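(* Let $\nu\ge -\frac12$ and $d_\nu=2\nu+2$. Let $0<\gamma<d_\nu$, let $\alpha,\beta\in\mathbb{R}$ satisfy $0\le \alpha+\beta\le\gamma<d_\nu$, and let $1<p\le q<\frac{d_\nu}{\gamma-\alpha-\beta}$. Assume that $s$ and $t$ satisfy $$1<s\le t<\infty,\qquad \frac1t=\frac1q-\frac{\gamma-\alpha-\beta}{d_\nu},\qquad \frac st=\frac pq,$$ and that $\alpha<\frac{d_\nu}{q'}$ and $\beta<\frac{d_\nu}{t}$, where $\frac1q+\frac1{q'}=1$. Assume in addition that $d_\nu>t$. Then there is a constant $C>0$, independent of $f$, such that $$\big\||\cdot|^{-\beta}M_\gamma^\nu f\big\|_{L^{s,t}(\mathbb{R},d\mu_\nu)}\le C\,\big\||\cdot|^{\alpha}f\big\|_{L^{p,q}(\mathbb{R},d\mu_\nu)}$$ for all $f$ with $|\cdot|^\alpha f\in L^{p,q}(\mathbb{R},d\mu_\nu)$.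
   Context: Fix a real number $\nu\ge-\frac12$ and put $d_\nu=2\nu+2$. Measure: $d\mu_\nu(x)=(2^{\nu+1}\Gamma(\nu+1))^{-1}|x|^{2\nu+1}dx$ on $\mathbb{R}$. Functions are complex-valued and measurable. Dunkl translation: for $x,y\in\mathbb{R}$, $\tau_x^\nu f(y)=\int_{\mathbb{R}}f(z)\,d\sigma_{x,y}(z)$, where $\sigma_{x,y}$ is the signed measure (with $\sigma_{x,0}=\delta_x$, $\sigma_{0,y}=\delta_y$, and, for $x,y\ne0$ and $\nu>-\frac12$, absolutely continuous with respect to $\mu_\nu$) given explicitly for $\nu>-\frac12$ by $$\tau_x^\nu f(y)=\frac{C_\nu}{2}\int_{-1}^{1}\Big[f(\rho_u)\Big(1+\frac{x+y}{\rho_u}\Big)+f(-\rho_u)\Big(1-\frac{x+y}{\rho_u}\Big)\Big](1+u)(1-u^2)^{\nu-\frac12}\,du,$$ with $\rho_u=\sqrt{x^2+y^2+2xyu}$, $C_\nu=\frac{\Gamma(\nu+1)}{\sqrt\pi\,\Gamma(\nu+\frac12)}$, and $\frac{x+y}{\rho_u}$ read as $0$ when $\rho_u=0$. For $\nu=-\frac12$, $\tau_x^\nu f(y)=f(x+y)$. For $f$ locally integrable with respect to $\mu_\nu$, $\tau_x^\nu f(y)$ is defined for almost every $y$. One has $\tau_x^\nu f(y)=\tau_y^\nu f(x)$. Dunkl fractional maximal function: for $0<\gamma<d_\nu$ and $f\in L^1_{loc}(\mathbb{R},d\mu_\nu)$, $$M_\gamma^\nu f(x)=\sup_{r>0}\frac{1}{\mu_\nu(B(0,r))^{1-\frac{\gamma}{d_\nu}}}\int_{B(0,r)}\tau_x^\nu|f|(y)\,d\mu_\nu(y),\qquad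 B(0,r)=(-r,r).$$ Dunkl Morrey space: for $1\le p\le q<\infty$, $L^{p,q}(\mathbb{R},d\mu_\nu)$ is the set of locally integrable functions $f$ on $\mathbb{R}$ with $$\|f\|_{L^{p,q}(\mathbb{R},d\mu_\nu)}=\sup_{x\in\mathbb{R},\,r>0} r^{d_\nu(\frac1q-\frac1p)}\Big(\int_{B(0,r)}\tau_x^\nu(|f|^p)(y)\,d\mu_\nu(y)\Big)^{1/p}<\infty$$ (the norm is $+\infty$ if $|f|^p$ is not locally integrable). Convention: when $\gamma=\alpha+\beta$, the condition $q<\frac{d_\nu}{\gamma-\alpha-\beta}$ means $q<\infty$. The notation $|\cdot|^{a}f$ denotes the function $x\mapsto|x|^{a}f(x)$. *)

(* Defs.v *)
From HB Require Import structures.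
From mathcomp Require Import all_boot all_order all_algebra.
From mathcomp Require Import all_classical all_reals all_analysis.
From mathcomp Require Import measurable_realfun complex.

Set Implicit Arguments.
Unset Strict Implicit.
Unset Printing Implicit Defensive.

Import Order.TTheory GRing.Theory Num.Theory.
Import numFieldNormedType.Exports.

Local Open Scope classical_set_scope.
Local Open Scope ring_scope.

(* Euler's integral, used below only at arguments a > 0, where it converges. *)
Definition euler_Gamma {R : realType} (a : R) : R :=
  (\int[lebesgue_measure]_(x in `]0%R, +oo[) (x `^ (a - 1) * expR (- x)))%R.

Definition dunkl_dim {R : realType} (nu : R) : R := 2 * nu + 2.

Definition dunkl_density {R : realType} (nu x : R) : R :=
  (2 `^ (nu + 1) * euler_Gamma (nu + 1))^-1 * `|x| `^ (2 * nu + 1).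

Definition dunkl_measure {R : realType} (nu : R) (A : set R) : \bar R :=
  (\int[lebesgue_measure]_(x in A) (dunkl_density nu x)%:E)%E.

Lemma euler_Gamma_ge0 {R : realType} (a : R) : 0 <= euler_Gamma a.
Proof. by apply: Rintegral_ge0 => x _; rewrite mulr_ge0 ?powR_ge0 ?expR_ge0. Qed.

Lemma dunkl_density_ge0 {R : realType} (nu x : R) : 0 <= dunkl_density nu x.
Proof.
by rewrite mulr_ge0 ?invr_ge0 ?mulr_ge0 ?powR_ge0 ?euler_Gamma_ge0.
Qed.

Lemma measurable_dunkl_density {R : realType} (nu : R) :
  measurable_fun setT (dunkl_density nu).
Proof.
apply: measurable_funM => //.
by apply: (measurableT_comp (measurable_powR _)); exact: normr_measurable.
Qed.

Lemma dunkl_measure0 {R : realType} (nu : R) : dunkl_measure nu set0 = 0%E.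
Proof. by rewrite /dunkl_measure integral_set0. Qed.

Lemma dunkl_measure_ge0 {R : realType} (nu : R) (A : set R) :
  (0 <= dunkl_measure nu A)%E.
Proof. by apply: integral_ge0 => x _; rewrite lee_fin dunkl_density_ge0. Qed.

Lemma dunkl_measure_sigma_additive {R : realType} (nu : R) :
  semi_sigma_additive (dunkl_measure nu).
Proof.
move=> /= F mF tF mUF; rewrite /dunkl_measure; apply: cvg_toP.
  apply: ereal_nondecreasing_is_cvgn => m n mn.
  by apply: lee_sum_nneg_natr => // k _ _; exact: dunkl_measure_ge0.
rewrite ge0_integral_bigcup//=.
- apply/measurable_funTS/measurableT_comp => //.
  exact: measurable_dunkl_density.
- by move=> x _; rewrite lee_fin dunkl_density_ge0.
Qed.

HB.instance Definition _ (R : realType) (nu : R) :=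
  isMeasure.Build _ _ _ (dunkl_measure nu) (dunkl_measure0 nu)
    (dunkl_measure_ge0 nu) (@dunkl_measure_sigma_additive R nu).

Definition dunkl_transl_const {R : realType} (nu : R) : R :=
  euler_Gamma (nu + 1) / (Num.sqrt pi * euler_Gamma (nu + 2^-1)).

(* [dunkl_transl nu x g y] is tau_x^nu g(y). Since [0^-1 = 0], the quotient
   (x + y) / rho is 0 when rho = 0, and for nu > -1/2 the formula reduces to
   g x when y = 0 and to g y when x = 0. Functions are [\bar R]-valued so that
   the maximal function, which may be infinite at some points, can be
   translated. The kernel takes both signs; for locally integrable g the
   set of y where the integrand is not integrable is null. *)
Definition dunkl_transl {R : realType} (nu x : R) (g : R -> \bar R) (y : R) :
    \bar R :=
  if nu == - 2^-1 then g (x + y) else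
  ((dunkl_transl_const nu / 2)%:E *
   \int[lebesgue_measure]_(u in `](- 1)%R, 1%R[)
     let rho := Num.sqrt (x ^+ 2 + y ^+ 2 + 2 * x * y * u) in
     (g rho * (1 + (x + y) / rho)%:E + g (- rho)%R * (1 - (x + y) / rho)%:E) *
     ((1 + u) * (1 - u ^+ 2) `^ (nu - 2^-1))%:E)%E.

Definition dunkl_locally_integrable {R : realType} (nu : R) (g : R -> \bar R) :
    Prop :=
  measurable_fun setT g /\
  forall K : set R, compact K ->
    (\int[dunkl_measure nu]_(x in K) `|g x| < +oo)%E.

Definition dunkl_morrey_avg {R : realType} (nu p q : R) (g : R -> \bar R)
    (x r : R) : \bar R :=
  ((r `^ (dunkl_dim nu * (q^-1 - p^-1)))%:E *
   poweR (\int[dunkl_measure nu]_(y in `](- r)%R, r[)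
            dunkl_transl nu x (fun z => poweR `|g z| p) y) p^-1)%E.

Definition dunkl_morrey_norm {R : realType} (nu p q : R) (g : R -> \bar R) :
    \bar R :=
  if `[< dunkl_locally_integrable nu (fun z => poweR `|g z|%E p) >] then
    ereal_sup [set dunkl_morrey_avg nu p q g x r | x in setT & r in [set r | 0 < r]]
  else +oo%E.

(* Extended real-valued so that it can be fed to the operators above; the
   Morrey norm and the maximal function of a complex function depend on its
   modulus only. *)
Definition cmodulus {R : realType} (f : R -> R[i]) (x : R) : \bar R :=
  (ComplexField.Normc.normc (f x))%:E.

Definition cmeasurable {R : realType} (f : R -> R[i]) : Prop :=
  measurable_fun setT (fun x => complex.Re (f x)) /\
  measurable_fun setT (fun x => complex.Im (f x)).

Definition dunkl_morrey {R : realType} (nu p q : R) : set (R -> R[i]) :=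
  [set f | [/\ cmeasurable f,
               dunkl_locally_integrable nu (cmodulus f) &
               (dunkl_morrey_norm nu p q (cmodulus f) < +oo)%E]].

Definition dunkl_fmax_avg {R : realType} (nu gamma : R) (f : R -> R[i])
    (x r : R) : \bar R :=
  ((((fine (dunkl_measure nu `](- r)%R, r[)) `^ (1 - gamma / dunkl_dim nu))^-1)%R%:E *
   \int[dunkl_measure nu]_(y in `](- r)%R, r[)
      dunkl_transl nu x (cmodulus f) y)%E.

Definition dunkl_fmax {R : realType} (nu gamma : R) (f : R -> R[i]) (x : R) :
    \bar R :=
  ereal_sup [set dunkl_fmax_avg nu gamma f x r | r in [set r | 0 < r]].

(* Since 0 `^ a = 0 for a <> 0, the weighted functions vanish at the origin, a
   null set for the Dunkl measure. *)
Definition cpow_weight {R : realType} (a : R) (f : R -> R[i]) (x : R) : R[i] :=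
  real_complex R (`|x| `^ a) * f x.

Definition epow_weight {R : realType} (a : R) (g : R -> \bar R) (x : R) : \bar R :=
  ((`|x| `^ a)%:E * g x)%E.

(* Main.v *)
From HB Require Import structures.
Require Import Defs.
From mathcomp Require Import all_boot all_order all_algebra.
From mathcomp Require Import all_classical all_reals all_analysis.
From mathcomp Require Import complex measurable_realfun ring lra.

(* Write d = 2 nu + 2; the hypotheses 1 < s <= t < d exclude nu = -1/2. For a
   nonnegative g, the part of the kernel of tau_x that changes sign integrates to
   zero over a ball, so that the integral of tau_x g over B(0,r) is comparable to
   (r/(|x|+r))^(d-1) times the integral of g over the shell ||z|-|x|| < r (for the
   lower bound: over |z-x| < r/2, when r <= |x|). Morrey norms and the maximal
   function thus become averages over shells.

   Let A be the Morrey norm of H = |.|^alpha |f|. In the supremum defining the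
   maximal function at y, the radii r <= |y|/2 see constant weights and a constant
   density, and the averages are one-dimensional; they are at most C A r^(-d/q),
   which controls the power s - p of their s-th power (as in Hedberg's
   inequality), and the remaining p-th power is handled by the Hardy-Littlewood
   maximal theorem. The radii r >= |y|/2 contribute at most C A |y|^(-d/t). This
   is in the target space if p < q; if p = q, so that s = t, one uses instead that
   this contribution is a Hardy operator, bounded between weighted Lebesgue spaces. *)

Set Implicit Arguments.
Unset Strict Implicit.
Unset Printing Implicit Defensive.

Import Order.TTheory GRing.Theory Num.Theory.
Import numFieldNormedType.Exports HBNNSimple.
Local Open Scope classical_set_scope.
Local Open Scope ring_scope.

(** * Changes of variables and integrals of powers *)

(** With b = d/t, all exponents come from b = d/q - (gamma - alpha - beta) and s b = d p/q; the
    second makes the powers of r cancel once s - p of the s factors of a local average are bounded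
    by the Morrey norm. The condition alpha + beta >= 0 lets |y|^(-(alpha+beta)) be replaced by
    r^(-(alpha+beta)) for r <= |y|/2; alpha < d/q' makes |.|^(-alpha) H locally integrable; beta <
    d/t makes the bound for r >= |y|/2 decrease in r, so that r = |y|/2 is the worst radius.

    The obstacle is the kernel of tau_x: it is signed and its factor (x + y)/rho is unbounded. Only
    its integrals over balls centred at 0 are compared. There the odd part disappears and the
    coefficients of g(rho) and g(-rho) become 1 + v and 1 - v, where v is the cosine of an angle of
    the triangle with sides |x|, |y|, rho. When |y| < r <= |x|, v has the sign of x, so the lower
    bound sees only the half of the shell on the side of x; the other half comes from the
    translation by -x. *)

Section density.
Local Open Scope ereal_scope.
Context d d' (T : measurableType d) (T' : measurableType d') (R : realType).
Variables (mu : {measure set T -> \bar R}) (m : {measure set T' -> \bar R}).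
Variables (phi : T -> T') (w : T -> R).
Hypotheses (mphi : measurable_fun setT phi).
Hypotheses (mw : measurable_fun setT w) (w0 : forall x, (0 <= w x)%R).
Hypothesis mE : forall A, measurable A ->
  m A = \int[mu]_(x in phi @^-1` A) (w x)%:E.

Let mwE D : measurable_fun D (EFin \o w).
Proof. exact/measurable_EFinP/measurable_funTS. Qed.

(** The hypothesis [mE] is the case of indicators; simple functions follow by linearity and the rest
    by monotone convergence. With [phi] the identity this is integration against a density, with [w]
    a Jacobian it is a change of variables. *)
Lemma ge0_integral_density_comp D (f : T' -> \bar R) :
  measurable D -> measurable_fun D f -> (forall x, D x -> 0 <= f x) ->
  \int[m]_(y in D) f y = \int[mu]_(x in phi @^-1` D) (f (phi x) * (w x)%:E).
Proof.
move=> mD mf f0.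
have mpre A : measurable A -> measurable (phi @^-1` A).
  by move=> mA; rewrite -[X in measurable X]setTI; exact: mphi.
have mpD := mpre _ mD.
pose f_ := nnsfun_approx mD mf.
have mfp n : measurable_fun setT (f_ n \o phi) by exact: measurableT_comp.
transitivity (limn (fun n => \int[m]_(x in D) (f_ n x)%:E)).
  rewrite -monotone_convergence//.
  - by apply: eq_integral => y /[!inE] yD; apply/esym/cvg_lim => //; exact: cvg_nnsfun_approx.
  - by move=> n; exact/measurable_EFinP/measurable_funTS.
  - by move=> n y _; rewrite lee_fin.
  - by move=> y _ a b ab; rewrite lee_fin; exact/lefP/nd_nnsfun_approx.
transitivity (limn (fun n =>
    \int[mu]_(x in phi @^-1` D) ((f_ n (phi x))%:E * (w x)%:E))); last first.
  rewrite -monotone_convergence//; last 3 first.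
  - move=> n; apply: emeasurable_funM; last exact: mwE.
    exact/measurable_EFinP/measurable_funTS/mfp.
  - by move=> n y _; rewrite mule_ge0// lee_fin.
  - move=> y _ a b ab; rewrite lee_wpmul2r ?lee_fin//; exact/lefP/nd_nnsfun_approx.
  apply: eq_integral => y /[!inE] yD; apply/cvg_lim => //.
  by apply: cvgeZr => //; exact: cvg_nnsfun_approx.
congr (limn _); apply/funext => n.
have mfr r : measurable (phi @^-1` (f_ n @^-1` [set r])) by exact: mpre.
under eq_integral do rewrite fimfunE -fsumEFin//.
rewrite ge0_integral_fsum//; last 2 first.
  - by move=> y; exact/measurable_EFinP/measurable_funM.
  - by move=> y x _; rewrite nnfun_muleindic_ge0.
under [RHS]eq_integral => x xD.
  rewrite fimfunE -fsumEFin// ge0_mule_fsuml; last first.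
    by move=> r; rewrite EFinM nnfun_muleindic_ge0.
  over.
have mind r : measurable_fun (phi @^-1` D) (fun x => (\1_(f_ n @^-1` [set r]) (phi x) : R)%:E).
  apply/measurable_EFinP/measurable_funTS.
  by rewrite (_ : (fun _ => _) = \1_(phi @^-1` (f_ n @^-1` [set r]))).
rewrite /= ge0_integral_fsum//; last 2 first.
  - by move=> y; apply: emeasurable_funM => //; under eq_fun do rewrite EFinM;
      exact: emeasurable_funM.
  - by move=> y x _; apply: mule_ge0; [rewrite EFinM nnfun_muleindic_ge0|rewrite lee_fin].
apply: eq_fsbigr => r rf.
rewrite integralZl_indic_nnsfun// integral_indic//= mE; last exact: measurableI.
have r0 : (0 <= r)%R by move: rf; rewrite inE => -[x _ <-].
under [RHS]eq_integral do rewrite EFinM -muleA.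
rewrite ge0_integralZl//; last 2 first.
  - by apply: emeasurable_funM => //; exact: mind.
  - by move=> x _; rewrite mule_ge0 ?lee_fin.
congr (_ * _); rewrite setIC integral_mkcondr; apply: eq_integral => x _.
rewrite patchE indicE; have [xr|xr] := eqVneq (f_ n (phi x)) r.
  by rewrite !mem_set ?mul1e.
by rewrite !memNset ?mul0e//; exact/eqP.
Qed.

Lemma integral_density_comp D (f : T' -> \bar R) :
  measurable D -> measurable_fun D f ->
  \int[m]_(y in D) f y = \int[mu]_(x in phi @^-1` D) (f (phi x) * (w x)%:E).
Proof.
move=> mD mf; rewrite integralE [RHS]integralE.
rewrite !ge0_integral_density_comp//; [|exact: measurable_funeneg|exact: measurable_funepos].
by congr (_ - _); apply: eq_integral => x _;
  rewrite ?funeposE ?funenegE maxe_pMl ?lee_fin// ?mul0e// ?mulNe.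
Qed.

End density.

(** * Substitution in Lebesgue integrals *)

Section change_of_variables.
Local Open Scope ereal_scope.
Context (R : realType).
Local Notation leb := (@lebesgue_measure R).
Variables (phi J : R -> R).
Hypotheses (mphi : measurable_fun setT phi) (mJ : measurable_fun setT J).
Hypothesis J0 : forall x, (0 <= J x)%R.
Hypothesis phiJ : forall a b : R, (a < b)%R ->
  \int[leb]_(y in phi @^-1` `]a, b]) (J y)%:E = (b - a)%:E.

Let m (A : set (measurableTypeR R)) : \bar R :=
  \int[leb]_(y in phi @^-1` A) (J y)%:E.

Let m0 : m set0 = 0. Proof. by rewrite /m preimage_set0 integral_set0. Qed.

Let m_ge0 A : 0 <= m A.
Proof. by apply: integral_ge0 => x _; rewrite lee_fin. Qed.

Let mpre (A : set (measurableTypeR R)) : measurable A ->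
  measurable (phi @^-1` A : set (measurableTypeR R)).
Proof. by move=> mA; rewrite -[X in measurable X]setTI; exact: mphi. Qed.

Let m_sigma : semi_sigma_additive m.
Proof.
move=> /= F mF tF mUF; rewrite /m; apply: cvg_toP.
  apply: ereal_nondecreasing_is_cvgn => k n kn.
  by apply: lee_sum_nneg_natr => // i _ _; exact: m_ge0.
rewrite preimage_bigcup ge0_integral_bigcup//=.
- by move=> k; exact: mpre.
- exact/measurable_funTS/measurable_EFinP.
- by move=> x _; rewrite lee_fin.
- by apply/trivIsetP => i j _ _ ij; rewrite -preimage_setI (trivIsetP.1 tF)// preimage_set0.
Qed.

Let mm : {measure set (measurableTypeR R) -> \bar R} :=
  HB.pack m (isMeasure.Build _ _ _ m m0 m_ge0 m_sigma).

(** By [phiJ], the image under [phi] of the measure with density [J] agrees with Lebesgue measure on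
    half-open intervals, hence everywhere by uniqueness. *)
Lemma ge0_integral_subst (f : R -> \bar R) :
  measurable_fun setT f -> (forall x, 0 <= f x) ->
  \int[leb]_x f x = \int[leb]_y (f (phi y) * (J y)%:E).
Proof.
move=> mf f0.
rewrite -[X in _ = \int[leb]_(x in X) _](preimage_setT phi).
rewrite -(@ge0_integral_density_comp _ _ _ _ _ leb mm phi J)//.
apply: (@eq_measure_integral _ _ _ setT mm leb f) => A mA _.
apply: (@lebesgue_measure_unique _ mm) => // _ [[a b]] _ <-.
rewrite /mm /= /m lebesgue_measure_itv/= lte_fin.
case: ltP => ab; first by rewrite phiJ.
by rewrite set_itv_ge ?bnd_simp -?leNgt// preimage_set0 integral_set0.
Qed.

End change_of_variables.

Lemma measurable_powR_comp d (T : measurableType d) (R : realType) (D : set T)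
    (g : T -> R) e :
  measurable_fun D g -> measurable_fun D (fun x => g x `^ e).
Proof. by move=> mg; exact: (measurableT_comp (measurable_powR e)). Qed.

(** * Integrals of powers; affine and quadratic substitutions *)

Section one_dim.
Context (R : realType).
Local Notation leb := (@lebesgue_measure R).
Implicit Types (f F : R -> R) (a b e : R).

Lemma integral_oc_FTC f F a b : a < b ->
  {in `[a, b], continuous f} ->
  (forall x, a <= x <= b -> is_derive x 1 F (f x)) ->
  (\int[leb]_(x in `]a, b]) (f x)%:E = (F b - F a)%:E)%E.
Proof.
move=> ab cf dF.
have cF x : a <= x <= b -> {for x, continuous F}.
  by move=> xab; apply/differentiable_continuous/derivable1_diffP; case: (dF x xab).
have cwf : {within `[a, b], continuous f}.
  by apply: continuous_in_subspaceT => x /[!inE]; exact: cf.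
rewrite integral_itv_obnd_cbnd; last first.
  apply/measurable_EFinP; apply: measurable_funS (subspace_continuous_measurable_fun _ cwf) => //.
  by move=> x /=; rewrite !in_itv/= => /andP[/ltW -> ->].
rewrite (@continuous_FTC2 _ _ F _ _ ab cwf) ?EFinB//.
- split.
  + by move=> x /[!in_itv]/= /andP[ax xb]; case: (dF x) => //; rewrite !ltW.
  + by apply: cvg_at_right_filter; apply: cF; rewrite lexx ltW.
  + by apply: cvg_at_left_filter; apply: cF; rewrite lexx ltW.
- move=> x /[!in_itv]/= /andP[ax xb].
  by rewrite derive1E; case: (dF x) => //; rewrite !ltW.
Qed.

Lemma integral_oc_powR a b e : 0 < a -> a <= b -> e != 0 ->
  (\int[leb]_(x in `]a, b]) (x `^ (e - 1))%:E = (e^-1 * (b `^ e - a `^ e))%:E)%E.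
Proof.
move=> a0; rewrite le_eqVlt => /predU1P[<-|ab] e0.
  by rewrite set_itvoc0 integral_set0 subrr mulr0.
rewrite mulrBr; apply: (@integral_oc_FTC _ (fun x => e^-1 * x `^ e)) => //.
- move=> x /[!in_itv]/= /andP[ax xb].
  have x0 : 0 < x by exact: lt_le_trans ax.
  apply/differentiable_continuous/derivable1_diffP.
  by apply: derivable_powR; rewrite in_itv/= x0.
- move=> x /andP[ax xb]; have x0 : 0 < x by exact: lt_le_trans ax.
  have -> : x `^ (e - 1) = e^-1 *: (e * x `^ (e - 1)) by rewrite /GRing.scale/= mulKf.
  by apply: is_deriveZ; exact: is_derive1_powR.
Qed.

Lemma ge0_lim_integral_eq (F : (set R)^nat) (A : set R) (f : R -> \bar R)
    (l : R^nat) (v : R) :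
  nondecreasing_seq F -> (forall i, measurable (F i)) -> \bigcup_i F i = A ->
  measurable_fun A f -> (forall x, A x -> (0 <= f x)%E) ->
  (forall i, \int[leb]_(x in F i) f x = (l i)%:E)%E -> l @ \oo --> v ->
  (\int[leb]_(x in A) f x = v%:E)%E.
Proof.
move=> ndF mF <- mf f0 fl lv.
have mfi i : measurable_fun (F i) f.
  by apply: measurable_funS mf; [exact: bigcup_measurable|exact: bigcup_sup].
have := @ge0_nondecreasing_set_cvg_integral _ (measurableTypeR R) _ F f leb ndF mF mfi
  (fun i x Fx => f0 x (ex_intro2 _ _ i I Fx)).
move=> h; apply: (cvg_unique _ h) => //.
have -> : (fun i => \int[leb]_(x in F i) f x)%E = EFin \o l.
  by apply/funext => i; rewrite fl.
exact: cvg_comp lv _.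
Qed.

Lemma integral_0b_powR b e : 0 < b -> 0 < e ->
  (\int[leb]_(x in `]0%R, b[) (x `^ (e - 1))%:E = (e^-1 * b `^ e)%:E)%E.
Proof.
move=> b0 e0.
have mp : measurable_fun `]0, b] (fun x : R => (x `^ (e - 1))%:E).
  by apply/measurable_EFinP; apply: measurable_powR_comp; exact: measurable_id.
rewrite integral_itv_bndo_bndc; last first.
  by apply: measurable_funS mp => // x /=; rewrite !in_itv/= => /andP[-> /ltW].
pose a n : R := b / n.+1%:R.
have a0 n : 0 < a n by rewrite divr_gt0.
have ab n : a n <= b by rewrite ler_pdivrMr// ler_peMr ?(ltW b0)// ler1n.
apply: (@ge0_lim_integral_eq (fun n => `]a n, b]%classic) _ _
  (fun n => e^-1 * (b `^ e - a n `^ e))) => //.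
- apply/nondecreasing_seqP => n; rewrite subsetEset => x /=.
  rewrite !in_itv/= => /andP[ax ->]; rewrite andbT (le_lt_trans _ ax)//.
  by rewrite ler_pM2l// lef_pV2 ?posrE// ler_nat.
- apply/seteqP; split => x /=.
    by move=> [n _]; rewrite /= !in_itv/= => /andP[/(lt_trans (a0 n)) -> ->].
  rewrite in_itv/= => /andP[x0 xb]; exists (Num.truncn (b / x)) => //=.
  rewrite in_itv/= xb andbT ltr_pdivrMr// mulrC -ltr_pdivrMr//.
  by rewrite truncnS_gt.
- by move=> x _; rewrite lee_fin powR_ge0.
- by move=> n; rewrite integral_oc_powR// gt_eqF.
- have ae : a n `^ e @[n --> \oo] --> (0 : R).
    have /cvg_at_rightP := powR_cvg0 e0; apply; split => //.
    rewrite -[X in _ --> X](mulr0 b); apply: cvgM; first exact: cvg_cst.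
    exact: cvg_harmonic.
  rewrite -[X in e^-1 * X]subr0; apply: cvgM; first exact: cvg_cst.
  by apply: cvgB => //; exact: cvg_cst.
Qed.

Lemma integral_by_powR b e : 0 < b -> 0 < e ->
  (\int[leb]_(x in `]b, +oo[) (x `^ (- e - 1))%:E = (e^-1 * b `^ (- e))%:E)%E.
Proof.
move=> b0 e0.
have mp : measurable_fun `]b, +oo[ (fun x : R => (x `^ (- e - 1))%:E).
  by apply/measurable_EFinP; apply: measurable_powR_comp; exact: measurable_id.
pose a n : R := b + n%:R.
have a0 n : 0 < a n by rewrite ltr_wpDr.
have ab n : b <= a n by rewrite lerDl.
apply: (@ge0_lim_integral_eq (fun n => `]b, a n]%classic) _ _
  (fun n => e^-1 * (b `^ (- e) - a n `^ (- e)))) => //.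
- apply/nondecreasing_seqP => n; rewrite subsetEset => x /=.
  rewrite !in_itv/= => /andP[-> ax]; rewrite (le_trans ax)//.
  by rewrite lerD2l ler_nat.
- apply/seteqP; split => x /=.
    by move=> [n _]; rewrite /= !in_itv/= => /andP[->].
  rewrite in_itv/= andbT => bx; exists (Num.truncn (x - b)).+1 => //=.
  rewrite in_itv/= bx/= -lerBlDl ltW//.
  by rewrite truncnS_gt.
- by move=> x _; rewrite lee_fin powR_ge0.
- move=> n; rewrite integral_oc_powR ?oppr_eq0 ?(gt_eqF e0)//.
  by rewrite invrN mulNr -mulrN opprB.
- have ae : a n `^ (- e) @[n --> \oo] --> (0 : R).
    rewrite (_ : (fun n => _) = (fun n => (a n)^-1 `^ e)); last first.
      by apply/funext => n; rewrite -[(a n)^-1]powR_inv1 ?(ltW (a0 n))// -powRrM mulN1r.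
    have /cvg_at_rightP := powR_cvg0 e0; apply; split => //.
      by move=> n; rewrite invr_gt0.
    apply/gtr0_cvgV0; first by near=> n.
    have h : (fun n => n%:R : R) x @[x --> \oo] --> +oo%R by exact: cvgr_idn.
    have := cvg_comp _ _ h (cvg_addrl b); exact.
  rewrite -[X in e^-1 * X]subr0; apply: cvgM; first exact: cvg_cst.
  by apply: cvgB => //; exact: cvg_cst.
Unshelve. all: by end_near. Qed.

Lemma ge0_integral_affine (c e : R) (f : R -> \bar R) : 0 < c ->
  measurable_fun setT f -> (forall x, (0 <= f x)%E) ->
  (\int[leb]_x f x = \int[leb]_y (f (e + c * y)%R * c%:E))%E.
Proof.
move=> c0 mf f0.
apply: (@ge0_integral_subst _ (fun y => e + c * y)%R (fun=> c)) => //.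
- by apply: measurable_funD => //; exact: measurable_funM.
- by move=> _; exact: ltW.
move=> a b ab.
rewrite (_ : _ @^-1` _ = `](a - e) / c, (b - e) / c]%classic); last first.
  apply/seteqP; split => x /=; rewrite !in_itv/= ltr_pdivrMr// ler_pdivlMr//;
  by rewrite ltrBlDl lerBrDl ![x * c]mulrC.
rewrite integral_cst//= lebesgue_measure_itv/= lte_fin ltr_pM2r ?invr_gt0//.
rewrite ltrD2r ab -EFinB -EFinM -mulrBl; congr EFin.
by rewrite mulrC divfK ?gt_eqF//; lra.
Qed.

Lemma ge0_integral_oppr (f : R -> \bar R) :
  measurable_fun setT f -> (forall x, (0 <= f x)%E) ->
  (\int[leb]_x f x = \int[leb]_y f (- y)%R)%E.
Proof.
move=> mf f0.
rewrite (@ge0_integral_subst _ -%R (fun=> 1))//.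
- by under eq_integral do rewrite mule1.
move=> a b ab.
rewrite (_ : _ @^-1` _ = `[- b, - a[%classic); last first.
  by apply/seteqP; split => x /=; rewrite !in_itv/= ltrNr lerNl andbC.
rewrite integral_cst//= mul1e lebesgue_measure_itv/= lte_fin ltrN2 ab.
by rewrite opprK -EFinD addrC.
Qed.

Lemma ge0_integral_sqr (f : R -> \bar R) :
  measurable_fun setT f -> (forall x, (0 <= f x)%E) ->
  (\int[leb]_(x in `]0%R, +oo[) f x =
   \int[leb]_(y in `]0%R, +oo[) (f (y ^+ 2)%R * (2 * y)%:E))%E.
Proof.
move=> mf f0.
(* The substitution lemma works with maps of the whole line whose image measure is Lebesgue measure,
   so squaring is continued by the identity on the negative half-line. *)
pose phi y : R := if 0 < y then y ^+ 2 else y.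
pose J y : R := if 0 < y then 2 * y else 1.
have mpos : measurable [set x : R | 0 < x].
  rewrite (_ : [set x : R | 0 < x] = `]0, +oo[%classic)//.
  by apply/seteqP; split => x /=; rewrite in_itv/= andbT.
have mif (g h : R -> R) : measurable_fun setT g -> measurable_fun setT h ->
    measurable_fun setT (fun y : R => if 0 < y then g y else h y).
  move=> mg mh; apply: measurable_fun_ifT => //.
  by apply: measurable_fun_ltr.
pose g x := (f x * (\1_(`]0%R, +oo[%classic : set R) x)%:E)%E.
have mg : measurable_fun setT g by apply: emeasurable_funM => //; exact/measurable_EFinP.
have conv (h : R -> \bar R) : (\int[leb]_(x in `]0%R, +oo[) h x =
    \int[leb]_x (h x * (\1_(`]0%R, +oo[%classic : set R) x)%:E))%E.
  rewrite integral_mkcond; apply: eq_integral => x _; rewrite patchE indicE.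
  by case: ifPn => _; rewrite ?mule1 ?mule0.
rewrite !conv -/g.
transitivity (\int[leb]_y (g (phi y) * (J y)%:E))%E; last first.
  apply: eq_integral => y _; rewrite /g /phi /J !indicE.
  have [y0|y0] := ltP 0 y.
    by rewrite !mem_set/= ?in_itv/= ?exprn_gt0 ?y0// !mule1.
  by rewrite !memNset/= ?in_itv/= ?andbT; [rewrite !mule0 mul0e|apply/negP; rewrite -leNgt..].
have JE (a b : R) : 0 <= a -> a < b ->
    (\int[leb]_(y in `]a, b]) (J y)%:E = (b ^+ 2 - a ^+ 2)%:E)%E.
  move=> a0 ab; under eq_integral => x.
    rewrite inE/= in_itv/= => /andP[ax _]; rewrite /J (le_lt_trans a0 ax); over.
  apply: (@integral_oc_FTC (fun x => 2 * x) (fun x => x ^+ 2)) => //.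
    by move=> x _; apply: cvgM; [exact: cvg_cst|exact: cvg_id].
  move=> x _; apply: is_derive_eq; rewrite /GRing.scale/=; ring.
have J1 (a b : R) : b <= 0 -> a < b ->
    (\int[leb]_(y in `]a, b]) (J y)%:E = (b - a)%:E)%E.
  move=> b0 ab; under eq_integral => x.
    rewrite inE/= in_itv/= => /andP[_ xb]; rewrite /J ltNge (le_trans xb b0) /=; over.
  by rewrite integral_cst//= mul1e lebesgue_measure_itv/= lte_fin ab.
apply: ge0_integral_subst => //.
- exact: mif.
- by apply: mif => //; exact: measurable_funM.
- by move=> x; rewrite /J; case: ltP => // x0; rewrite mulr_ge0// ltW.
- move=> a b ab.
  (* The inverse of [phi], used through the equivalence of psi x < y and x < phi y: preimages of
     intervals are then intervals with endpoints psi a and psi b. *)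
  pose psi (x : R) := if 0 < x then Num.sqrt x else x.
  have psi_lt x y : (psi x < y) = (x < phi y).
    rewrite /psi /phi; case: (ltP 0 x) => x0; case: (ltP 0 y) => y0 //.
    + by rewrite -[X in _ < X](ger0_norm (ltW y0)) -sqrtr_sqr ltr_sqrt ?exprn_gt0.
    + by rewrite !ltNge (le_trans y0) ?sqrtr_ge0// (le_trans y0 (ltW x0)).
    + by rewrite (le_lt_trans x0 y0) (le_lt_trans x0)// exprn_gt0.
  rewrite (_ : _ @^-1` _ = `]psi a, psi b]%classic); last first.
    apply/seteqP; split => x /=; rewrite !in_itv/= psi_lt => /andP[-> /=];
    by rewrite !leNgt psi_lt.
  rewrite /psi; case: (ltP 0 a) => a0; case: (ltP 0 b) => b0.
  + by rewrite JE ?sqrtr_ge0 ?ltr_sqrt// !sqr_sqrtr ?ltW.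
  + by move: (lt_le_trans a0 (le_trans (ltW ab) b0)); rewrite ltxx.
  + move: a0; rewrite le_eqVlt => /predU1P[->|a0].
      by rewrite JE ?sqrtr_gt0 // sqr_sqrtr ?ltW// expr0n.
    rewrite (@itv_bndbnd_setU _ _ _ (BRight 0))//; last 2 first.
      by rewrite bnd_simp ltW.
      by rewrite bnd_simp sqrtr_ge0.
    rewrite ge0_integral_setU//=; last 3 first.
    * apply/measurable_EFinP/measurable_funTS; apply: mif => //; exact: measurable_funM.
    * by move=> x _; rewrite lee_fin /J; case: ltP => // x0; rewrite mulr_ge0// ltW.
    * apply/disj_setPS => x [] /=; rewrite !in_itv/= => /andP[_ x0] /andP[].
      by rewrite ltNge x0.
    rewrite J1// JE ?sqrtr_gt0// sqr_sqrtr ?(ltW b0)// expr0n /= -EFinD; congr EFin; ring.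
  + by rewrite J1.
- by move=> x; rewrite mule_ge0// lee_fin.
Qed.

End one_dim.

(** * The Gegenbauer weight *)

Lemma le_of_eq (disp : Order.disp_t) (T : porderType disp) (x y : T) :
  x = y -> (x <= y)%O.
Proof. by move=> ->. Qed.
Section measurability.
Context d (T : measurableType d) (R : realType).
Implicit Types f g : T -> R.

Lemma measurable_fun_inv f :
  measurable_fun setT f -> measurable_fun setT (fun x => (f x)^-1).
Proof.
move=> mf.
rewrite (_ : (fun _ => _) = (fun x => f x * (f x ^+ 2) `^ (- 1))).
  apply: measurable_funM => //; apply: measurable_powR_comp.
  exact: measurable_funX.
apply/funext => x; rewrite powR_inv1 ?sqr_ge0//.
have [->|f0] := eqVneq (f x) 0; first by rewrite invr0 mul0r.
by rewrite expr2 invfM mulrA mulfV ?mul1r.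
Qed.

Lemma measurable_fun_sqrt f :
  measurable_fun setT f -> measurable_fun setT (fun x => Num.sqrt (f x)).
Proof.
move=> mf.
rewrite (_ : (fun _ => _) = (fun x => (Num.max (f x) 0) `^ (2^-1))).
  by apply: measurable_powR_comp; apply: measurable_maxr.
apply/funext => x; case: (leP 0 (f x)) => f0; first by rewrite powR12_sqrt.
by rewrite powR0 ?invr_neq0 ?ltr0_sqrtr.
Qed.

Lemma measurable_fun_nat_of_bool (b : T -> bool) :
  measurable_fun setT b -> measurable_fun setT (fun x => (b x)%:R : R).
Proof.
move=> mb; rewrite (_ : (fun _ => _) = (fun x => if b x then 1 else 0)).
  exact: measurable_fun_ifT.
by apply/funext => x; case: (b x).
Qed.

Lemma measurable_fun_itv_indic f (i : interval R) : measurable_fun setT f ->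
  measurable_fun setT (fun x => \1_([set` i]) (f x) : R).
Proof. by move=> mf; exact: measurableT_comp. Qed.

End measurability.

Lemma measurable_fun_EFin d (T : measurableType d) (R : realType) (f : T -> R) :
  measurable_fun setT f -> measurable_fun setT (fun x => (f x)%:E).
Proof. by move=> mf; exact/measurable_EFinP. Qed.

Lemma measurable_fun_norm d (T : measurableType d) (R : realType) (f : T -> R) :
  measurable_fun setT f -> measurable_fun setT (fun x => `|f x|).
Proof. by move=> mf; exact: measurableT_comp. Qed.

(** Structural recursion on the body of the function. The [change] clauses expand again the partial
    applications left by eta-reduction, so that the structural clauses match. *)
Ltac mfun1 :=
  match goal with
  | H : ?P |- ?P => exact: H
  | |- measurable_fun _ (fun=> _) => exact: measurable_cst
  | |- measurable_fun _ (fun x => x) => exact: measurable_id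
  | |- measurable_fun _ fst => exact: measurable_fst
  | |- measurable_fun _ snd => exact: measurable_snd
  | |- measurable_fun _ (fun x => x.1) => exact: measurable_fst
  | |- measurable_fun _ (fun x => x.2) => exact: measurable_snd
  | |- measurable_fun _ (fun x => _%:E) => apply: measurable_fun_EFin
  | |- measurable_fun _ (fun x => (_ * _)%E) => apply: emeasurable_funM
  | |- measurable_fun _ (fun x => _ `^ _) => apply: measurable_powR_comp
  | |- measurable_fun _ (fun x => \1_[set` _] _) => apply: measurable_fun_itv_indic
  | |- measurable_fun _ (fun x => (nat_of_bool _)%:R) => apply: measurable_fun_nat_of_bool
  | |- measurable_fun _ (fun x => _ < _) => apply: measurable_fun_ltr
  | |- measurable_fun _ (fun x => _ <= _) => apply: measurable_fun_ler
  | |- measurable_fun _ (fun x => _ && _) => apply: measurable_and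
  | |- measurable_fun _ (fun x => _ ^+ _) => apply: measurable_funX
  | |- measurable_fun _ (fun x => _ ^-1) => apply: measurable_fun_inv
  | |- measurable_fun _ (fun x => _ * _) => apply: measurable_funM
  | |- measurable_fun _ (fun x => _ - _) => apply: measurable_funB
  | |- measurable_fun _ (fun x => _ + _) => apply: measurable_funD
  | |- measurable_fun _ (fun x => @GRing.add _ _ _) => apply: emeasurable_funD
  | |- measurable_fun _ (fun x => adde _ _) => apply: emeasurable_funD
  | |- measurable_fun _ (fun x => - _) => apply: measurableT_comp
  | |- measurable_fun _ \1_[set` _] => apply: measurable_indic; exact: measurable_itv
  | |- measurable_fun ?D (+%R ?a) => change (measurable_fun D (fun y => a + y))
  | |- measurable_fun ?D ( *%R ?a) => change (measurable_fun D (fun y => a * y))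
  | |- measurable_fun ?D (<%O ?a) => change (measurable_fun D (fun y => a < y))
  | |- measurable_fun ?D (<=%O ?a) => change (measurable_fun D (fun y => a <= y))
  | |- measurable_fun _ Num.sqrt => exact: (measurable_fun_sqrt (@measurable_id _ _ _))
  | |- measurable_fun _ -%R => exact: oppr_measurable
  | |- measurable_fun _ Num.norm => exact: normr_measurable
  | |- measurable_fun _ (fun x => `|_|) => apply: measurable_fun_norm
  | |- measurable_fun _ (fun x => Num.sqrt _) => apply: measurable_fun_sqrt
  | H : measurable_fun setT ?g |- measurable_fun _ (fun x => ?g _) =>
    apply: (measurableT_comp H)
  end.
Ltac mfun := repeat mfun1.

Section integral_indic.
Context d (T : measurableType d) (R : realType) (mu : {measure set T -> \bar R}).

Lemma integral_mul_indic (A : set T) (f : T -> \bar R) :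
  (\int[mu]_(x in A) f x = \int[mu]_x (f x * (\1_A x)%:E))%E.
Proof.
rewrite integral_mkcond; apply: eq_integral => x _; rewrite patchE indicE.
by case: ifPn => _; rewrite ?mule1 ?mule0.
Qed.

Lemma ge0_integralZr_real (f : T -> \bar R) (k : R) :
  measurable_fun setT f -> (forall x, (0 <= f x)%E) -> 0 <= k ->
  (\int[mu]_x (f x * k%:E) = \int[mu]_x f x * k%:E)%E.
Proof. by move=> mf f0 k0; rewrite ge0_integralZr ?lee_fin. Qed.

Lemma ge0_integralZl_real (f : T -> \bar R) (k : R) :
  measurable_fun setT f -> (forall x, (0 <= f x)%E) -> 0 <= k ->
  (\int[mu]_x (k%:E * f x) = k%:E * \int[mu]_x f x)%E.
Proof. by move=> mf f0 k0; rewrite ge0_integralZl ?lee_fin. Qed.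

End integral_indic.

Lemma in_set_itv (R : realType) (i : interval R) (x : R) :
  (x \in [set` i]) = (x \in i).
Proof. by apply/idP/idP => /[!inE]. Qed.

Lemma powR_gt0E (R : realType) (x a : R) : 0 < x -> x `^ a = expR (a * ln x).
Proof. by move=> x0; rewrite /powR gt_eqF. Qed.

Section gegenbauer.
Context (R : realType) (nu : R).
Local Notation leb := (@lebesgue_measure R).

(** Extended by zero, so that substitutions in u and Tonelli's theorem are applied on the whole
    line. The factor 1 + u of the translation kernel is left out, which keeps the weight even. *)
Definition gegenbauer_weight (u : R) : R :=
  (1 - u ^+ 2) `^ (nu - 2^-1) * \1_(`](- 1)%R, 1%R[ : set R) u.
Local Notation W := gegenbauer_weight.

Lemma gegenbauer_weight_ge0 u : 0 <= W u.
Proof. by rewrite mulr_ge0 ?powR_ge0// indicE. Qed.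

Lemma measurable_gegenbauer_weight : measurable_fun setT W.
Proof. by rewrite /gegenbauer_weight; mfun. Qed.

Lemma gegenbauer_weightN u : W (- u) = W u.
Proof.
rewrite /gegenbauer_weight sqrrN !indicE; congr (_ * (_ : bool)%:R).
by apply/idP/idP => /[!inE]/=; rewrite !in_itv/= => /andP[? ?]; apply/andP; split; lra.
Qed.

(** The mass of the u for which the triangle with sides x and z, and third side sqrt(x^2 + z^2 + 2 x
    z u), has this third side below r: a cap at u = -1. *)
Definition cap_mass (r x z : R) : \bar R :=
  (\int[leb]_u (W u * (x ^+ 2 + z ^+ 2 + 2 * x * z * u < r ^+ 2)%R%:R)%:E)%E.

(** The density in the variables Y = y^2 and Z = x^2 + y^2 + 2 x y u: one has y^(2 nu + 1) dy = Y^nu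
    dY / 2 and, for fixed y, du = dZ / (2 x y). *)
Let kern (x Y Z : R) : R :=
  \1_(`]0, +oo[ : set R) Y * (2^-1 * Y `^ nu * (W ((Z - (x ^+ 2 + Y)) / (2 * x * Num.sqrt Y)) / (2 * x * Num.sqrt Y))).

Let kern_ge0 x Y Z : 0 < x -> 0 <= kern x Y Z.
Proof.
move=> x0; rewrite /kern mulr_ge0 ?indicE// !mulr_ge0 ?powR_ge0 ?gegenbauer_weight_ge0//.
by rewrite invr_ge0 !mulr_ge0 ?sqrtr_ge0// ltW.
Qed.

(** By Heron's formula [D] is 16 times the squared area of the triangle with squared sides x^2, Y,
    Z. The powers of Y cancel: Y^nu from the measure, Y^(-(nu - 1/2)) from the weight and Y^(-1/2)
    from du. *)
Let kern_gt0E x Y Z : 0 < x -> 0 < Y ->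
  let D := 4 * x ^+ 2 * Y - (Z - (x ^+ 2 + Y)) ^+ 2 in
  kern x Y Z = if 0 < D then 2^-1 * D `^ (nu - 2^-1) *
    (4 * x ^+ 2) `^ (- (nu - 2^-1)) / (2 * x) else 0.
Proof.
move=> x0 Y0 D; rewrite /kern /gegenbauer_weight !indicE mem_set/=; last by rewrite in_itv/= Y0.
set m := 2 * x * Num.sqrt Y; set t := Z - (x ^+ 2 + Y).
have m0 : 0 < m by rewrite !mulr_gt0 ?sqrtr_gt0.
have m2 : m ^+ 2 = 4 * x ^+ 2 * Y.
  by rewrite /m !exprMn sqr_sqrtr ?ltW//; congr (_ * _ * _); ring.
have DE : D = m ^+ 2 - t ^+ 2 by rewrite m2.
rewrite mul1r (_ : (_ \in _) = (0 < D)); last first.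
  apply/idP/idP => [/[!inE]/=|D0]; last apply/mem_set => /=.
    rewrite in_itv/= ltr_pdivlMr// ltr_pdivrMr// mulN1r mul1r => tm.
    by rewrite DE subr_sqr mulr_gt0//; case/andP: tm; lra.
  rewrite in_itv/= ltr_pdivlMr// ltr_pdivrMr// mulN1r mul1r -ltr_norml.
  by rewrite -(ltr_pXn2r (n := 2)) ?nnegrE ?(ltW m0)// real_normK ?num_real// -subr_gt0 -DE.
case: ifPn => D0; last by rewrite mulr0 mul0r !mulr0.
rewrite mulr1 (_ : 1 - (t / m) ^+ 2 = D / (4 * x ^+ 2 * Y)); last first.
  by rewrite DE -m2; field; rewrite gt_eqF.
rewrite !powR_gt0E ?mulr_gt0 ?divr_gt0 ?invr_gt0 ?exprn_gt0//.
rewrite ln_div ?posrE ?mulr_gt0 ?exprn_gt0 ?mulr_gt0//.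
rewrite [ln (_ * Y)]lnM ?posrE ?mulr_gt0 ?exprn_gt0//.
rewrite /m -powR12_sqrt ?(ltW Y0)// powR_gt0E//.
set a := ln D; set b := ln (4 * _); set c := ln Y.
rewrite !invfM -expRN.
transitivity (2^-1 * (2^-1 * x^-1) * (expR (nu * c) * expR ((nu - 2^-1) * (a - (b + c)))
  * expR (- (2^-1 * c)))); first ring.
rewrite -!expRD -[in RHS]mulrA.
transitivity (2^-1 * (2^-1 * x^-1) * expR ((nu - 2^-1) * a + - (nu - 2^-1) * b)).
  by congr (_ * expR _); ring.
by rewrite expRD; ring.
by rewrite !mulr_gt0// exprn_gt0.
Qed.

Let kern_sym x Y Z : 0 < x -> kern x Y Z = kern x Z Y.
Proof.
move=> x0.
(* The indicator in [kern] tests the first variable only. When the second one is nonpositive the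
   triangle is degenerate: D <= 0, since (x^2 + A)^2 >= 4 x^2 A. *)
have kern0 A B : B <= 0 -> kern x A B = 0.
  move=> B0; have [A0|A0] := leP A 0.
    rewrite /kern indicE memNset/= ?mul0r//.
    by rewrite in_itv/= andbT; apply/negP; rewrite -leNgt.
  rewrite kern_gt0E// ifF//; apply/negbTE; rewrite -leNgt.
  rewrite subr_le0.
  have : 0 <= (x ^+ 2 - A) ^+ 2 by exact: sqr_ge0.
  have : 0 <= x ^+ 2 by exact: sqr_ge0.
  nra.
have kern00 A B : A <= 0 -> kern x A B = 0.
  move=> A0; rewrite /kern indicE memNset/= ?mul0r//.
  by rewrite in_itv/= andbT; apply/negP; rewrite -leNgt.
have [Y0|Y0] := leP Y 0; first by rewrite kern00// kern0.
have [Z0|Z0] := leP Z 0; first by rewrite kern0// kern00.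
rewrite !kern_gt0E//=.
by have -> : 4 * x ^+ 2 * Y - (Z - (x ^+ 2 + Y)) ^+ 2 =
  4 * x ^+ 2 * Z - (Y - (x ^+ 2 + Z)) ^+ 2 by ring.
Qed.

(* In terms of the squares Y = y^2 and Z = rho^2 the kernel
   (16 area(x, y, rho)^2)^(nu - 1/2) is symmetric, which exchanges the roles of
   y and rho. *)
Lemma gegenbauer_triangle_swap (phi : R -> \bar R) (x r : R) : 0 < x -> 0 < r ->
  measurable_fun setT phi -> (forall z, (0 <= phi z)%E) ->
  (\int[leb]_(y in `]0%R, r[) ((y `^ (2 * nu + 1))%:E *
     \int[leb]_u (phi (Num.sqrt (x ^+ 2 + y ^+ 2 + 2 * x * y * u)) * (W u)%:E)) =
   \int[leb]_(z in `]0%R, +oo[)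
     (phi z * ((z `^ (2 * nu + 1))%:E * cap_mass r x z)))%E.
Proof.
move=> x0 r0 mphi phi0.
pose lt2 (Y : R) : R := (Y < r ^+ 2)%R%:R.
(* The two inner integrals of one function of (Y, Z), to be exchanged by Tonelli's theorem; [lt2] is
   the constraint y < r in squared form. *)
pose F Y := (\int[leb]_Z (phi (Num.sqrt Z) * (lt2 Y * kern x Y Z)%:E))%E.
pose G Z := (\int[leb]_Y (phi (Num.sqrt Z) * (lt2 Y * kern x Y Z)%:E))%E.
have lk0 Y Z : 0 <= lt2 Y * kern x Y Z by rewrite mulr_ge0// kern_ge0.
have mj : measurable_fun setT (fun p : R * R =>
    (phi (Num.sqrt p.2) * (lt2 p.1 * kern x p.1 p.2)%:E)%E).
  by rewrite /lt2 /kern /gegenbauer_weight; mfun.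
have j0 (p : R * R) : (0 <= phi (Num.sqrt p.2) * (lt2 p.1 * kern x p.1 p.2)%:E)%E.
  by rewrite mule_ge0// lee_fin.
have affK (e c u : R) : c != 0 -> (e + c * u - e) / c = u by move=> c0; field.
have mW := measurable_gegenbauer_weight.
have W0 := gegenbauer_weight_ge0.
have mjY Y : measurable_fun setT (fun Z : R =>
    (phi (Num.sqrt Z) * (lt2 Y * kern x Y Z)%:E)%E).
  by rewrite /lt2 /kern; mfun.
have mjZ Z : measurable_fun setT (fun Y : R =>
    (phi (Num.sqrt Z) * (lt2 Y * kern x Y Z)%:E)%E).
  by rewrite /lt2 /kern; mfun.
transitivity (\int[leb]_(y in `]0%R, +oo[) (F (y ^+ 2)%R * (2 * y)%:E))%E.
  rewrite [LHS]integral_mul_indic [RHS]integral_mul_indic; apply: eq_integral => y _.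
  rewrite !indicE; have [y0|y0] := leP y 0.
    by rewrite !memNset ?mule0//= in_itv/= ltNge y0.
  rewrite !in_set_itv !in_itv/= y0 /= mule1.
  have m0 : 0 < 2 * x * y by rewrite !mulr_gt0.
  pose H Z := (phi (Num.sqrt Z) *
    (W ((Z - (x ^+ 2 + y ^+ 2)) / (2 * x * y)) / (2 * x * y))%:E)%E.
  have mH : measurable_fun setT H.
    by rewrite /H; mfun.
  have H0 Z : (0 <= H Z)%E by rewrite mule_ge0// lee_fin divr_ge0// ltW.
  have -> : (\int[leb]_u (phi (Num.sqrt (x ^+ 2 + y ^+ 2 + 2 * x * y * u)) * (W u)%:E)
    = \int[leb]_Z H Z)%E.
    rewrite [RHS](@ge0_integral_affine _ (2 * x * y) (x ^+ 2 + y ^+ 2))//.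
    apply: eq_integral => u _; rewrite /H -muleA -EFinM divfK ?gt_eqF//.
    by rewrite affK ?gt_eqF.
  rewrite /F -ge0_integralZr_real ?(mulr_ge0 _ (ltW y0))//; last 2 first.
  - exact: mjY.
  - by move=> Z; rewrite mule_ge0// lee_fin.
  rewrite -ge0_integralZl_real ?powR_ge0//.
  rewrite -ge0_integralZr_real//; last 2 first.
  - by mfun.
  - by move=> Z; rewrite mule_ge0// lee_fin powR_ge0.
  apply: eq_integral => Z _.
  rewrite /lt2 /kern /H indicE mem_set/= ?in_itv/= ?exprn_gt0 ?y0// mul1r.
  rewrite sqrtr_sqr gtr0_norm// ltr_pXn2r ?nnegrE ?(ltW y0) ?(ltW r0)//.
  rewrite muleCA -!muleA -!EFinM; congr (_ * _%:E)%E.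
  rewrite -[y ^+ 2]powR_mulrn ?(ltW y0)// -powRrM.
  rewrite powRD; last by rewrite (gt_eqF y0) implybT.
  by rewrite powRr1 ?(ltW y0)//; field; rewrite !gt_eqF.
have mF : measurable_fun setT F.
  exact: (measurable_fun_fubini_tonelli_F (m2 := leb) _ mj j0).
have F0 Y : (0 <= F Y)%E by apply: integral_ge0 => Z _; rewrite mule_ge0// lee_fin.
rewrite -ge0_integral_sqr//.
transitivity (\int[leb]_Y F Y)%E.
  rewrite integral_mul_indic; apply: eq_integral => Y _.
  rewrite indicE; have [Y0|Y0] := boolP (Y \in _); first by rewrite mule1.
  rewrite mule0 /F integral0_eq// => Z _; rewrite /kern indicE.
  by rewrite (negbTE Y0) mul0r mulr0 mule0.
rewrite /F (fubini_tonelli (m1 := leb) (m2 := leb) _ mj j0) -/G.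
have mG : measurable_fun setT G.
  exact: (measurable_fun_fubini_tonelli_G (m1 := leb) _ mj j0).
have G0 Y : (0 <= G Y)%E by apply: integral_ge0 => Z _; rewrite mule_ge0// lee_fin.
transitivity (\int[leb]_(Z in `]0%R, +oo[) G Z)%E.
  rewrite [RHS]integral_mul_indic; apply: eq_integral => Z _.
  rewrite indicE; have [Z0|Z0] := boolP (Z \in _); first by rewrite mule1.
  rewrite mule0 integral0_eq// => Y _; rewrite kern_sym// /kern indicE.
  by rewrite (negbTE Z0) mul0r mulr0 mule0.
rewrite ge0_integral_sqr//; apply: eq_integral => z.
rewrite inE/= in_itv/= andbT => z0.
have m0 : 0 < 2 * x * z by rewrite !mulr_gt0.
rewrite /G /cap_mass [X in (X * _)%E](@ge0_integral_affine _ (2 * x * z) (x ^+ 2 + z ^+ 2))//;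
  last by move=> Y; rewrite mule_ge0// lee_fin.
rewrite -ge0_integralZr_real ?(mulr_ge0 _ (ltW z0))//; last 2 first.
- by rewrite /lt2 /kern; mfun.
- by move=> u; rewrite !mule_ge0// lee_fin// ltW.
rewrite -ge0_integralZl_real ?powR_ge0//; [|by mfun|by move=> u; rewrite lee_fin mulr_ge0].
rewrite -ge0_integralZl//; last 2 first.
- by mfun.
- by move=> u _; rewrite mule_ge0 ?lee_fin ?powR_ge0// mulr_ge0.
apply: eq_integral => u _.
rewrite kern_sym// /kern indicE mem_set/= ?in_itv/= ?exprn_gt0 ?z0// mul1r.
rewrite sqrtr_sqr gtr0_norm//.
rewrite affK ?gt_eqF//.
rewrite -!muleA -!EFinM; congr (_ * _%:E)%E; rewrite /lt2.
have -> : (z ^+ 2) `^ nu = z `^ (2 * nu) by rewrite -powR_mulrn ?(ltW z0)// -powRrM.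
rewrite powRD; last by rewrite (gt_eqF z0) implybT.
by rewrite powRr1 ?(ltW z0)//; field; rewrite !gt_eqF.
Qed.

End gegenbauer.

Lemma powR_bounds (R : realType) (v e : R) : 2^-1 <= v <= 2 ->
  (2 `^ `|e|)^-1 <= v `^ e <= 2 `^ `|e|.
Proof.
move=> /andP[v1 v2].
have v0 : 0 < v by lra.
rewrite -powRN !powR_gt0E// !ler_expR.
have l1 : ln v <= ln 2 by rewrite ler_ln ?posrE.
have l2 : - ln 2 <= ln v :> R by rewrite -lnV ?posrE// ler_ln ?posrE ?invr_gt0.
have l0 : 0 <= ln 2 :> R by rewrite ln_ge0// ler1n.
have := ler_norm e; have := ler_norm (- e); rewrite normrN.
set a := `|e| => h1 h2; have a0 : 0 <= a by rewrite /a.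
by apply/andP; split; nra.
Qed.

Section le_integral.
Context d (T : measurableType d) (R : realType) (mu : {measure set T -> \bar R}).

Lemma ge0_le_integralT (f g : T -> \bar R) :
  measurable_fun setT f -> measurable_fun setT g ->
  (forall x, (0 <= f x)%E) -> (forall x, (f x <= g x)%E) ->
  (\int[mu]_x f x <= \int[mu]_x g x)%E.
Proof.
by move=> mf mg f0 fg; apply: ge0_le_integral => // x _; exact: le_trans (fg x).
Qed.

End le_integral.

(** * Size of the caps *)

Section cap_mass_bounds.
Context (R : realType) (nu : R).
Hypothesis hnu : - 2^-1 < nu.
Local Notation leb := (@lebesgue_measure R).
Local Notation W := (gegenbauer_weight nu).
Local Notation e := (nu - 2^-1).
Let K : R := 2 `^ `|e|.

Let e1 : 0 < e + 1. Proof. move: hnu; lra. Qed.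
Let K0 : 0 < K. Proof. exact: powR_gt0. Qed.

Let mW : measurable_fun setT W := measurable_gegenbauer_weight nu.
Let W0 u : 0 <= W u := gegenbauer_weight_ge0 nu u.

Let shifted_integral (eps : R) : 0 < eps ->
  (\int[leb]_u ((1 + u) `^ e * \1_(`]0%R, eps[ : set R) (1 + u))%:E =
   ((e + 1)^-1 * eps `^ (e + 1))%:E)%E.
Proof.
move=> eps0; rewrite -integral_0b_powR// [RHS]integral_mul_indic.
rewrite [RHS](@ge0_integral_affine _ 1 1)//.
- by apply: eq_integral => u _; rewrite mul1r mule1 -EFinM addrK.
- by mfun.
- by move=> x; rewrite -EFinM lee_fin mulr_ge0 ?powR_ge0// indicE.
Qed.

(** W u = (1 - u)^e (1 + u)^e, and the threshold 3/2 keeps 1 - u between 1/2 and 2, where its powers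
    lie between 1/K and K. *)
Let cap_weight (u : R) : 0 < 1 + u < 3 / 2 ->
  K^-1 * (1 + u) `^ e <= W u <= K * (1 + u) `^ e.
Proof.
move=> /andP[u1 u2].
have -> : W u = (1 - u) `^ e * (1 + u) `^ e.
  rewrite /gegenbauer_weight indicE in_set_itv in_itv/=.
  rewrite (_ : (_ && _) = true) ?mulr1; last by apply/andP; split; lra.
  by rewrite -powRM; [congr (_ `^ _); ring|lra|lra].
have /andP[h1 h2] : K^-1 <= (1 - u) `^ e <= K by apply: powR_bounds; apply/andP; split; lra.
by rewrite !ler_wpM2r ?powR_ge0.
Qed.

Let supp u : W u != 0 -> -1 < u < 1.
Proof.
rewrite /gegenbauer_weight indicE in_set_itv in_itv/= => Wu.
by apply: contraNT Wu => /negbTE ->; rewrite mulr0.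
Qed.

Lemma gegenbauer_cap_upper (eps : R) : 0 < eps <= 3 / 2 ->
  (\int[leb]_u (W u * \1_(`]0%R, eps[ : set R) (1 + u))%:E <=
   (K / (e + 1) * eps `^ (e + 1))%:E)%E.
Proof.
move=> /andP[eps0 eps1]; rewrite -[K / _ * _]mulrA EFinM -shifted_integral//.
rewrite -ge0_integralZl_real ?(ltW K0)//; last 2 first.
- by mfun.
- by move=> u; rewrite lee_fin mulr_ge0 ?powR_ge0// indicE.
apply: ge0_le_integralT.
- by mfun.
- by mfun.
- by move=> u; rewrite lee_fin mulr_ge0// indicE.
- move=> u; rewrite -EFinM lee_fin indicE in_set_itv in_itv/=.
  have [/andP[u1 u2]|_] := boolP (_ && _); last by rewrite !mulr0.
  have /cap_weight/andP[h1 h2] : 0 < 1 + u < 3 / 2 by rewrite u1 (lt_le_trans u2).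
  by rewrite !mulr1.
Qed.

Lemma gegenbauer_cap_lower (eps : R) : 0 < eps <= 3 / 2 ->
  ((K^-1 / (e + 1) * eps `^ (e + 1))%:E <=
   \int[leb]_u (W u * \1_(`]0%R, eps[ : set R) (1 + u))%:E)%E.
Proof.
move=> /andP[eps0 eps1]; rewrite -[K^-1 / _ * _]mulrA EFinM -shifted_integral//.
rewrite -ge0_integralZl_real ?invr_ge0 ?(ltW K0)//; last 2 first.
- by mfun.
- by move=> u; rewrite lee_fin mulr_ge0 ?powR_ge0// indicE.
apply: ge0_le_integralT.
- by mfun.
- by mfun.
- by move=> u; rewrite -EFinM lee_fin !mulr_ge0 ?powR_ge0 ?invr_ge0 ?(ltW K0)// indicE.
- move=> u; rewrite -EFinM lee_fin indicE in_set_itv in_itv/=.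
  have [/andP[u1 u2]|_] := boolP (_ && _); last by rewrite !mulr0.
  have /cap_weight/andP[h1 h2] : 0 < 1 + u < 3 / 2 by rewrite u1 (lt_le_trans u2).
  by rewrite !mulr1.
Qed.

(** The caps 1 + u < 3/2 and 1 - u < 3/2 cover ]-1, 1[ and have the same mass because the weight is
    even. *)
Lemma gegenbauer_mass_lty : (\int[leb]_u (W u)%:E < +oo)%E.
Proof.
pose h u : R := W u * \1_(`]0, 3 / 2[ : set R) (1 + u).
have mh : measurable_fun setT h by rewrite /h; mfun.
have h0 u : (0 <= (h u)%:E)%E by rewrite lee_fin mulr_ge0// indicE.
have hfin : (\int[leb]_u (h u)%:E < +oo)%E.
  by apply: le_lt_trans (gegenbauer_cap_upper _) (ltry _); apply/andP; split; lra.
apply: (@le_lt_trans _ _ (\int[leb]_u ((h u)%:E + (h (- u))%:E))%E).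
  apply: ge0_le_integralT; [by mfun|by mfun|by move=> u; rewrite lee_fin|].
  move=> u; rewrite -EFinD lee_fin /h gegenbauer_weightN -mulrDr.
  have [->|/supp/andP[u1 u2]] := eqVneq (W u) 0; first by rewrite mul0r.
  rewrite ler_peMr ?powR_ge0// !indicE !in_set_itv !in_itv/=.
  have [u0|u0] := leP u 0.
    by rewrite (_ : 0 < 1 + u < _) ?lerDl//; apply/andP; split; lra.
  by rewrite (_ : 0 < 1 + - u < _) ?lerDr//; apply/andP; split; lra.
rewrite ge0_integralD//; [|by mfun|by mfun].
rewrite -(@ge0_integral_oppr _ (fun u => (h u)%:E))//; last by mfun.
by rewrite lte_add_pinfty.
Qed.

Let M : R := fine (\int[leb]_u (W u)%:E)%E.

Let W_M : (\int[leb]_u (W u)%:E = M%:E)%E.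
Proof.
rewrite fineK// ge0_fin_numE ?gegenbauer_mass_lty//.
by apply: integral_ge0 => u _; rewrite lee_fin.
Qed.

Let M0 : 0 <= M.
Proof. by rewrite -lee_fin -W_M; apply: integral_ge0 => u _; rewrite lee_fin. Qed.

Let sqr_powR (t : R) : 0 <= t -> (t ^+ 2) `^ (e + 1) = t `^ (2 * nu + 1).
Proof. by move=> t0; rewrite -powR_mulrn// -powRrM; congr (_ `^ _); field. Qed.

Lemma cap_mass_ge0 r x z : (0 <= cap_mass nu r x z)%E.
Proof. by apply: integral_ge0 => u _; rewrite lee_fin mulr_ge0. Qed.

Lemma measurable_cap_mass r x : measurable_fun setT (cap_mass nu r x).
Proof.
have := @measurable_fun_fubini_tonelli_F _ _ (measurableTypeR R) (measurableTypeR R) R leb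
 (fun p : R * R =>
  (W p.2 * (x ^+ 2 + p.1 ^+ 2 + 2 * x * p.1 * p.2 < r ^+ 2)%R%:R)%:E).
apply.
- by mfun.
- by move=> p; rewrite lee_fin mulr_ge0.
Qed.

(** For u > -1 the third side of the triangle is at least |z - x|. *)
Lemma cap_mass_eq0 r x z : 0 < x -> 0 < z -> r <= `|z - x| -> 0 < r ->
  cap_mass nu r x z = 0%E.
Proof.
move=> x0 z0 rzx r0; apply: integral0_eq => u _.
have [->|/supp/andP[u1 u2]] := eqVneq (W u) 0; first by rewrite mul0r.
rewrite ltNge (_ : _ <= _) /= ?mulr0//.
have : r ^+ 2 <= (z - x) ^+ 2.
  by rewrite -[leRHS]real_normK ?num_real// ler_pXn2r ?nnegrE// ltW.
have xz : 0 < x * z by rewrite mulr_gt0.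
nra.
Qed.

(** If 2 r <= x then z > x/2, and (x - z)^2 + 2 x z (1 + u) < r^2 forces 1 + u < (r/x)^2: a cap of
    mass of order (r/x)^(2 nu + 1), with x + r <= 3x/2 as the source of the factor 3/2. Otherwise
    r/(x + r) > 1/3 and the total mass is a sufficient bound. *)
Lemma cap_mass_upper : exists2 C : R, 0 < C & forall r x z, 0 < r -> 0 < x -> 0 < z ->
  (cap_mass nu r x z <=
   (C * (r / (x + r)) `^ (2 * nu + 1) * (`|z - x| < r)%R%:R)%:E)%E.
Proof.
have d0 : 0 < 2 * nu + 1 by move: hnu; lra.
pose C1 := K / (e + 1) * (3 / 2) `^ (2 * nu + 1).
have C10 : 0 < C1 by rewrite mulr_gt0 ?powR_gt0 ?divr_gt0//; lra.
pose C2 := M * 3 `^ (2 * nu + 1).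
have C20 : 0 <= C2 by rewrite mulr_ge0 ?powR_ge0.
exists (C1 + C2); first by rewrite ltr_pwDl.
move=> r x z r0 x0 z0.
have q0 : 0 <= r / (x + r) by rewrite divr_ge0 ?ltW// addr_gt0.
have [zx|zx] := ltP `|z - x| r; last first.
  by rewrite cap_mass_eq0// mulr0.
rewrite mulr1 mulrDl EFinD.
have [rx|rx] := leP (2 * r) x.
- apply: (@le_trans _ _ (C1 * (r / (x + r)) `^ (2 * nu + 1))%:E); last first.
    by rewrite leeDl// lee_fin mulr_ge0 ?powR_ge0.
  pose eps := (r / x) ^+ 2.
  have rx0 : 0 < r / x by rewrite divr_gt0.
  have rx1 : r / x <= 2^-1 by rewrite ler_pdivrMr//; lra.
  apply: (@le_trans _ _ (\int[leb]_u (W u * \1_(`]0%R, eps[ : set R) (1 + u))%:E)%E).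
    apply: ge0_le_integralT.
    + by mfun.
    + by mfun.
    + by move=> u; rewrite lee_fin mulr_ge0.
    + move=> u; rewrite lee_fin.
      have [->|/supp/andP[u1 u2]] := eqVneq (W u) 0; first by rewrite !mul0r.
      rewrite ler_wpM2l// indicE in_set_itv in_itv/=.
      case: ltP => // h; rewrite (_ : _ && _ = true)//; apply/andP; split; first lra.
      have zx2 : x / 2 < z by move: zx; rewrite ltr_norml => /andP[]; lra.
      have x2 : 0 < x ^+ 2 by rewrite exprn_gt0.
      rewrite /eps expr_div_n ltr_pdivlMr//.
      apply: (@le_lt_trans _ _ (2 * x * z * (1 + u))).
        rewrite mulrC ler_wpM2r; [by []|lra|nra].
      have := sqr_ge0 (x - z); nra.
  apply: le_trans (gegenbauer_cap_upper _) _.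
    by rewrite exprn_gt0// /eps; nra.
  rewrite lee_fin /eps sqr_powR ?(ltW rx0)// /C1 -!mulrA.
  rewrite !ler_wpM2l ?(ltW K0) ?invr_ge0 ?(ltW e1)//.
  have h32 : 0 <= 3 / 2 :> R by lra.
  rewrite -powRM//; apply: ge0_ler_powR; rewrite ?nnegrE ?(ltW rx0) ?(ltW d0)//.
    exact: mulr_ge0.
  rewrite mulrA ler_pdivlMr ?addr_gt0// mulrAC ler_pdivrMr//; nra.
- apply: (@le_trans _ _ (C2 * (r / (x + r)) `^ (2 * nu + 1))%:E); last first.
    by rewrite leeDr// lee_fin mulr_ge0 ?powR_ge0// ltW.
  apply: (@le_trans _ _ M%:E).
    rewrite -W_M; apply: ge0_le_integralT.
    + by mfun.
    + by mfun.
    + by move=> u; rewrite lee_fin mulr_ge0.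
    + by move=> u; rewrite lee_fin ler_piMr//; case: ltP.
  rewrite lee_fin /C2 -mulrA -powRM//.
  rewrite ler_peMr//; apply: (@le_trans _ _ (1 `^ (2 * nu + 1))).
    by rewrite powR1.
  have q1 : 0 <= 3 * (r / (x + r)) by exact: mulr_ge0.
  rewrite ge0_ler_powR ?nnegrE ?(ltW d0)//.
  rewrite mulrA ler_pdivlMr ?addr_gt0//; lra.
Qed.

(** The budget r^2 is split: |z - x| < r/2 uses up r^2/4, and since z < 3x/2, the cap 1 + u <
    (r/(2x))^2 uses at most 3 r^2/4. This is where the half radius of the lower bounds
    originates. *)
Lemma cap_mass_lower : exists2 c : R, 0 < c & forall r x z, 0 < r -> r <= x ->
  `|z - x| < r / 2 -> ((c * (r / (x + r)) `^ (2 * nu + 1))%:E <= cap_mass nu r x z)%E.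
Proof.
have d0 : 0 < 2 * nu + 1 by move: hnu; lra.
exists (K^-1 / (e + 1) * 2^-1 `^ (2 * nu + 1)).
  by rewrite !mulr_gt0 ?powR_gt0 ?invr_gt0.
move=> r x z r0 rx zx; have x0 : 0 < x by lra.
have q0 : 0 <= r / (x + r) by rewrite divr_ge0 ?ltW// addr_gt0.
pose eps := (r / (2 * x)) ^+ 2.
have rx0 : 0 < r / (2 * x) by rewrite divr_gt0// mulr_gt0.
have rx1 : r / (2 * x) <= 2^-1 by rewrite ler_pdivrMr ?mulr_gt0//; lra.
apply: (@le_trans _ _ (\int[leb]_u (W u * \1_(`]0%R, eps[ : set R) (1 + u))%:E)%E).
  apply: le_trans (gegenbauer_cap_lower _); last by rewrite exprn_gt0// /eps; nra.
  rewrite lee_fin /eps sqr_powR ?(ltW rx0)// -!mulrA.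
  rewrite !ler_wpM2l ?invr_ge0 ?(ltW K0) ?(ltW e1)//.
  rewrite -powRM//.
  apply: ge0_ler_powR; rewrite ?nnegrE ?(ltW rx0) ?(ltW d0)//.
    exact: mulr_ge0.
  rewrite invfM mulrCA ler_pM2l ?invr_gt0// ler_pM2l// lef_pV2 ?posrE ?addr_gt0//; lra.
apply: ge0_le_integralT.
- by mfun.
- by mfun.
- by move=> u; rewrite lee_fin mulr_ge0// indicE.
- move=> u; rewrite lee_fin ler_wpM2l// indicE in_set_itv in_itv/=.
  have [/andP[u1 u2]|//] := boolP (_ && _).
  rewrite (_ : _ < _)//.
  move: zx; rewrite ltr_norml => /andP[zx1 zx2].
  have zx3 : z < 3 / 2 * x by lra.
  have x2 : 0 < x ^+ 2 by rewrite exprn_gt0.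
  move: u2; rewrite /eps expr_div_n exprMn ltr_pdivlMr ?mulr_gt0 ?exprn_gt0//.
  move=> u2.
  have h1 : 2 * x * z * (1 + u) <= 3 * x ^+ 2 * (1 + u).
    by rewrite ler_wpM2r//; [lra|nra].
  nra.
Qed.

End cap_mass_bounds.

(** * The Dunkl measure *)

Section euler_Gamma_positive.
Context (R : realType) (a : R).
Hypothesis a0 : 0 < a.
Local Notation leb := (@lebesgue_measure R).
Let g (x : R) : R := x `^ (a - 1) * expR (- x) * \1_(`]0%R, +oo[ : set R) x.

Let mexp : measurable_fun setT (expR : R -> R).
Proof. exact: measurable_expR. Qed.

Let mg : measurable_fun setT g.
Proof. by rewrite /g; mfun. Qed.

Let g0 x : 0 <= g x.
Proof. by rewrite /g !mulr_ge0 ?powR_ge0 ?expR_ge0// indicE. Qed.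

Let gE : euler_Gamma a = fine (\int[leb]_x (g x)%:E)%E.
Proof.
rewrite /euler_Gamma /Rintegral [in LHS]integral_mul_indic.
by congr fine; apply: eq_integral => x _; rewrite -EFinM.
Qed.

Let g_lty : (\int[leb]_x (g x)%:E < +oo)%E.
Proof.
(* For x >= 1 the majorant is b^b x^(-2): with b = a + 1, x^b exp(-x) <= b^b is the inequality
   ln(x/b) < x/b. Starting [h2] at 1/2 includes the point 1. *)
pose b := a + 1; have b0 : 0 < b by rewrite addr_gt0.
pose h1 (x : R) : R := x `^ (a - 1) * \1_(`]0%R, 1[ : set R) x.
pose h2 (x : R) : R := b `^ b * (x `^ (- 1 - 1) * \1_(`]2^-1, +oo[ : set R) x).
have h10 x : 0 <= h1 x by rewrite mulr_ge0 ?powR_ge0// indicE.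
have h20 x : 0 <= h2 x by rewrite !mulr_ge0 ?powR_ge0// indicE.
apply: (@le_lt_trans _ _ (\int[leb]_x ((h1 x)%:E + (h2 x)%:E))%E).
  apply: ge0_le_integralT; [by mfun|by rewrite /h1 /h2; mfun|by move=> x; rewrite lee_fin|].
  move=> x; rewrite -EFinD lee_fin /g indicE in_set_itv in_itv/= andbT.
  have [x0|x0] := ltP 0 x; last by rewrite mulr0 addr_ge0.
  rewrite mulr1.
  have [x1|x1] := ltP x 1.
    rewrite -[leLHS]addr0 lerD// /h1 indicE in_set_itv in_itv/= x0 x1 mulr1.
    by rewrite ler_piMr ?powR_ge0// -expR0 ler_expR oppr_le0 ltW.
  rewrite -[leLHS]add0r lerD// /h2 indicE in_set_itv in_itv/= andbT.
  rewrite (_ : _ < x) ?mulr1; last by rewrite (lt_le_trans _ x1)// invf_lt1// ltr1n.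
  rewrite !powR_gt0E// -!expRD ler_expR.
  have : ln (x / b) < x / b by apply: ln_sublinear; rewrite divr_gt0.
  rewrite ln_div ?posrE// ltr_pdivlMr// /b; nra.
rewrite ge0_integralD//; [|by move=> x _; rewrite lee_fin|by rewrite /h1; mfun
  |by move=> x _; rewrite lee_fin|by rewrite /h2; mfun].
have -> : (\int[leb]_x (h1 x)%:E = (a^-1 * 1 `^ a)%:E)%E.
  rewrite -integral_0b_powR// [RHS]integral_mul_indic.
  by apply: eq_integral => x _; rewrite -EFinM.
have -> : (\int[leb]_x (h2 x)%:E = (b `^ b * (1^-1 * 2^-1 `^ (- 1)))%:E)%E.
  rewrite EFinM -(@integral_by_powR _ 2^-1 1) ?invr_gt0// [in RHS]integral_mul_indic.
  rewrite -ge0_integralZl_real ?powR_ge0//; last 2 first.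
  - by mfun.
  - by move=> x; rewrite -EFinM lee_fin mulr_ge0 ?powR_ge0// indicE.
by rewrite -EFinD ltry.
Qed.

(** The real-valued integral is 0 when the integral diverges, so positivity rests on finiteness as
    well as on a lower bound over ]1, 2[. *)
Lemma euler_Gamma_gt0 : 0 < euler_Gamma a.
Proof.
rewrite gE fine_gt0// g_lty andbT.
pose c : R := (2 `^ `|a - 1|)^-1 * expR (- 2).
have c0 : 0 < c by rewrite mulr_gt0 ?expR_gt0// invr_gt0 powR_gt0.
apply: (@lt_le_trans _ _ (c * 1)%:E); first by rewrite lte_fin mulr1.
apply: (@le_trans _ _ (\int[leb]_x (c * \1_(`]1, 2[ : set R) x)%:E)%E).
  under eq_integral do rewrite EFinM.
  rewrite ge0_integralZl_real ?(ltW c0)//; last by mfun.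
  have -> : (\int[leb]_x (\1_(`]1, 2[%classic : set R) x)%:E = 1)%E.
    rewrite integral_indic// setIT/= lebesgue_measure_itv/= lte_fin ltr1n/=.
    by rewrite -EFinB; congr EFin; ring.
  by rewrite EFinM.
apply: ge0_le_integralT.
- by mfun.
- by mfun.
- by move=> x; rewrite lee_fin mulr_ge0 ?(ltW c0)// indicE.
- move=> x; rewrite lee_fin indicE in_set_itv in_itv/=.
  have [/andP[x1 x2]|_] := boolP (_ && _); last by rewrite mulr0.
  rewrite /g indicE in_set_itv in_itv/= andbT (lt_trans ltr01 x1) !mulr1.
  have /powR_bounds : 2^-1 <= x <= 2 by apply/andP; split; lra.
  move=> /(_ (a - 1))/andP[h _].
  by apply: ler_pM; rewrite ?invr_ge0 ?powR_ge0 ?expR_ge0// ler_expR lerN2 ltW.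
Qed.

End euler_Gamma_positive.

Section dunkl_measure_basics.
Context (R : realType) (nu : R).
Local Notation leb := (@lebesgue_measure R).
Local Notation mu := (dunkl_measure nu).

Definition dunkl_cst : R := (2 `^ (nu + 1) * euler_Gamma (nu + 1))^-1.
Local Notation kappa := dunkl_cst.

Lemma dunkl_cst_gt0 : - 1 < nu -> 0 < kappa.
Proof.
move=> h; rewrite invr_gt0 mulr_gt0 ?powR_gt0// euler_Gamma_gt0//; lra.
Qed.

Lemma dunkl_cst_ge0 : 0 <= kappa.
Proof. by rewrite invr_ge0 mulr_ge0 ?powR_ge0// euler_Gamma_ge0. Qed.

Lemma dunkl_densityE x : dunkl_density nu x = kappa * `|x| `^ (2 * nu + 1).
Proof. by []. Qed.

Lemma ge0_integral_dunkl D (f : R -> \bar R) :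
  measurable D -> measurable_fun D f -> (forall x, D x -> (0 <= f x)%E) ->
  (\int[dunkl_measure nu]_(x in D) f x =
   \int[leb]_(x in D) (f x * (dunkl_density nu x)%:E))%E.
Proof.
move=> mD mf f0.
have mE A : measurable A -> dunkl_measure nu A =
    (\int[leb]_(x in id @^-1` A) (dunkl_density nu x)%:E)%E by [].
exact: (@ge0_integral_density_comp _ _ (measurableTypeR R) _ R leb (dunkl_measure nu) id
  (dunkl_density nu) (@measurable_id _ _ _) (measurable_dunkl_density nu)
  (dunkl_density_ge0 nu) mE D f mD mf f0).
Qed.

Lemma integral_dunkl D (f : R -> \bar R) :
  measurable D -> measurable_fun D f ->
  (\int[dunkl_measure nu]_(x in D) f x =
   \int[leb]_(x in D) (f x * (dunkl_density nu x)%:E))%E.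
Proof.
move=> mD mf.
have mE A : measurable A -> dunkl_measure nu A =
    (\int[leb]_(x in id @^-1` A) (dunkl_density nu x)%:E)%E by [].
exact: (@integral_density_comp _ _ (measurableTypeR R) _ R leb (dunkl_measure nu) id
  (dunkl_density nu) (@measurable_id _ _ _) (measurable_dunkl_density nu)
  (dunkl_density_ge0 nu) mE D f mD mf).
Qed.

(** Cutting also by the size of the density covers every [nu], including those for which the density
    blows up at the origin; the instance can thus be declared for all parameters. *)
Lemma dunkl_measure_sigma_finite : sigma_finite setT mu.
Proof.
exists (fun n : nat => `[- n%:R, n%:R] `&` [set x : R | dunkl_density nu x <= n%:R]).
  apply/seteqP; split => // x _.
  exists (Num.truncn (`|x| + dunkl_density nu x)).+1 => //=.
  have := truncnS_gt (`|x| + dunkl_density nu x); set n := (_.+1)%:R => xn.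
  have d0 := dunkl_density_ge0 nu x; have x0 := normr_ge0 x.
  by rewrite /= in_itv/= -ler_norml; split; lra.
move=> n.
have mn : measurable [set x : R | dunkl_density nu x <= n%:R].
  rewrite -[X in measurable X]setTI.
  rewrite (_ : [set x | _] = (fun x => dunkl_density nu x <= n%:R) @^-1` [set true]).
    by apply: measurable_fun_ler => //; exact: measurable_dunkl_density.
  by apply/seteqP; split => x.
split; first exact: measurableI.
rewrite /dunkl_measure; apply: (@le_lt_trans _ _ (\int[leb]_(x in `[(- n%:R)%R, n%:R]) n%:R%:E)%E).
  apply: (@le_trans _ _ (\int[leb]_(x in `[(- n%:R)%R, n%:R] `&` [set x : R | (dunkl_density nu x <= n%:R)%R]) n%:R%:E)%E).
    apply: ge0_le_integral => //.
    - exact: measurableI.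
    - by move=> x _; rewrite lee_fin dunkl_density_ge0.
    - apply/measurable_EFinP; apply: measurable_funTS; exact: measurable_dunkl_density.
    - by move=> x [_ /=]; rewrite lee_fin.
  apply: ge0_subset_integral => //; exact: measurableI.
rewrite integral_cst//= lebesgue_measure_itv/=.
by case: ifP => _; rewrite ?mule0 -?EFinB -?EFinM ltry.
Qed.

HB.instance Definition _ :=
  @Measure_isSigmaFinite.Build _ _ _ mu dunkl_measure_sigma_finite.

Lemma dunkl_densityN x : dunkl_density nu (- x) = dunkl_density nu x.
Proof. by rewrite /dunkl_density normrN. Qed.

Lemma integral_lebN (f : R -> \bar R) : measurable_fun setT f ->
  (\int[leb]_x f x = \int[leb]_x f (- x)%R)%E.
Proof.
move=> mf; rewrite integralE [RHS]integralE; congr (_ - _)%E.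
- have h := ge0_integral_oppr (measurable_funepos mf) (@funepos_ge0 _ _ f).
  by apply: etrans h _; apply: eq_integral => x _; rewrite !funeposE.
- have h := ge0_integral_oppr (measurable_funeneg mf) (@funeneg_ge0 _ _ f).
  by apply: etrans h _; apply: eq_integral => x _; rewrite !funenegE.
Qed.

Lemma integral_dunklN (f : R -> \bar R) : measurable_fun setT f ->
  (\int[dunkl_measure nu]_x f x = \int[dunkl_measure nu]_x f (- x)%R)%E.
Proof.
move=> mf; rewrite !integral_dunkl//; last exact: measurableT_comp.
rewrite integral_lebN; first by under [RHS]eq_integral do rewrite -dunkl_densityN.
by have mw := measurable_dunkl_density nu; mfun.
Qed.

End dunkl_measure_basics.

(** * Dunkl translation over balls *)

Section fold.
Context (R : realType).
Local Notation leb := (@lebesgue_measure R).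

Lemma ge0_integral_fold (f : R -> \bar R) :
  measurable_fun setT f -> (forall x, (0 <= f x)%E) ->
  (\int[leb]_x f x = \int[leb]_(x in `]0%R, +oo[) (f x + f (- x)%R))%E.
Proof.
move=> mf f0.
have mfN : measurable_fun setT (fun x : R => f (- x)) by mfun.
rewrite ge0_integralD//; last 2 first.
- exact: measurable_funTS.
- exact: measurable_funTS.
rewrite [X in (_ + X)%E]integral_itv_obnd_cbnd; last exact: measurable_funTS.
have -> : (\int[leb]_(x in `[0%R, +oo[) f (- x)%R = \int[leb]_(x in `]-oo, 0%R]) f x)%E.
  rewrite ge0_integration_by_substitution0//.
  by apply: eq_integral => x _; rewrite opprK.
rewrite addeC -ge0_integral_setU//=.
- congr (integral _ _ _); apply/seteqP; split => // x _ /=.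
  by rewrite !in_itv/= andbT; case: (leP x 0); [left|right].
- exact: measurable_funTS.
- by apply/disj_setPS => x [] /=; rewrite !in_itv/= andbT leNgt => /negbTE ->.
Qed.

End fold.

Lemma in_ball_set (R : realType) (a b : R) : (`]- a, a[%classic : set R) b = (`|b| < a) :> Prop.
Proof. by rewrite /= in_itv/= ltr_norml. Qed.

Lemma indic_ball (R : realType) (a b : R) :
  \1_(`]- a, a[ : set R) b = (`|b| < a)%R%:R :> R.
Proof. by rewrite indicE in_set_itv in_itv/= ltr_norml. Qed.

Section dunkl_even.
Context (R : realType) (nu : R).
Hypothesis hnu : - 2^-1 < nu.
Local Notation leb := (@lebesgue_measure R).
Local Notation W := (gegenbauer_weight nu).

Definition dunkl_rho (x y u : R) : R := Num.sqrt (x ^+ 2 + y ^+ 2 + 2 * x * y * u).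
Local Notation rho := dunkl_rho.

Let mW : measurable_fun setT W := measurable_gegenbauer_weight nu.
Let W0 u : 0 <= W u := gegenbauer_weight_ge0 nu u.

Let Phi (phi : R -> \bar R) (x y : R) : \bar R :=
  (\int[leb]_u (phi (rho x y u) * (W u)%:E))%E.

Lemma measurable_integral_rho (phi : R -> \bar R) : measurable_fun setT phi ->
  (forall z, (0 <= phi z)%E) -> measurable_fun setT (fun p : R * R => Phi phi p.1 p.2).
Proof.
move=> mphi phi0.
have := @measurable_fun_fubini_tonelli_F _ _ (measurableTypeR R * measurableTypeR R)%type
 (measurableTypeR R) R leb
 (fun q : (R * R) * R => phi (rho q.1.1 q.1.2 q.2) * (W q.2)%:E)%E.
apply.
- have m1 : measurable_fun setT (fun q : (R * R) * R => q.1.1).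
    by apply: (measurableT_comp measurable_fst); exact: measurable_fst.
  have m2 : measurable_fun setT (fun q : (R * R) * R => q.1.2).
    by apply: (measurableT_comp measurable_snd); exact: measurable_fst.
  by rewrite /rho; mfun.
- by move=> q; rewrite mule_ge0// lee_fin.
Qed.

Let measurable_Phi (phi : R -> \bar R) (x : R) : measurable_fun setT phi ->
  (forall z, (0 <= phi z)%E) -> measurable_fun setT (Phi phi x).
Proof.
move=> mphi phi0.
apply: (@measurable_fun_fubini_tonelli_F _ _ (measurableTypeR R) (measurableTypeR R) R leb
 (fun q : R * R => phi (rho x q.1 q.2) * (W q.2)%:E)%E).
- by rewrite /rho; mfun.
- by move=> q; rewrite mule_ge0// lee_fin.
Qed.

Let Phi_ge0 (phi : R -> \bar R) (x y : R) : (forall z, (0 <= phi z)%E) ->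
  (0 <= Phi phi x y)%E.
Proof. by move=> phi0; apply: integral_ge0 => u _; rewrite mule_ge0// lee_fin. Qed.

Let PhiN (phi : R -> \bar R) (x y : R) : measurable_fun setT phi ->
  (forall z, (0 <= phi z)%E) ->
  Phi phi x (- y) = Phi phi x y /\ Phi phi (- x) y = Phi phi x y.
Proof.
move=> mphi phi0.
have E : Phi phi x y = (\int[leb]_u (phi (Num.sqrt (x ^+ 2 + y ^+ 2 - 2 * x * y * u)) * (W u)%:E))%E.
  rewrite /Phi ge0_integral_oppr//.
  - by apply: eq_integral => u _; rewrite /rho gegenbauer_weightN mulrN.
  - by rewrite /rho; mfun.
  - by move=> u; rewrite mule_ge0// lee_fin.
by split; rewrite E; apply: eq_integral => u _; rewrite /rho sqrrN ?mulrN ?mulNr.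
Qed.

(** The reflection u -> -u shows that the inner integral is even in x and in y. The factor 2 counts
    the signs of y; the rest is [gegenbauer_triangle_swap] with |x|. *)
Lemma dunkl_integral_rho (phi : R -> \bar R) (x r : R) : x != 0 -> 0 < r ->
  measurable_fun setT phi -> (forall z, (0 <= phi z)%E) ->
  (\int[dunkl_measure nu]_(y in `](- r)%R, r[) \int[leb]_u (phi (rho x y u) * (W u)%:E) =
   2%:E * \int[dunkl_measure nu]_(z in `]0%R, +oo[) (phi z * cap_mass nu r `|x| z))%E.
Proof.
move=> x0 r0 mphi phi0; have ax0 : 0 < `|x| by rewrite normr_gt0.
have mPhi := measurable_Phi x mphi phi0.
have mcap := measurable_cap_mass nu r `|x|.
have k0 := dunkl_cst_ge0 nu.
have mdens := measurable_dunkl_density nu.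
have d0 := dunkl_density_ge0 nu.
rewrite -/(Phi phi x) ge0_integral_dunkl//; last 2 first.
- exact: measurable_funTS.
- by move=> y _; exact: Phi_ge0.
rewrite ge0_integral_dunkl//; last 2 first.
- by apply: measurable_funTS; mfun.
- by move=> z _; rewrite mule_ge0// cap_mass_ge0.
rewrite [LHS]integral_mul_indic ge0_integral_fold; last 2 first.
- by mfun.
- by move=> y; rewrite !mule_ge0 ?Phi_ge0 ?lee_fin// indicE.
transitivity (2%:E * (dunkl_cst nu)%:E * \int[leb]_(y in `]0%R, r[)
    ((y `^ (2 * nu + 1))%:E * Phi phi `|x| y))%E.
  rewrite -EFinM -ge0_integralZl//; last 3 first.
  - apply: measurable_funTS; have := measurable_Phi `|x| mphi phi0 => mPhi'; by mfun.
  - by move=> y _; rewrite mule_ge0 ?Phi_ge0// lee_fin powR_ge0.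
  - by rewrite lee_fin mulr_ge0.
  rewrite [LHS]integral_mul_indic [RHS]integral_mul_indic.
  apply: eq_integral => y _; rewrite !indic_ball !indicE !in_set_itv !in_itv/= andbT.
  have [y0|y0] := leP y 0; first by rewrite !mule0.
  rewrite mule1 normrN dunkl_densityN -/(Phi phi x y) -/(Phi phi x (- y)).
  rewrite (PhiN x y mphi phi0).1.
  have -> : Phi phi `|x| y = Phi phi x y.
    case: (leP 0 x) => h; first by rewrite ger0_norm.
    by rewrite ltr0_norm// (PhiN x y mphi phi0).2.
  rewrite dunkl_densityE (gtr0_norm y0)/=.
  have [yr|_] := ltP y r; last by rewrite !mule0 adde0.
  rewrite !mule1 -ge0_muleDr ?lee_fin ?mulr_ge0 ?powR_ge0//.
  by rewrite -EFinD muleA -EFinM [RHS]muleC; congr (_ * _%:E)%E; ring.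
rewrite (gegenbauer_triangle_swap nu ax0 r0 mphi phi0) -muleA; congr (_ * _)%E.
rewrite -ge0_integralZl//; last 2 first.
- by apply: measurable_funTS; mfun.
- by move=> z _; rewrite !mule_ge0 ?cap_mass_ge0// lee_fin powR_ge0.
apply: eq_integral => z; rewrite inE/= in_itv/= andbT => z0.
rewrite dunkl_densityE (gtr0_norm z0) EFinM muleCA -!muleA; congr (_ * _)%E.
by rewrite [RHS]muleC -muleA; congr (_ * _)%E; rewrite muleC.
Qed.

End dunkl_even.

Section dunkl_even_bounds.
Context (R : realType) (nu : R).
Hypothesis hnu : - 2^-1 < nu.
Local Notation mu := (dunkl_measure nu).
Local Notation leb := (@lebesgue_measure R).
Local Notation W := (gegenbauer_weight nu).

(* Comparable to mu(B(0,r)) / mu({z : ||z| - |x|| < r}). *)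
Definition ball_ratio (x r : R) : R := (r / (`|x| + r)) `^ (2 * nu + 1).
Local Notation kb := ball_ratio.

Lemma ball_ratio_ge0 x r : 0 <= kb x r.
Proof. exact: powR_ge0. Qed.

(** The indicator of a shell, kept as a real factor of the integrand rather than as a domain of
    integration. *)
Definition near_sphere (x r z : R) : R := (`| `|z| - `|x| | < r)%R%:R.
Local Notation nb := near_sphere.

Lemma near_sphere_ge0 x r z : 0 <= nb x r z.
Proof. by rewrite /near_sphere. Qed.

Lemma near_sphereN x r z : nb x r (- z) = nb x r z.
Proof. by rewrite /near_sphere normrN. Qed.

Lemma measurable_near_sphere x r : measurable_fun setT (nb x r).
Proof. by rewrite /near_sphere; mfun. Qed.

Lemma ge0_integral_dunkl_fold (f : R -> \bar R) :
  measurable_fun setT f -> (forall x, (0 <= f x)%E) ->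
  (\int[mu]_x f x = \int[mu]_(x in `]0%R, +oo[) (f x + f (- x)%R))%E.
Proof.
move=> mf f0; have md := measurable_dunkl_density nu.
have d0 := dunkl_density_ge0 nu.
rewrite !ge0_integral_dunkl//; [|by apply: measurable_funTS; mfun|by move=> x _; rewrite adde_ge0].
rewrite ge0_integral_fold; [|by mfun|by move=> x; rewrite mule_ge0// lee_fin].
by apply: eq_integral => x _; rewrite dunkl_densityN ge0_muleDl.
Qed.

Lemma dunkl_even_upper : exists2 C : R, 0 < C & forall (phi : R -> \bar R) x r,
  x != 0 -> 0 < r -> measurable_fun setT phi -> (forall z, (0 <= phi z)%E) ->
  (\int[mu]_(y in `](- r)%R, r[) \int[leb]_u (phi (dunkl_rho x y u) * (W u)%:E) <=
   (C * kb x r)%:E * \int[mu]_(z in `]0%R, +oo[) (phi z * (nb x r z)%:E))%E.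
Proof.
have [C C0 HC] := cap_mass_upper hnu.
exists (2 * C); first by rewrite mulr_gt0.
move=> phi x r x0 r0 mphi phi0; have ax0 : 0 < `|x| by rewrite normr_gt0.
rewrite dunkl_integral_rho// -mulrA EFinM -muleA lee_pmul2l//.
have mnb := measurable_near_sphere x r.
have mcap := measurable_cap_mass nu r `|x|.
have kb0 := ball_ratio_ge0 x r.
rewrite -ge0_integralZl//; last 3 first.
- by apply: measurable_funTS; mfun.
- by move=> z _; rewrite mule_ge0// lee_fin.
- by rewrite lee_fin mulr_ge0// ltW.
apply: ge0_le_integral => //.
- by move=> z _; rewrite mule_ge0// cap_mass_ge0.
- by apply: measurable_funTS; mfun.
- by apply: measurable_funTS; mfun.
- move=> z; rewrite /= in_itv/= andbT => z0.
  rewrite muleCA -EFinM lee_wpmul2l//; apply: le_trans (HC _ _ _ r0 ax0 z0) _.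
  by rewrite lee_fin /near_sphere (gtr0_norm z0).
Qed.

Lemma dunkl_even_lower : exists2 c : R, 0 < c & forall (phi : R -> \bar R) x r,
  0 < r -> r <= `|x| -> measurable_fun setT phi -> (forall z, (0 <= phi z)%E) ->
  ((c * kb x r)%:E * \int[mu]_(z in `]0%R, +oo[) (phi z * (nb x (r / 2) z)%:E) <=
   \int[mu]_(y in `](- r)%R, r[) \int[leb]_u (phi (dunkl_rho x y u) * (W u)%:E))%E.
Proof.
have [C C0 HC] := cap_mass_lower hnu.
exists (2 * C); first by rewrite mulr_gt0.
move=> phi x r r0 rx mphi phi0; have ax0 : 0 < `|x| by exact: lt_le_trans rx.
have x0 : x != 0 by rewrite -normr_gt0.
rewrite dunkl_integral_rho// -mulrA EFinM -muleA lee_pmul2l//.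
have mnb := measurable_near_sphere x (r / 2).
have mcap := measurable_cap_mass nu r `|x|.
have kb0 := ball_ratio_ge0 x r.
have nb0 := near_sphere_ge0 x (r / 2).
rewrite -ge0_integralZl//; last 3 first.
- by apply: measurable_funTS; mfun.
- by move=> z _; rewrite mule_ge0// lee_fin.
- by rewrite lee_fin mulr_ge0// ltW.
apply: ge0_le_integral => //.
- by move=> z _; rewrite !mule_ge0// lee_fin// mulr_ge0// ltW.
- by apply: measurable_funTS; mfun.
- by apply: measurable_funTS; mfun.
- move=> z; rewrite /= in_itv/= andbT => z0.
  rewrite muleCA -EFinM lee_wpmul2l//.
  rewrite /near_sphere (gtr0_norm z0); have [h|h] := ltP `|z - `|x| | (r / 2).
    by rewrite mulr1; exact: HC.
  by rewrite mulr0 cap_mass_ge0.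
Qed.

End dunkl_even_bounds.

(** * Removal of the odd part of the kernel *)

Section dunkl_translation.
Context (R : realType) (nu : R).
Hypothesis hnu : - 2^-1 < nu.
Local Notation mu := (dunkl_measure nu).
Local Notation leb := (@lebesgue_measure R).
Local Notation W := (gegenbauer_weight nu).
Local Notation rho := dunkl_rho.
Local Notation kb := (ball_ratio nu).
Local Notation nb := (@near_sphere R).

Let mW : measurable_fun setT W := measurable_gegenbauer_weight nu.
Let W0 u : 0 <= W u := gegenbauer_weight_ge0 nu u.

Let W_supp u : W u != 0 -> -1 < u < 1.
Proof.
rewrite /gegenbauer_weight indicE in_set_itv in_itv/= => Wu.
by apply: contraNT Wu => /negbTE ->; rewrite mulr0.
Qed.

(* The cosine of the angle opposite to y in the triangle with sides x, y, rho. *)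
Definition dunkl_cos (x y u : R) : R := (x + y * u) / rho x y u.
Local Notation v := dunkl_cos.

Let rho_sq (x y u : R) : -1 <= u <= 1 -> rho x y u ^+ 2 = x ^+ 2 + y ^+ 2 + 2 * x * y * u.
Proof.
move=> /andP[u1 u2]; rewrite /dunkl_rho sqr_sqrtr//.
have -> : x ^+ 2 + y ^+ 2 + 2 * x * y * u = (x + y * u) ^+ 2 + y ^+ 2 * (1 - u ^+ 2) by ring.
rewrite addr_ge0 ?sqr_ge0// mulr_ge0 ?sqr_ge0//; nra.
Qed.

Let rho_ge0 (x y u : R) : 0 <= rho x y u. Proof. exact: sqrtr_ge0. Qed.

(** rho^2 = (x + y u)^2 + y^2 (1 - u^2). *)
Lemma dunkl_cos_le1 (x y u : R) : -1 <= u <= 1 -> `|v x y u| <= 1.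
Proof.
move=> hu; rewrite /dunkl_cos normrM normfV (ger0_norm (rho_ge0 _ _ _)).
have [->|h] := eqVneq (rho x y u) 0; first by rewrite invr0 mulr0.
rewrite ler_pdivrMr ?lt0r ?h ?rho_ge0// mul1r.
rewrite -(ler_pXn2r (n := 2)) ?nnegrE// real_normK ?num_real// rho_sq//.
have -> : x ^+ 2 + y ^+ 2 + 2 * x * y * u = (x + y * u) ^+ 2 + y ^+ 2 * (1 - u ^+ 2) by ring.
by rewrite lerDl mulr_ge0 ?sqr_ge0//; case/andP: hu => ? ?; nra.
Qed.

Let v' (x y u : R) : R := (x * u + y) / rho x y u.

Let v'_le1 (x y u : R) : -1 <= u <= 1 -> `|v' x y u| <= 1.
Proof.
move=> hu; have := dunkl_cos_le1 y x hu.
rewrite /dunkl_cos /v' /dunkl_rho.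
by rewrite addrC [y ^+ 2 + _]addrC -[2 * y * x]mulrAC.
Qed.

(** The signs s = 1 and s = -1 are the coefficients of g(rho) and g(-rho). The unbounded quotient (x
    + y)/rho becomes, after multiplication by 1 + u, a sum of two cosines. *)
Let coef_split (x y u s : R) :
  (1 + s * ((x + y) / rho x y u)) * (1 + u) = (1 + s * v x y u) + (u + s * v' x y u).
Proof. by rewrite /dunkl_cos /v'; ring. Qed.

(** The even part of the kernel. As |v| <= 1 on the support of the weight, the integrand is
    nonnegative when g is, unlike that of [dunkl_transl]. *)
Definition dunkl_ball_int (x r : R) (g : R -> \bar R) : \bar R :=
  (\int[mu]_(y in `](- r)%R, r[) \int[leb]_u
     ((g (rho x y u) * (1 + v x y u)%:E + g (- rho x y u)%R * (1 - v x y u)%:E) *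
      (W u)%:E))%E.

Variables (x r : R) (g : R -> \bar R).
Hypotheses (x0 : x != 0) (r0 : 0 < r).
Hypotheses (mg : measurable_fun setT g) (g0 : forall z, (0 <= g z)%E).
Hypothesis gfin : forall b : R, 0 < b -> (\int[mu]_(z in `](- b)%R, b[) g z < +oo)%E.

Let B (y : R) : R := \1_(`](- r), r[ : set R) y.

Let B0 y : 0 <= B y. Proof. by rewrite /B indicE. Qed.

(** Dominates, up to constants, the full integrand [F], its even part [Fe] and its odd part [Fo].
    Its integrability in (y, u), a consequence of [dunkl_even_upper], is what permits splitting the
    integral of [F]. *)
Let G (p : R * R) : \bar R :=
  ((g (rho x p.1 p.2) + g (- rho x p.1 p.2)%R) * (W p.2 * B p.1)%:E)%E.

Let mG : measurable_fun setT G.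
Proof. by rewrite /G /B /dunkl_rho; mfun. Qed.

Let G0 p : (0 <= G p)%E.
Proof. by rewrite mule_ge0 ?adde_ge0// lee_fin mulr_ge0. Qed.

Let G_lty : (\int[mu]_y \int[leb]_u G (y, u) < +oo)%E.
Proof.
have [C C0 HC] := dunkl_even_upper hnu.
pose phi z := (g z + g (- z)%R)%E.
have mphi : measurable_fun setT phi by rewrite /phi; mfun.
have phi0 z : (0 <= phi z)%E by rewrite adde_ge0.
have mnb := measurable_near_sphere x r.
have nb0 := near_sphere_ge0 x r.
have -> : (\int[mu]_y \int[leb]_u G (y, u) =
   \int[mu]_(y in `](- r)%R, r[) \int[leb]_u (phi (rho x y u) * (W u)%:E))%E.
  rewrite [RHS]integral_mul_indic; apply: eq_integral => y _.
  rewrite -ge0_integralZr_real//; [|by rewrite /dunkl_rho; mfun|by move=> u; rewrite mule_ge0// lee_fin].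
  by apply: eq_integral => u _; rewrite /G /= EFinM muleA.
apply: le_lt_trans (HC _ _ _ x0 r0 mphi phi0) _.
have -> : (\int[mu]_(z in `]0%R, +oo[) (phi z * (nb x r z)%:E) =
    \int[mu]_z (g z * (nb x r z)%:E))%E.
  rewrite [RHS]ge0_integral_dunkl_fold//; [|by mfun|by move=> z; rewrite mule_ge0// lee_fin].
  by apply: eq_integral => z _; rewrite near_sphereN ge0_muleDl.
have b0 : 0 < `|x| + r by rewrite ltr_wpDl.
apply: (@le_lt_trans _ _ ((C * kb x r)%:E * \int[mu]_(z in `](- (`|x| + r))%R, (`|x| + r)%R[) g z)%E).
  rewrite lee_wpmul2l ?lee_fin ?mulr_ge0 ?ball_ratio_ge0 ?(ltW C0)//.
  rewrite [leRHS]integral_mul_indic; apply: ge0_le_integralT.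
  - by mfun.
  - by mfun.
  - by move=> z; rewrite mule_ge0// lee_fin.
  - move=> z; rewrite lee_wpmul2l// lee_fin indic_ball /near_sphere.
    case: (ltP `| `|z| - `|x| | r) => // h.
    suff -> : `|z| < `|x| + r by [].
    by move: h; rewrite ltr_norml => /andP[]; lra.
have : (0 <= \int[mu]_(z in `](- (`|x| + r))%R, (`|x| + r)%R[) g z)%E by exact: integral_ge0.
move: (gfin b0); case: (\int[mu]_(z in _) g z)%E => // s _ _.
by rewrite -EFinM ltry.
Qed.

Let F (p : R * R) : \bar R :=
  ((g (rho x p.1 p.2) * (1 + (x + p.1) / rho x p.1 p.2)%:E +
    g (- rho x p.1 p.2)%R * (1 - (x + p.1) / rho x p.1 p.2)%:E) *
   ((1 + p.2) * (W p.2 * B p.1))%:E)%E.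

Let Fe (p : R * R) : \bar R :=
  ((g (rho x p.1 p.2) * (1 + v x p.1 p.2)%:E +
    g (- rho x p.1 p.2)%R * (1 - v x p.1 p.2)%:E) *
   (W p.2 * B p.1)%:E)%E.

(** The odd part involves differences, and g may be infinite: [fine] makes [Fo] real-valued, at the
    price of an identity F = Fe + Fo valid only where [G] is finite. *)
Let gf z : R := fine (g z).

Let Fo (p : R * R) : R :=
  (gf (rho x p.1 p.2) * (p.2 + v' x p.1 p.2) +
   gf (- rho x p.1 p.2) * (p.2 - v' x p.1 p.2)) * (W p.2 * B p.1).

Let mF : measurable_fun setT F.
Proof. by rewrite /F /B /dunkl_rho; mfun. Qed.

Let mFe : measurable_fun setT Fe.
Proof. by rewrite /Fe /B /dunkl_cos /dunkl_rho; mfun. Qed.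

Let mgf : measurable_fun setT gf.
Proof. exact: measurableT_comp. Qed.

Let mFo : measurable_fun setT Fo.
Proof. by rewrite /Fo /B /v' /dunkl_rho; mfun. Qed.

Let bound (k : R) (H : R * R -> \bar R) : 0 <= k -> measurable_fun setT H ->
  (forall p, (`|H p| <= k%:E * G p)%E) ->
  ((mu \x leb)%E).-integrable setT H.
Proof.
move=> k0 mH HG; apply/integrable12ltyP; first exact: mH.
have maH : measurable_fun setT (abse \o H) by exact: measurableT_comp.
have aH0 p : (0 <= (abse \o H) p)%E by exact: abse_ge0.
have mkG : measurable_fun setT (fun p => k%:E * G p)%E by mfun.
have kG0 p : (0 <= k%:E * G p)%E by rewrite mule_ge0// lee_fin.
apply: (@le_lt_trans _ _ (\int[mu]_y \int[leb]_u (k%:E * G (y, u)))%E).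
  apply: ge0_le_integralT.
  - exact: (measurable_fun_fubini_tonelli_F (m2 := leb) _ maH aH0).
  - exact: (measurable_fun_fubini_tonelli_F (m2 := leb) _ mkG kG0).
  - by move=> y; exact: integral_ge0.
  - move=> y; apply: ge0_le_integralT => //.
    + by apply: measurableT_comp => //; exact: measurableT_comp.
    + apply: emeasurable_funM => //; exact: measurableT_comp.
have mGy y : measurable_fun setT (fun u => G (y, u)) by exact: measurableT_comp.
have mGi : measurable_fun setT (fun y => \int[leb]_u G (y, u))%E.
  exact: (measurable_fun_fubini_tonelli_F (m2 := leb) G).
have -> : (\int[mu]_y \int[leb]_u (k%:E * G (y, u)) =
    k%:E * \int[mu]_y \int[leb]_u G (y, u))%E.
  rewrite -ge0_integralZl_real//; last by move=> y; exact: integral_ge0.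
  apply: eq_integral => y _; apply: ge0_integralZl_real => //; exact: mGy.
have : (0 <= \int[mu]_y \int[leb]_u G (y, u))%E.
  by apply: integral_ge0 => y _; exact: integral_ge0.
move: G_lty; case: (\int[mu]_y \int[leb]_u G (y, u))%E => // a _ _.
by rewrite -EFinM ltry.
Qed.

Let le_coef (a b : \bar R) (al be t w k : R) : (0 <= a)%E -> (0 <= b)%E -> 0 <= w ->
  0 <= t -> `|al| * t <= k -> `|be| * t <= k ->
  (`|(a * al%:E + b * be%:E) * (t * w)%:E| <= k%:E * ((a + b) * w%:E))%E.
Proof.
move=> a0 b0 w0 t0 alk bek.
have k0 : 0 <= k by apply: le_trans alk; rewrite mulr_ge0.
have tw0 : (0 <= (t * w)%:E)%E by rewrite lee_fin mulr_ge0.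
rewrite abseM (gee0_abs tw0) EFinM !muleA lee_wpmul2r ?lee_fin//.
apply: (@le_trans _ _ ((a * `|al|%:E + b * `|be|%:E) * t%:E)%E).
  rewrite lee_wpmul2r ?lee_fin//.
  by apply: le_trans (lee_abs_add _ _) _; rewrite !abseM (gee0_abs a0) (gee0_abs b0).
rewrite ge0_muleDl ?mule_ge0 ?lee_fin// ge0_muleDr// !(muleC k%:E) -!muleA -!EFinM.
by rewrite leeD// lee_wpmul2l ?lee_fin.
Qed.

Let W_supp' u : W u != 0 -> -1 <= u <= 1.
Proof. by move=> /W_supp/andP[/ltW -> /ltW ->]. Qed.

Let intF : ((mu \x leb)%E).-integrable setT F.
Proof.
(* By [coef_split] each coefficient is a sum of four terms of modulus at most 1. *)
apply: (@bound 4) => // -[y u]; rewrite /F /G /=.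
have [->|/W_supp' hu] := eqVneq (W u) 0; first by rewrite !(mul0r, mulr0) !mule0 abse0.
have /ler_normlP[v1 v2] := dunkl_cos_le1 x y hu.
have /ler_normlP[v3 v4] := v'_le1 x y hu.
move: hu => /andP[hu1 hu2].
apply: le_coef => //; first exact: mulr_ge0.
- lra.
- rewrite -[1 + u]ger0_norm; last lra.
  rewrite -normrM -[(x + y) / _]mul1r coef_split; apply/ler_normlP; split; lra.
- rewrite -[1 + u]ger0_norm; last lra.
  rewrite -normrM -[- ((x + y) / _)]mulN1r coef_split; apply/ler_normlP; split; lra.
Qed.

Let Fe0 p : (0 <= Fe p)%E.
Proof.
case: p => y u; rewrite /Fe /=.
have [->|/W_supp' hu] := eqVneq (W u) 0; first by rewrite mul0r mule0.
have /ler_normlP[v1 v2] := dunkl_cos_le1 x y hu.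
apply: mule_ge0; last by rewrite lee_fin mulr_ge0.
by apply: adde_ge0; apply: mule_ge0 => //; rewrite lee_fin; lra.
Qed.

Let intFe : ((mu \x leb)%E).-integrable setT Fe.
Proof.
apply: (@bound 2) => // -[y u]; rewrite /Fe /G /=.
have [->|/W_supp' hu] := eqVneq (W u) 0; first by rewrite !mul0r !mule0 abse0.
have /ler_normlP[v1 v2] := dunkl_cos_le1 x y hu.
rewrite -[X in (_ * X%:E)%E]mul1r; apply: le_coef => //; first exact: mulr_ge0.
- by rewrite mulr1; apply/ler_normlP; split; lra.
- by rewrite mulr1; apply/ler_normlP; split; lra.
Qed.

Let intFo : ((mu \x leb)%E).-integrable setT (EFin \o Fo).
Proof.
apply: (@bound 2) => //; first by move: mFo; exact: measurable_fun_EFin.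
move=> [y u]; rewrite /Fo /G /=.
have [->|/W_supp' hu] := eqVneq (W u) 0; first by rewrite !(mul0r, mulr0) !mule0 normr0.
have /ler_normlP[v1 v2] := v'_le1 x y hu.
have gf0 z : 0 <= gf z by rewrite fine_ge0.
have gfg z : ((gf z)%:E <= g z)%E.
  by rewrite /gf; have := g0 z; case: (g z) => //= *; rewrite leey.
move: (hu) => /andP[hu1 hu2].
apply: (@le_trans _ _ (2%:E * (((gf (rho x y u))%:E + (gf (- rho x y u))%:E) * (W u * B y)%:E))%E).
  have h : (`|((gf (rho x y u))%:E * (u + v' x y u)%:E +
      (gf (- rho x y u))%:E * (u - v' x y u)%:E) * (1 * (W u * B y))%:E| <=
      2%:E * (((gf (rho x y u))%:E + (gf (- rho x y u))%:E) * (W u * B y)%:E))%E.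
    apply: le_coef; [by rewrite lee_fin|by rewrite lee_fin|exact: mulr_ge0|by []| |];
      by rewrite mulr1; apply/ler_normlP; split; lra.
  by apply: le_trans h; rewrite mul1r.
apply: lee_wpmul2l; first by [].
apply: lee_wpmul2r; first by rewrite lee_fin mulr_ge0.
by apply: leeD; exact: gfg.
Qed.

Let G_ae : {ae (mu \x leb)%E, forall p, G p \is a fin_num}.
Proof.
have intG : ((mu \x leb)%E).-integrable setT G.
  by apply: (@bound 1) => // p; rewrite mul1e gee0_abs.
have := integrable_ae measurableT intG.
by apply: filterS => p; apply.
Qed.

(** Where [G] is finite, either the weight vanishes and both sides are 0, or g is finite at rho and
    at -rho and [coef_split] applies with s = 1 and s = -1. *)
Let F_ae : ae_eq (mu \x leb)%E setT F (fun p => Fe p + (Fo p)%:E)%E.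
Proof.
have flt : Filter (almost_everywhere (mu \x leb)%E).
  exact: (@ae_filter_ringOfSetsType _ _ _ (mu \x leb)%E).
apply: filterS G_ae => -[y u]; rewrite /G /F /Fe /Fo /=.
have [->|wb] := eqVneq (W u * B y) 0; first by rewrite !(mul0r, mulr0) !mule0 adde0.
move=> Gfin _.
have wb0 : 0 < W u * B y by rewrite lt0r wb mulr_ge0.
have gg : (g (rho x y u) + g (- rho x y u)%R)%E \is a fin_num.
  rewrite ge0_fin_numE ?adde_ge0//; move: Gfin; rewrite ge0_fin_numE; last first.
    by rewrite mule_ge0 ?adde_ge0// lee_fin ltW.
  move: (g (rho x y u) + g (- rho x y u)%R)%E => [a _| |//]; first exact: ltry.
  by rewrite gt0_mulye ?lte_fin.
move: gg; rewrite fin_numD => /andP[g1 g2].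
rewrite -(fineK g1) -(fineK g2) -/(gf _) -/(gf (- _)).
have c1 := coef_split x y u 1; rewrite !mul1r in c1.
have c2 := coef_split x y u (- 1); rewrite !mulN1r in c2.
suff h : (gf (rho x y u) * (1 + (x + y) / rho x y u) +
    gf (- rho x y u) * (1 - (x + y) / rho x y u)) * ((1 + u) * (W u * B y)) =
  (gf (rho x y u) * (1 + v x y u) + gf (- rho x y u) * (1 - v x y u)) * (W u * B y) +
   (gf (rho x y u) * (u + v' x y u) + gf (- rho x y u) * (u - v' x y u)) * (W u * B y).
  exact: (congr1 EFin h).
transitivity ((gf (rho x y u) * ((1 + (x + y) / rho x y u) * (1 + u)) +
    gf (- rho x y u) * ((1 - (x + y) / rho x y u) * (1 + u))) * (W u * B y)); first ring.
by rewrite c1 c2; ring.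
Qed.

(** Reflecting y and u preserves both measures and changes the sign of [Fo], so the integral is its
    own opposite; integrability excludes infinite values. *)
Let intFo0 : (\int[(mu \x leb)%E]_p (Fo p)%:E = 0)%E.
Proof.
have FoN p : Fo (- p.1, - p.2) = - Fo p.
  case: p => y u; rewrite /Fo /= gegenbauer_weightN.
  have -> : B (- y) = B y by rewrite /B !indic_ball normrN.
  have -> : rho x (- y) (- u) = rho x y u by rewrite /dunkl_rho sqrrN; congr Num.sqrt; ring.
  have -> : v' x (- y) (- u) = - v' x y u.
    by rewrite /v' /dunkl_rho sqrrN -mulNr; congr (_ / Num.sqrt _); ring.
  by ring.
have mFoy y : measurable_fun setT (fun u => (Fo (y, u))%:E).
  by apply/measurable_EFinP; exact: measurableT_comp.
have E : (\int[mu]_y \int[leb]_u (Fo (y, u))%:E = \int[(mu \x leb)%E]_p (Fo p)%:E)%E.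
  exact: (integral12_prod_meas1 (m1 := mu) (m2 := leb) intFo).
have E2 : (\int[mu]_y \int[leb]_u (Fo (y, u))%:E =
    \int[mu]_y \int[leb]_u (- Fo (y, u))%:E)%E.
  rewrite integral_dunklN; last first.
    exact: (measurable_fubini_F (m1 := mu) (m2 := leb) intFo).
  apply: eq_integral => y _; rewrite integral_lebN; last exact: mFoy.
  by apply: eq_integral => u _; rewrite (FoN (y, u)).
have : (\int[(mu \x leb)%E]_p (Fo p)%:E = - \int[(mu \x leb)%E]_p (Fo p)%:E)%E.
  rewrite -[LHS]E E2.
  have intFoN : ((mu \x leb)%E).-integrable setT (\- (EFin \o Fo))%E by exact: integrableN.
  rewrite (integral12_prod_meas1 (m1 := mu) (m2 := leb) intFoN).
  by rewrite integralN//; exact: integrable_add_def.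
have := integrable_fin_num measurableT intFo.
rewrite /comp; case: (\int[(mu \x leb)%E]_p (Fo p)%:E)%E => // a _ /eqP.
by rewrite -EFinN eqe => /eqP h; congr EFin; lra.
Qed.

(* With v = (x + y u) / rho and v' = (x u + y) / rho, one has
   (1 + (x + y) / rho) (1 + u) = (1 + v) + (u + v'), and the second summand is odd
   under (y, u) |-> (-y, -u). *)
Lemma dunkl_transl_ball :
  (\int[mu]_(y in `](- r)%R, r[) dunkl_transl nu x g y =
   (dunkl_transl_const nu / 2)%:E * dunkl_ball_int x r g)%E.
Proof.
have -> : (\int[mu]_(y in `](- r)%R, r[) dunkl_transl nu x g y =
    \int[mu]_y ((dunkl_transl_const nu / 2)%:E * \int[leb]_u F (y, u)))%E.
  rewrite integral_mkcond; apply: eq_integral => y _; rewrite patchE.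
  rewrite /F /= /B indicE; case: ifPn => [yr|yr]; last first.
    by rewrite integral0_eq ?mule0// => u _; rewrite !mulr0 mule0.
  rewrite /dunkl_transl ifF; last by apply/negbTE; rewrite gt_eqF.
  congr (_ * _)%E; rewrite integral_mul_indic; apply: eq_integral => u _ /=.
  rewrite -[LHS]muleA -EFinM mulr1 -[X in (_ * X%:E)%E]mulrA.
  by rewrite -/(gegenbauer_weight nu u) /dunkl_rho.
have iH := integrable_fubini_F (m1 := mu) (m2 := leb) intF.
have E := integral12_prod_meas1 (m1 := mu) (m2 := leb) intF.
rewrite /fubini_F in iH E; move: (dunkl_transl_const nu / 2) => k.
transitivity (k%:E * \int[mu]_y \int[leb]_u F (y, u))%E.
  have ZL (H : R -> \bar R) : mu.-integrable setT H ->
      (\int[mu]_y (k%:E * H y) = k%:E * \int[mu]_y H y)%E.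
    by move=> ?; exact: integralZl.
  exact: (ZL (fun y => \int[leb]_u F (y, u))%E iH).
suff E' : (\int[(mu \x leb)%E]_p F p = dunkl_ball_int x r g)%E.
  by apply: (congr1 (fun t => k%:E * t)%E); exact: etrans E E'.
have -> : (\int[(mu \x leb)%E]_p F p = \int[(mu \x leb)%E]_p (Fe p + (Fo p)%:E))%E.
  apply: ae_eq_integral => //.
  by apply: emeasurable_funD => //; exact: measurable_fun_EFin.
transitivity (\int[(mu \x leb)%E]_p Fe p + \int[(mu \x leb)%E]_p (Fo p)%:E)%E.
  exact: integralD.
rewrite intFo0 adde0; transitivity (\int[mu]_y \int[leb]_u Fe (y, u))%E.
  exact: (fubini_tonelli1 (m1 := mu) (m2 := leb) _ mFe Fe0).
rewrite /dunkl_ball_int [RHS]integral_mul_indic; apply: eq_integral => y _.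
transitivity (\int[leb]_u (((g (rho x y u) * (1 + v x y u)%:E +
    g (- rho x y u)%R * (1 - v x y u)%:E) * (W u)%:E) * (B y)%:E))%E.
  by apply: eq_integral => u _; rewrite /Fe /= EFinM muleA.
apply: ge0_integralZr_real => //.
- by rewrite /dunkl_cos /dunkl_rho; mfun.
- move=> u; have [->|/W_supp' hu] := eqVneq (W u) 0; first by rewrite mule0.
  have /ler_normlP[v1 v2] := dunkl_cos_le1 x y hu.
  apply: mule_ge0; last by rewrite lee_fin.
  by apply: adde_ge0; apply: mule_ge0 => //; rewrite lee_fin; lra.
Qed.

End dunkl_translation.

(** * Two-sided bounds for translations integrated over balls *)

Section dunkl_translation_bounds.
Context (R : realType) (nu : R).
Hypothesis hnu : - 2^-1 < nu.
Local Notation mu := (dunkl_measure nu).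
Local Notation leb := (@lebesgue_measure R).
Local Notation W := (gegenbauer_weight nu).
Local Notation rho := dunkl_rho.
Local Notation kb := (ball_ratio nu).
Local Notation nb := (@near_sphere R).
Local Notation v := dunkl_cos.
Local Notation c := (dunkl_transl_const nu / 2).

Definition dunkl_locfin (g : R -> \bar R) : Prop :=
  forall b : R, 0 < b -> (\int[mu]_(z in `](- b)%R, b[) g z < +oo)%E.

Lemma dunkl_transl_const_gt0 : 0 < dunkl_transl_const nu.
Proof.
rewrite divr_gt0 ?euler_Gamma_gt0//; first by move: hnu; lra.
by rewrite mulr_gt0 ?sqrtr_gt0 ?pi_gt0// euler_Gamma_gt0//; move: hnu; lra.
Qed.

Let c0 : 0 < c. Proof. by rewrite divr_gt0// dunkl_transl_const_gt0. Qed.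

Let mW : measurable_fun setT W := measurable_gegenbauer_weight nu.
Let W0 u : 0 <= W u := gegenbauer_weight_ge0 nu u.

Let W_supp u : W u != 0 -> -1 < u < 1.
Proof.
rewrite /gegenbauer_weight indicE in_set_itv in_itv/= => Wu.
by apply: contraNT Wu => /negbTE ->; rewrite mulr0.
Qed.

Let h (g : R -> \bar R) (x y u : R) : \bar R :=
  ((g (rho x y u) * (1 + v x y u)%:E + g (- rho x y u)%R * (1 - v x y u)%:E) *
      (W u)%:E)%E.

Let h_ge0 (g : R -> \bar R) (x y u : R) : (forall z, (0 <= g z)%E) -> (0 <= h g x y u)%E.
Proof.
move=> g0; rewrite /h; have [->|/W_supp/andP[u1 u2]] := eqVneq (W u) 0.
  by rewrite mule0.
have hu : -1 <= u <= 1 by rewrite !ltW.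
have /ler_normlP[v1 v2] := dunkl_cos_le1 x y hu.
apply: mule_ge0; last by rewrite lee_fin.
by apply: adde_ge0; apply: mule_ge0 => //; rewrite lee_fin; lra.
Qed.

Lemma dunkl_inner_ge0 (g : R -> \bar R) (x y : R) : (forall z, (0 <= g z)%E) ->
  (0 <= \int[leb]_u
     ((g (rho x y u) * (1 + v x y u)%:E + g (- rho x y u)%R * (1 - v x y u)%:E) *
      (W u)%:E))%E.
Proof. by move=> g0; apply: integral_ge0 => u _; exact: h_ge0. Qed.

Lemma measurable_dunkl_inner (g : R -> \bar R) : measurable_fun setT g ->
  (forall z, (0 <= g z)%E) -> measurable_fun setT (fun p : R * R =>
   \int[leb]_u
     ((g (rho p.1 p.2 u) * (1 + v p.1 p.2 u)%:E +
       g (- rho p.1 p.2 u)%R * (1 - v p.1 p.2 u)%:E) * (W u)%:E))%E.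
Proof.
move=> mg g0.
have mh : measurable_fun setT (fun q : (R * R) * R => h g q.1.1 q.1.2 q.2).
  have m1 : measurable_fun setT (fun q : (R * R) * R => q.1.1).
    by apply: (measurableT_comp measurable_fst); exact: measurable_fst.
  have m2 : measurable_fun setT (fun q : (R * R) * R => q.1.2).
    by apply: (measurableT_comp measurable_snd); exact: measurable_fst.
  by rewrite /h /dunkl_cos /dunkl_rho; mfun.
have h0 (q : (R * R) * R) : (0 <= h g q.1.1 q.1.2 q.2)%E by exact: h_ge0.
exact: (measurable_fun_fubini_tonelli_F (m2 := leb) _ mh h0).
Qed.

Lemma measurable_dunkl_inner1 (g : R -> \bar R) x : measurable_fun setT g ->
  (forall z, (0 <= g z)%E) -> measurable_fun setT (fun y =>
   \int[leb]_u
     ((g (rho x y u) * (1 + v x y u)%:E +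
       g (- rho x y u)%R * (1 - v x y u)%:E) * (W u)%:E))%E.
Proof.
move=> mg g0.
have mh : measurable_fun setT (fun q : R * R => h g x q.1 q.2).
  by rewrite /h /dunkl_cos /dunkl_rho; mfun.
have h0 (q : R * R) : (0 <= h g x q.1 q.2)%E by exact: h_ge0.
exact: (measurable_fun_fubini_tonelli_F (m2 := leb) _ mh h0).
Qed.

Lemma dunkl_ball_int_ge0 (g : R -> \bar R) x r : (forall z, (0 <= g z)%E) ->
  (0 <= dunkl_ball_int nu x r g)%E.
Proof. by move=> g0; apply: integral_ge0 => y _; exact: dunkl_inner_ge0. Qed.

Lemma measurable_dunkl_ball_int (g : R -> \bar R) r : measurable_fun setT g ->
  (forall z, (0 <= g z)%E) -> measurable_fun setT (fun x => dunkl_ball_int nu x r g).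
Proof.
move=> mg g0; rewrite /dunkl_ball_int; under eq_fun do rewrite integral_mul_indic.
pose H (p : R * R) : \bar R := ((\int[leb]_u h g p.1 p.2 u) * (\1_(`](- r), r[ : set R) p.2)%:E)%E.
have mH : measurable_fun setT H.
  apply: emeasurable_funM; first exact: measurable_dunkl_inner.
  by mfun.
have H0 p : (0 <= H p)%E.
  by rewrite mule_ge0 ?dunkl_inner_ge0// lee_fin indicE.
exact: (measurable_fun_fubini_tonelli_F (m2 := mu) _ mH H0).
Qed.

(** For x = 0 one has rho = |y| and the quotient is the sign of y, so only g(y) survives. The
    constant is left abstract, like all the others in these comparisons. *)
Lemma dunkl_transl0 : exists2 k : R, 0 < k & forall (g : R -> \bar R) y,
  (forall z, (0 <= g z)%E) -> dunkl_transl nu 0 g y = (k%:E * g y)%E.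
Proof.
pose m : \bar R := (\int[leb]_u ((1 + u) * W u)%:E)%E.
have w0 u : 0 <= (1 + u) * W u.
  have [->|/W_supp/andP[u1 u2]] := eqVneq (W u) 0; first by rewrite mulr0.
  by rewrite mulr_ge0//; lra.
have m_fin : m \is a fin_num.
  rewrite ge0_fin_numE; last by apply: integral_ge0 => u _; rewrite lee_fin.
  apply: (@le_lt_trans _ _ (\int[leb]_u (2%:E * (W u)%:E))%E).
    apply: ge0_le_integralT; [by mfun|by mfun|by move=> u; rewrite lee_fin|].
    move=> u; rewrite -EFinM lee_fin.
    have [->|/W_supp/andP[u1 u2]] := eqVneq (W u) 0; first by rewrite !mulr0.
    by rewrite ler_wpM2r//; lra.
  rewrite ge0_integralZl_real//; last by mfun.
  have := gegenbauer_mass_lty hnu.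
  have : (0 <= \int[leb]_u (W u)%:E)%E by apply: integral_ge0 => u _; rewrite lee_fin.
  by case: (\int[leb]_u (W u)%:E)%E => // s _ _; rewrite -EFinM ltry.
have m_gt0 : 0 < fine m.
  rewrite fine_gt0// -ge0_fin_numE ?m_fin ?andbT; last first.
    by apply: integral_ge0 => u _; rewrite lee_fin.
  have e1 : 0 < nu - 2^-1 + 1 by move: hnu; lra.
  pose eps : R := 2^-1; have heps : 0 < eps <= 3 / 2 by rewrite /eps; apply/andP; split; lra.
  have lo := gegenbauer_cap_lower hnu heps.
  set K := (X in (X%:E <= _)%E) in lo.
  have K0 : 0 < K by rewrite !mulr_gt0 ?invr_gt0 ?powR_gt0//; case/andP: heps.
  apply: (@lt_le_trans _ _ K%:E); first by rewrite lte_fin.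
  (* The available lower bound is for the cap at -1, where 1 + u is small; a reflection carries it
     to the cap at 1, where 1 + u >= 1. *)
  apply: le_trans lo _; rewrite ge0_integral_oppr; last 2 first.
  - by mfun.
  - by move=> u; rewrite lee_fin mulr_ge0// indicE.
  apply: ge0_le_integralT.
  - by mfun.
  - by mfun.
  - by move=> u; rewrite lee_fin mulr_ge0// indicE.
  - move=> u; rewrite lee_fin gegenbauer_weightN indicE in_set_itv in_itv/= /eps.
    case: andP => [[u1 u2]|_]; last by rewrite mulr0.
    by rewrite mulr1 ler_peMl//; lra.
exists (c * (2 * fine m)); first by rewrite (mulr_gt0 c0)// mulr_gt0.
move=> g y g0; rewrite /dunkl_transl ifF; last by apply/negbTE; rewrite gt_eqF.
rewrite [in RHS]EFinM -[RHS]muleA; congr (_ * _)%E.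
transitivity (\int[leb]_u (2%:E * g y * ((1 + u) * W u)%:E))%E.
  rewrite integral_mul_indic; apply: eq_integral => u _ /=.
  rewrite (_ : 0 ^+ 2 + _ + _ = y ^+ 2); last ring.
  rewrite sqrtr_sqr add0r.
  rewrite -muleA -EFinM -mulrA -/(W u); congr (_ * _)%E.
  case: (ltgtP y 0) => y0.
  - rewrite ltr0_norm// opprK invrN mulrN divff ?lt_eqF// subrr mule0 add0e opprK.
    by rewrite muleC.
  - by rewrite gtr0_norm// divff ?gt_eqF// subrr mule0 adde0 muleC.
  - rewrite y0 normr0 oppr0 mul0r addr0 subr0 mule1.
    by rewrite -[in LHS](mul1e (g 0)) -ge0_muleDl.
transitivity (2%:E * g y * m)%E.
  rewrite ge0_integralZl//; last 3 first.
  - by mfun.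
  - by move=> u _; rewrite lee_fin.
  - by rewrite mule_ge0.
by rewrite -(fineK m_fin) EFinM -!muleA; congr (_ * _)%E; rewrite muleC.
Qed.

(** Both coefficients 1 + v and 1 - v are at most 2, which reduces the bound to the even function
    g(z) + g(-z). The case x = 0, where the triangles degenerate, is read off from
    [dunkl_transl0]. *)
Lemma dunkl_transl_ball_upper : exists2 C : R, 0 < C & forall (g : R -> \bar R) x r,
  0 < r -> measurable_fun setT g -> (forall z, (0 <= g z)%E) -> dunkl_locfin g ->
  (\int[mu]_(y in `](- r)%R, r[) dunkl_transl nu x g y <=
   (C * kb x r)%:E * \int[mu]_z (g z * (nb x r z)%:E))%E.
Proof.
have [C C0 HC] := dunkl_even_upper hnu; have [k k0 Hk] := dunkl_transl0.
exists (k + c * (2 * C)); first by rewrite addr_gt0// (mulr_gt0 c0)// mulr_gt0.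
move=> g x r r0 mg g0 gfin.
have kb0 := ball_ratio_ge0 nu x r.
have mnb := measurable_near_sphere x r; have nb0 := near_sphere_ge0 x r.
have gnb0 z : (0 <= g z * (nb x r z)%:E)%E by rewrite mule_ge0// lee_fin.
have ckb0 : 0 <= c * (2 * C) * kb x r.
  by rewrite mulr_ge0// (mulr_ge0 (ltW c0))// mulr_ge0// ltW.
have kkb0 : 0 <= k * kb x r by rewrite mulr_ge0// ltW.
rewrite mulrDl EFinD ge0_muleDl ?lee_fin//.
have [x0|x0] := eqVneq x 0.
  apply: (@le_trans _ _ ((k * kb x r)%:E * \int[mu]_z (g z * (nb x r z)%:E))%E); last first.
    by rewrite leeDl// mule_ge0//; exact: integral_ge0.
  have -> : (\int[mu]_(y in `](- r)%R, r[) dunkl_transl nu x g y =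
      \int[mu]_(y in `](- r)%R, r[) (k%:E * g y))%E.
    by apply: eq_integral => y _; rewrite x0 Hk.
  have -> : kb x r = 1 by rewrite /ball_ratio x0 normr0 add0r divff ?gt_eqF// powR1.
  rewrite mulr1 ge0_integralZl//; last 2 first.
  - exact: measurable_funTS.
  - by rewrite lee_fin ltW.
  rewrite [leLHS](_ : _ = k%:E * \int[mu]_z (g z * (nb x r z)%:E))%E//; congr (_ * _)%E.
  rewrite integral_mul_indic.
  apply: eq_integral => z _;
    by rewrite indic_ball /near_sphere x0 normr0 subr0 normr_id.
apply: (@le_trans _ _ ((c * (2 * C) * kb x r)%:E * \int[mu]_z (g z * (nb x r z)%:E))%E); last first.
  by rewrite leeDr// mule_ge0//; exact: integral_ge0.
rewrite (dunkl_transl_ball hnu x0 r0 mg g0 gfin).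
rewrite -(mulrA c) -(mulrA 2) [in leRHS]EFinM -[leRHS]muleA.
apply: lee_wpmul2l; first by rewrite lee_fin (ltW c0).
pose phi z := (g z + g (- z)%R)%E.
have mphi : measurable_fun setT phi by rewrite /phi; mfun.
have phi0 z : (0 <= phi z)%E by rewrite adde_ge0.
have E : (\int[mu]_(z in `]0%R, +oo[) (phi z * (nb x r z)%:E) =
    \int[mu]_z (g z * (nb x r z)%:E))%E.
  rewrite [RHS]ge0_integral_dunkl_fold//; last by mfun.
  by apply: eq_integral => z _; rewrite near_sphereN ge0_muleDl.
have := HC phi x r x0 r0 mphi phi0; rewrite E => H.
rewrite EFinM -muleA; apply: le_trans (lee_wpmul2l _ H) => //.
rewrite -ge0_integralZl//; last 2 first.
- apply: measurable_funTS.
  have := @measurable_integral_rho R nu phi mphi phi0 => m1.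
  have mj : measurable_fun setT (fun q : R * R => phi (rho x q.1 q.2) * (W q.2)%:E)%E.
    by rewrite /dunkl_rho; mfun.
  have j0 (q : R * R) : (0 <= phi (rho x q.1 q.2) * (W q.2)%:E)%E.
    by rewrite mule_ge0// lee_fin.
  exact: (measurable_fun_fubini_tonelli_F (m2 := leb) _ mj j0).
- by move=> y _; apply: integral_ge0 => u _; rewrite mule_ge0// lee_fin.
apply: ge0_le_integral => //.
- by move=> y _; exact: dunkl_inner_ge0.
- by apply: measurable_funTS; exact: measurable_dunkl_inner1.
- apply: measurable_funTS; apply: emeasurable_funM => //.
  have mj : measurable_fun setT (fun q : R * R => phi (rho x q.1 q.2) * (W q.2)%:E)%E.
    by rewrite /dunkl_rho; mfun.
  have j0 (q : R * R) : (0 <= phi (rho x q.1 q.2) * (W q.2)%:E)%E.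
    by rewrite mule_ge0// lee_fin.
  exact: (measurable_fun_fubini_tonelli_F (m2 := leb) _ mj j0).
- move=> y _; rewrite -ge0_integralZl_real//; [|by rewrite /dunkl_rho; mfun|by move=> u; rewrite mule_ge0// lee_fin].
  apply: ge0_le_integralT.
  + by rewrite /dunkl_cos /dunkl_rho; mfun.
  + by rewrite /dunkl_rho; mfun.
  + by move=> u; exact: h_ge0.
  + move=> u; have [->|/W_supp/andP[u1 u2]] := eqVneq (W u) 0; first by rewrite !mule0.
    have hu : -1 <= u <= 1 by rewrite !ltW.
    have /ler_normlP[v1 v2] := dunkl_cos_le1 x y hu.
    rewrite muleA lee_wpmul2r ?lee_fin// /phi ge0_muleDr// ![(2%:E * _)%E]muleC.
    by apply: leeD; apply: lee_wpmul2l => //; rewrite lee_fin; lra.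
Qed.

(** For |y| < r <= |x| the number x + y u has the sign s of x, so s v >= 0 and g(s rho) has a
    coefficient at least 1. The other term is dropped, hence an interval about x instead of a whole
    shell. *)
Lemma dunkl_transl_ball_lower : exists2 C : R, 0 < C & forall (g : R -> \bar R) x r,
  0 < r -> r <= `|x| -> measurable_fun setT g -> (forall z, (0 <= g z)%E) -> dunkl_locfin g ->
  ((C * kb x r)%:E * \int[mu]_z (g z * (`|z - x| < r / 2)%R%:R%:E) <=
   \int[mu]_(y in `](- r)%R, r[) dunkl_transl nu x g y)%E.
Proof.
have [C C0 HC] := dunkl_even_lower hnu.
exists (c * C); first by rewrite mulr_gt0.
move=> g x r r0 rx mg g0 gfin; have ax0 : 0 < `|x| by exact: lt_le_trans rx.
have x0 : x != 0 by rewrite -normr_gt0.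
rewrite (dunkl_transl_ball hnu x0 r0 mg g0 gfin).
rewrite -mulrA [in leLHS]EFinM -[leLHS]muleA.
apply: lee_wpmul2l; first by rewrite lee_fin (ltW c0).
pose s : R := if 0 < x then 1 else -1.
have sx : x = s * `|x|.
  rewrite /s; case: (ltgtP x 0) => // xx; first by rewrite ltr0_norm// mulN1r opprK.
    by rewrite gtr0_norm// mul1r.
  by rewrite xx eqxx in x0.
have s1 : s = 1 \/ s = -1 by rewrite /s; case: ifP => _; [left|right].
pose phi z := g (s * z)%R.
have mphi : measurable_fun setT phi by rewrite /phi; mfun.
have phi0 z : (0 <= phi z)%E by exact: g0.
have mi : measurable_fun setT (fun z : R => (g z * (`|z - x| < r / 2)%R%:R%:E)%E) by mfun.
have i0 z : (0 <= g z * (`|z - x| < r / 2)%R%:R%:E)%E by rewrite mule_ge0// lee_fin.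
have E : (\int[mu]_z (g z * (`|z - x| < r / 2)%R%:R%:E) =
   \int[mu]_(z in `]0%R, +oo[) (phi z * (nb x (r / 2) z)%:E))%E.
  rewrite ge0_integral_dunkl_fold//; apply: eq_integral => z.
  rewrite inE/= in_itv/= andbT => z0; rewrite /phi /near_sphere (gtr0_norm z0).
  have F : `|z + `|x| | < r / 2 = false.
    by apply/negbTE; rewrite -leNgt ger0_norm ?addr_ge0// ?(ltW z0)//; lra.
  case: s1 => s1; rewrite s1 in sx *.
  - have -> : (`|- z - x| < r / 2) = false by rewrite -opprD normrN sx mul1r F.
    by rewrite mule0 adde0 mul1r [in LHS]sx mul1r.
  - have -> : (`|z - x| < r / 2) = false by rewrite sx mulN1r opprK F.
    rewrite mule0 add0e mulN1r; congr (_ * (nat_of_bool (_ < _)%R)%:R%:E)%E.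
    by rewrite [in LHS]sx mulN1r opprK -normrN; congr `| _ |; ring.
rewrite E; apply: le_trans (HC _ _ _ r0 rx mphi phi0) _.
apply: ge0_le_integral => //.
- by move=> y _; apply: integral_ge0 => u _; rewrite mule_ge0// lee_fin.
- apply: measurable_funTS.
  have mj : measurable_fun setT (fun q : R * R => phi (rho x q.1 q.2) * (W q.2)%:E)%E.
    by rewrite /dunkl_rho; mfun.
  have j0 (q : R * R) : (0 <= phi (rho x q.1 q.2) * (W q.2)%:E)%E.
    by rewrite mule_ge0// lee_fin.
  exact: (measurable_fun_fubini_tonelli_F (m2 := leb) _ mj j0).
- by apply: measurable_funTS; exact: measurable_dunkl_inner1.
- move=> y; rewrite in_ball_set => yr; apply: ge0_le_integralT.
  + by rewrite /dunkl_rho; mfun.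
  + by rewrite /dunkl_cos /dunkl_rho; mfun.
  + by move=> u; rewrite mule_ge0// lee_fin.
  + move=> u; have [->|/W_supp/andP[u1 u2]] := eqVneq (W u) 0; first by rewrite !mule0.
    have hu : -1 <= u <= 1 by rewrite !ltW.
    have /ler_normlP[v1 v2] := dunkl_cos_le1 x y hu.
    rewrite lee_wpmul2r ?lee_fin//.
    have sv : 0 <= s * v x y u.
      rewrite /dunkl_cos mulrA mulr_ge0 ?invr_ge0 ?sqrtr_ge0//.
      have yu : `|y * u| <= `|x|.
        rewrite normrM (le_trans _ (le_trans (ltW yr) rx))// ler_piMr//.
        by rewrite ler_norml !ltW.
      move: yu; case: s1 => s1; rewrite s1 in sx *; rewrite sx.
        by rewrite !mul1r normr_id ler_norml => /andP[]; lra.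
      by rewrite !mulN1r normrN normr_id ler_norml => /andP[]; lra.
    rewrite /phi; move: sv; case: s1 => ->; rewrite ?mul1r ?mulN1r => sv.
    * rewrite -[leLHS]adde0; apply: leeD; last by apply: mule_ge0 => //; rewrite lee_fin; lra.
      by rewrite -[leLHS]mule1; apply: lee_wpmul2l => //; rewrite lee_fin; lra.
    * rewrite -[leLHS]add0e; apply: leeD; first by apply: mule_ge0 => //; rewrite lee_fin; lra.
      by rewrite -[leLHS]mule1; apply: lee_wpmul2l => //; rewrite lee_fin; lra.
Qed.

End dunkl_translation_bounds.

(** * Power weights *)

Ltac pos1 :=
  match goal with
  | H : ?P |- ?P => exact: H
  | H : is_true (0 < ?x) |- is_true (0 <= ?x) => exact: (ltW H)
  | H : forall z, is_true (0 <= ?f z) |- is_true (0 <= ?f _) => exact: H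
  | H : forall z, is_true (0 <= ?f z)%E |- is_true (0 <= ?f _)%E => exact: H
  | |- is_true (0 <= _%:R) => exact: ler0n
  | |- is_true (0 < _ + _) => apply: addr_gt0
  | |- is_true (0 <= _ + _) => apply: addr_ge0
  | |- is_true (0 < _ * _) => apply: mulr_gt0
  | |- is_true (0 <= _ * _) => apply: mulr_ge0
  | |- is_true (0 < _ ^-1) => rewrite invr_gt0
  | |- is_true (0 <= _ ^-1) => rewrite invr_ge0
  | |- is_true (0 < _ `^ _) => apply: powR_gt0
  | |- is_true (0 <= _ `^ _) => exact: powR_ge0
  | |- is_true (0 <= `| _ |) => exact: normr_ge0
  | |- is_true (@Order.le _ _ _ (poweR _ _)) => exact: poweR_ge0
  | |- is_true (@Order.le _ _ _ (EFin _)) => rewrite lee_fin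
  | |- is_true (@Order.le _ _ _ (mule _ _)) => apply: mule_ge0
  | |- is_true (@Order.le _ _ _ (adde _ _)) => apply: adde_ge0
  | |- is_true (@Order.le _ _ _ (GRing.add _ _)) => apply: adde_ge0
  | |- is_true (@Order.le _ _ _ (integral _ _ _)) => apply: integral_ge0 => ? _
  | |- is_true (0 < _) => done
  | |- is_true (0 <= _) => done
  end.
Ltac pos := intros; repeat pos1.

Section power_layers.
Context (R : realType).
Local Notation leb := (@lebesgue_measure R).

Lemma ge0_integral_sum_le d (T : measurableType d) (m : {measure set T -> \bar R})
    (f g h : T -> \bar R) :
  measurable_fun setT f -> measurable_fun setT g -> measurable_fun setT h ->
  (forall z, (0 <= f z)%E) -> (forall z, (0 <= g z)%E) -> (forall z, (0 <= h z)%E) ->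
  (forall z, (f z <= g z + h z)%E) ->
  (\int[m]_z f z <= \int[m]_z g z + \int[m]_z h z)%E.
Proof.
move=> mf mg mh f0 g0 h0 fgh; rewrite -ge0_integralD//.
by apply: ge0_le_integral => //; exact: emeasurable_funD.
Qed.

Lemma integral_powR_above (r e : R) : 0 < r -> 0 < e ->
  (\int[leb]_l ((l `^ (- e - 1))%:E * (r < l)%R%:R%:E) = (e^-1 * r `^ (- e))%:E)%E.
Proof.
move=> r0 e0; rewrite -integral_by_powR// [RHS]integral_mul_indic.
by apply: eq_integral => l _; rewrite indicE in_set_itv in_itv/= andbT.
Qed.

Lemma integral_powR_below (r e : R) : 0 < r -> 0 < e ->
  (\int[leb]_l ((l `^ (e - 1))%:E * (0 < l < r)%R%:R%:E) = (e^-1 * r `^ e)%:E)%E.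
Proof.
move=> r0 e0; rewrite -integral_0b_powR// [RHS]integral_mul_indic.
by apply: eq_integral => l _; rewrite indicE in_set_itv in_itv/=.
Qed.

(* Layer cake: |z|^(-e) is e times the integral of l^(-e-1) over l > |z|. *)
Lemma integral_powR_weight (E e : R) : e < E -> exists2 K : R, 0 < K &
  forall (m : {sigma_finite_measure set R -> \bar R}) (phi : R -> \bar R) (B : R),
  measurable_fun setT phi -> (forall z, (0 <= phi z)%E) -> 0 <= B ->
  (forall r, 0 < r -> (\int[m]_z (phi z * (`|z| < r)%R%:R%:E) <= (B * r `^ E)%:E)%E) ->
  forall r, 0 < r ->
    (\int[m]_z ((`|z| `^ (- e))%:E * (phi z * (`|z| < r)%R%:R%:E)) <=
     (K * B * r `^ (E - e))%:E)%E.
Proof.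
move=> eE; have [e0|e0] := leP e 0.
  exists 1 => // m phi B mphi phi0 B0 HB r r0.
  apply: (@le_trans _ _ (\int[m]_z ((r `^ (- e))%:E * (phi z * (`|z| < r)%R%:R%:E)))%E).
    apply: ge0_le_integralT.
    - by mfun.
    - by mfun.
    - by move=> z; rewrite !mule_ge0// ?lee_fin ?powR_ge0.
    - move=> z; case: ltP => zr; last by rewrite !mule0.
      rewrite !mule1 lee_wpmul2r// lee_fin ge0_ler_powR ?nnegrE ?oppr_ge0 ?(ltW r0)//.
      exact: ltW.
  rewrite ge0_integralZl_real ?powR_ge0//; [|by mfun|by move=> z; rewrite mule_ge0].
  apply: le_trans (lee_wpmul2l _ (HB _ r0)) _; first by rewrite lee_fin powR_ge0.
  by rewrite -EFinM lee_fin mul1r mulrCA -powRD ?(gt_eqF r0) ?implybT// addrC.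
have Ee : 0 < E - e by rewrite subr_gt0.
exists (e * ((E - e)^-1 * 2 `^ (E - e) + e^-1)).
  by rewrite mulr_gt0// addr_gt0 ?mulr_gt0 ?invr_gt0 ?powR_gt0.
move=> m phi B mphi phi0 B0 HB r r0.
pose F (z l : R) : \bar R := ((e * l `^ (- e - 1))%:E *
  (((`|z| < l)%R%:R%:E * phi z) * (`|z| < r)%R%:R%:E))%E.
have mF : measurable_fun setT (fun q : R * R => F q.1 q.2) by rewrite /F; mfun.
have F0 z l : (0 <= F z l)%E by rewrite /F !mule_ge0// lee_fin// mulr_ge0 ?(ltW e0)// powR_ge0.
have mFl l : measurable_fun setT (fun z : R => F z l) by rewrite /F; mfun.
have mFz z : measurable_fun setT (fun l : R => F z l) := measurableT_comp mF (pair1_measurable z).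
apply: (@le_trans _ _ (\int[m]_z \int[leb]_l F z l)%E).
  apply: ge0_le_integralT.
  - by mfun.
  - exact: (measurable_fun_fubini_tonelli_F (m2 := leb) _ mF).
  - by move=> z; rewrite !mule_ge0// ?lee_fin ?powR_ge0.
  - move=> z; have [->|z0] := eqVneq z 0.
      rewrite normr0 powR0 ?oppr_eq0 ?gt_eqF// mul0e.
      by apply: integral_ge0 => l _; exact: F0.
    have z1 : 0 < `|z| by rewrite normr_gt0.
    apply: le_of_eq.
    transitivity (\int[leb]_l ((e%:E * (phi z * (`|z| < r)%R%:R%:E)) *
        ((l `^ (- e - 1))%:E * (`|z| < l)%R%:R%:E)))%E.
      rewrite ge0_integralZl//.
      + by rewrite integral_powR_above// EFinM muleACA -EFinM divff ?gt_eqF// mul1e muleC.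
      + have mq : measurable_fun setT (fun l : R =>
            ((l `^ (- e - 1))%:E * (`|z| < l)%R%:R%:E)%E).
          by mfun.
        exact: mq.
      + by move=> l _; rewrite mule_ge0// lee_fin// powR_ge0.
      + by rewrite !mule_ge0// lee_fin// ltW.
    apply: eq_integral => l _; rewrite /F EFinM [LHS]muleACA; congr (_ * _)%E.
    by rewrite -[RHS]muleA [RHS]muleC.
have -> : (\int[m]_z \int[leb]_l F z l = \int[leb]_l \int[m]_z F z l)%E.
  by apply: (fubini_tonelli (m1 := m) (m2 := leb) _ mF) => q; exact: F0.
(* Levels l < 2 r use the growth bound at radius l, where e < E gives convergence at 0; the higher
   ones use it at radius r, where e > 0 gives convergence at infinity. The ranges of [g] and [h]
   overlap so that no level is missed. *)
pose g (l : R) : \bar R := ((e * B)%:E * ((l `^ (E - e - 1))%:E * (0 < l < 2 * r)%R%:R%:E))%E.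
pose h (l : R) : \bar R := ((e * B * r `^ E)%:E * ((l `^ (- e - 1))%:E * (r < l)%R%:R%:E))%E.
have mg : measurable_fun setT g by rewrite /g; mfun.
have mh : measurable_fun setT h by rewrite /h; mfun.
have eB0 : 0 <= e * B by rewrite mulr_ge0// ltW.
have eBr0 : 0 <= e * B * r `^ E by rewrite mulr_ge0// powR_ge0.
apply: (@le_trans _ _ (\int[leb]_l g l + \int[leb]_l h l)%E).
  apply: ge0_integral_sum_le.
  - exact: (measurable_fun_fubini_tonelli_G (m1 := m) _ mF).
  - exact: mg.
  - exact: mh.
  - by move=> l; apply: integral_ge0 => z _; exact: F0.
  - by move=> l; rewrite !mule_ge0// lee_fin// powR_ge0.
  - by move=> l; rewrite !mule_ge0// lee_fin// powR_ge0.
  - move=> l; have [l0|l0] := leP l 0.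
      rewrite integral0_eq; last first.
        by move=> z _; rewrite /F ltNge (le_trans l0 (normr_ge0 _))/= !(mule0, mul0e).
      by rewrite adde_ge0// !mule_ge0// lee_fin// powR_ge0.
    have [lr|lr] := ltP l (2 * r).
      apply: (@le_trans _ _ (g l)); last first.
        by rewrite leeDl// !mule_ge0// lee_fin// powR_ge0.
      rewrite /g lr l0/= mule1 /F.
      apply: (@le_trans _ _ (\int[m]_z ((e * l `^ (- e - 1))%:E * (phi z * (`|z| < l)%R%:R%:E)))%E).
        apply: ge0_le_integralT.
        + exact: mFl.
        + by mfun.
        + by move=> z; exact: F0.
        + move=> z; rewrite lee_wpmul2l//; first by rewrite lee_fin mulr_ge0 ?powR_ge0// ltW.
          rewrite [leRHS]muleC -[leRHS]mule1 lee_wpmul2l//; first by rewrite mule_ge0.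
          by rewrite lee_fin; case: (_ < _).
      rewrite ge0_integralZl_real; [|by mfun|by move=> z; rewrite mule_ge0|by rewrite mulr_ge0 ?powR_ge0// ltW].
      apply: le_trans (lee_wpmul2l _ (HB _ l0)) _; first by rewrite lee_fin mulr_ge0 ?powR_ge0// ltW.
      rewrite -!EFinM lee_fin; apply: le_of_eq.
      rewrite (_ : E - e - 1 = (- e - 1) + E); last by ring.
      by rewrite [in RHS]powRD ?(gt_eqF l0) ?implybT//; ring.
    apply: (@le_trans _ _ (h l)); last first.
      by rewrite leeDr// !mule_ge0// lee_fin// powR_ge0.
    have rl : r < l by apply: lt_le_trans lr; move: r0; lra.
    rewrite /h rl mule1 /F.
    apply: (@le_trans _ _ (\int[m]_z ((e * l `^ (- e - 1))%:E * (phi z * (`|z| < r)%R%:R%:E)))%E).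
      apply: ge0_le_integralT.
      + exact: mFl.
      + by mfun.
      + by move=> z; exact: F0.
      + move=> z; rewrite lee_wpmul2l//; first by rewrite lee_fin mulr_ge0 ?powR_ge0// ltW.
        rewrite lee_wpmul2r// -[leRHS]mul1e lee_wpmul2r//.
        by rewrite lee_fin; case: (_ < _).
    rewrite ge0_integralZl_real; [|by mfun|by move=> z; rewrite mule_ge0|by rewrite mulr_ge0 ?powR_ge0// ltW].
    apply: le_trans (lee_wpmul2l _ (HB _ r0)) _; first by rewrite lee_fin mulr_ge0 ?powR_ge0// ltW.
    by rewrite -!EFinM lee_fin; apply: le_of_eq; ring.
have Ig : (\int[leb]_l g l = (e * B * ((E - e)^-1 * (2 * r) `^ (E - e)))%:E)%E.
  have r2 : 0 < 2 * r by rewrite mulr_gt0.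
  rewrite [RHS]EFinM -(integral_powR_below r2 Ee); apply: ge0_integralZl_real => //.
    by mfun.
  by move=> l; rewrite mule_ge0// lee_fin powR_ge0.
have Ih : (\int[leb]_l h l = (e * B * r `^ E * (e^-1 * r `^ (- e)))%:E)%E.
  rewrite [RHS]EFinM -(integral_powR_above r0 e0); apply: ge0_integralZl_real => //.
    by mfun.
  by move=> l; rewrite mule_ge0// lee_fin powR_ge0.
rewrite Ig Ih -EFinD lee_fin; apply: le_of_eq.
rewrite powRM ?(ltW r0)// (_ : r `^ (E - e) = r `^ E * r `^ (- e)); last first.
  by rewrite -powRD// (gt_eqF r0) implybT.
by ring.
Qed.
End power_layers.

Lemma ler_bool (R : realType) (b c : bool) : (b -> c) -> b%:R <= c%:R :> R.
Proof. by case: b => //= /(_ isT) ->. Qed.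

Lemma powR_divr (R : realType) (x y a : R) : 0 <= x -> 0 < y ->
  (x / y) `^ a = x `^ a / y `^ a.
Proof.
move=> x0 y0; rewrite powRM ?invr_ge0 ?(ltW y0)//; congr (_ * _).
by rewrite !powR_gt0E ?invr_gt0// lnV ?posrE// mulrN expRN.
Qed.

Lemma powR_addr (R : realType) (x a b : R) : 0 < x -> x `^ (a + b) = x `^ a * x `^ b.
Proof. by move=> x0; rewrite powRD// (gt_eqF x0) implybT. Qed.

(** * Powers on balls and shells *)

Section dunkl_powers.
Context (R : realType) (nu : R).
Hypothesis hnu : - 2^-1 < nu.
Local Notation leb := (@lebesgue_measure R).
Local Notation mu := (dunkl_measure nu).
Local Notation d := (dunkl_dim nu).
Local Notation kb := (ball_ratio nu).
Local Notation nb := (@near_sphere R).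
Local Notation kappa := (dunkl_cst nu).

Lemma dunkl_dim_gt1 : 1 < d. Proof. by rewrite /dunkl_dim; move: hnu; lra. Qed.

Let kappa0 : 0 < kappa. Proof. by apply: dunkl_cst_gt0; move: hnu; lra. Qed.

Lemma dunkl_dimB1 : 2 * nu + 1 = d - 1. Proof. by rewrite /dunkl_dim; ring. Qed.

Lemma integral_dunkl_radial (f : R -> R) : measurable_fun setT f -> (forall l, 0 <= f l) ->
  (\int[mu]_z (f `|z|)%:E =
   \int[leb]_l ((2 * kappa)%:E * ((f l * l `^ (d - 1))%:E * (0 < l)%R%:R%:E)))%E.
Proof.
move=> mf f0; rewrite ge0_integral_dunkl_fold; [|by mfun|by move=> z; rewrite lee_fin].
rewrite ge0_integral_dunkl//; last 2 first.
- by apply: measurable_funTS; mfun.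
- by move=> z _; rewrite adde_ge0// lee_fin.
rewrite [LHS]integral_mul_indic; apply: eq_integral => l _.
rewrite indicE in_set_itv in_itv/= andbT; case: ltP => l0; last by rewrite !mule0.
rewrite !mule1 normrN gtr0_norm// dunkl_densityE -EFinD -!EFinM gtr0_norm// dunkl_dimB1.
by congr EFin; ring.
Qed.

Lemma integral_dunkl_ball r : 0 < r ->
  (\int[mu]_z (`|z| < r)%R%:R%:E = (2 * kappa / d * r `^ d)%:E)%E.
Proof.
move=> r0; have d0 : 0 < d by apply: lt_trans dunkl_dim_gt1.
have mf : measurable_fun setT (fun l : R => (l < r)%R%:R : R) by mfun.
rewrite (integral_dunkl_radial mf)//.
rewrite -[in RHS]mulrA [RHS]EFinM -(integral_powR_below r0 d0).
rewrite -ge0_integralZl_real; last 3 first.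
- by mfun.
- by move=> l; rewrite mule_ge0// lee_fin powR_ge0.
- by rewrite mulr_ge0// ltW.
apply: eq_integral => l _; congr (_ * _)%E; rewrite EFinM.
by rewrite muleAC -[RHS]muleC; congr (_ * _)%E; case: (0 < l); rewrite ?mule1 ?mule0.
Qed.

Lemma dunkl_measure_ball r : 0 < r ->
  dunkl_measure nu `](- r), r[ = (2 * kappa / d * r `^ d)%:E.
Proof.
move=> r0; rewrite -integral_dunkl_ball// -[LHS]mul1e -integral_cst//.
by rewrite [LHS]integral_mul_indic; apply: eq_integral => z _; rewrite mul1e indic_ball.
Qed.

Lemma integral_dunkl_tail e : d < e -> exists2 K : R, 0 < K & forall r, 0 < r ->
  (\int[mu]_z ((`|z| `^ (- e))%:E * (r < `|z|)%R%:R%:E) <= (K * r `^ (d - e))%:E)%E.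
Proof.
move=> de; have ed : 0 < e - d by rewrite subr_gt0.
exists (2 * kappa / (e - d)); first by rewrite divr_gt0// mulr_gt0.
move=> r r0.
have mf : measurable_fun setT (fun l : R => l `^ (- e) * (r < l)%R%:R : R) by mfun.
under eq_integral do rewrite -EFinM.
rewrite (integral_dunkl_radial mf)//; last by move=> l; rewrite mulr_ge0// powR_ge0.
rewrite -[in leRHS]mulrA [leRHS]EFinM (_ : d - e = - (e - d)); last by ring.
rewrite -(integral_powR_above r0 ed) -ge0_integralZl_real; last 3 first.
- by mfun.
- by move=> l; rewrite mule_ge0// lee_fin powR_ge0.
- by rewrite mulr_ge0// ltW.
apply: le_of_eq.
apply: eq_integral => l _; congr (_ * _)%E; rewrite -!EFinM; congr EFin.
case: (ltP r l) => rl; last by rewrite !(mulr0, mul0r).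
have l0 : 0 < l by apply: lt_trans rl.
rewrite l0 !mulr1 -powRD ?(gt_eqF l0) ?implybT//; congr (_ `^ _); ring.
Qed.

Lemma ball_ratio_le1 x r : 0 < r -> kb x r <= 1.
Proof.
move=> r0; have xr : 0 < `|x| + r by rewrite ltr_wpDl.
apply: (@le_trans _ _ (1 `^ (2 * nu + 1))); last by rewrite powR1.
rewrite /ball_ratio ge0_ler_powR ?nnegrE//.
- by move: hnu; lra.
- by rewrite divr_ge0// ltW.
- by rewrite ler_pdivrMr// mul1r lerDr.
Qed.

Lemma ball_ratio_le_far x r : 0 < r -> x != 0 -> kb x r <= (r / `|x|) `^ (d - 1).
Proof.
move=> r0 x0; have xr : 0 < `|x| + r by rewrite ltr_wpDl.
have x1 : 0 < `|x| by rewrite normr_gt0.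
rewrite /ball_ratio dunkl_dimB1 ge0_ler_powR ?nnegrE ?divr_ge0 ?(ltW r0) ?(ltW xr)//.
- by rewrite subr_ge0 ltW// dunkl_dim_gt1.
- by rewrite ler_pM2l// lef_pV2 ?posrE// lerDl ltW.
Qed.

Lemma ball_ratio_ge_far x r : 0 < r -> r <= `|x| -> (r / (2 * `|x|)) `^ (d - 1) <= kb x r.
Proof.
move=> r0 x0; have xr : 0 < `|x| + r by rewrite ltr_wpDl.
have x1 : 0 < `|x| by apply: lt_le_trans x0.
have x2 : 0 < 2 * `|x| by rewrite mulr_gt0.
rewrite /ball_ratio dunkl_dimB1 ge0_ler_powR ?nnegrE ?divr_ge0 ?(ltW r0) ?(ltW xr) ?(ltW x2)//.
- by rewrite subr_ge0 ltW// dunkl_dim_gt1.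
- by rewrite ler_pM2l// lef_pV2 ?posrE//; move: x0; lra.
Qed.

Lemma ball_ratio_mono x r r' : 0 < r -> r <= r' -> kb x r <= kb x r'.
Proof.
move=> r0 rr; have xr : 0 < `|x| + r by rewrite ltr_wpDl.
have r'0 : 0 < r' by apply: lt_le_trans rr.
have xr' : 0 < `|x| + r' by rewrite ltr_wpDl.
rewrite /ball_ratio dunkl_dimB1 ge0_ler_powR ?nnegrE ?divr_ge0 ?(ltW r0) ?(ltW xr) ?(ltW xr') ?(ltW r'0)//.
- by rewrite subr_ge0 ltW// dunkl_dim_gt1.
- rewrite ler_pdivrMr// mulrAC ler_pdivlMr// !mulrDr lerD ?ler_wpM2r//.
  by rewrite mulrC.
Qed.

Lemma near_sphere_le x r z :
  nb x r z <= (`|z - x| < r)%R%:R + (`|z + x| < r)%R%:R.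
Proof.
rewrite /near_sphere -natrD ler_nat.
case: ltP => // h; case: ltP => // h1; case: ltP => // h2; exfalso.
move: h h1 h2; rewrite ltr_norml.
by case: (ler0P z) => z0; case: (ler0P x) => x0;
  case: (ler0P (z - x)) => zx; case: (ler0P (z + x)) => zx' => /andP[]; move: zx zx'; lra.
Qed.

Lemma lebesgue_ball_indic x r : 0 < r ->
  (\int[leb]_z (`|z - x| < r)%R%:R%:E = (2 * r)%:E)%E.
Proof.
move=> r0; have := lebesgue_measure_ball x (ltW r0); rewrite (_ : (2 * r)%:E = (r *+ 2)%:E) ?mulr_natl// => <-.
rewrite -[RHS]mul1e -integral_cst//; last exact: measurable_ball.
rewrite [RHS]integral_mul_indic; apply: eq_integral => z _; rewrite mul1e indicE.
by rewrite -ball_normE; congr (nat_of_bool _)%:R%:E; apply/idP/idP; rewrite !inE/= distrC.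
Qed.

Lemma lebesgue_near_sphere_le x r : 0 < r -> (\int[leb]_z (nb x r z)%:E <= (4 * r)%:E)%E.
Proof.
move=> r0; apply: (@le_trans _ _ (\int[leb]_z (`|z - x| < r)%R%:R%:E +
  \int[leb]_z (`|z - (- x)| < r)%R%:R%:E)%E).
  have m1 : measurable_fun setT (fun z : R => ((`|z - x| < r)%R%:R : R)%:E) by mfun.
  have m2 : measurable_fun setT (fun z : R => ((`|z - (- x)| < r)%R%:R : R)%:E) by mfun.
  have m3 := measurable_near_sphere x r.
  apply: ge0_integral_sum_le => //.
  - exact: measurableT_comp.
  - by move=> z; rewrite lee_fin near_sphere_ge0.
  - by move=> z; rewrite -EFinD lee_fin opprK near_sphere_le.
by rewrite !lebesgue_ball_indic// -EFinD lee_fin; move: r0; lra.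
Qed.

(** This places powers of |y| in a Morrey space. If |x| <= 2 r the shell lies in the ball of radius
    3 r. Otherwise |y| >= r on the shell, the density is at most a multiple of |x|^(d-1), which
    [ball_ratio] cancels, and the shell has length at most 4 r. *)
Lemma integral_near_sphere_powR a : 0 <= a < d -> exists2 K : R, 0 < K & forall x r, 0 < r ->
  ((kb x r)%:E * \int[mu]_y ((`|y| `^ (- a))%:E * (nb x r y)%:E) <= (K * r `^ (d - a))%:E)%E.
Proof.
move=> /andP[a0 ad]; have [K K0 HK] := integral_powR_weight ad.
have d1 := dunkl_dim_gt1; have d0 : 0 < d by apply: lt_trans d1.
have B0 : 0 < 2 * kappa / d by rewrite divr_gt0// mulr_gt0.
exists (K * (2 * kappa / d) * 3 `^ (d - a) + kappa * 2 `^ (d - 1) * 4).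
  by pos.
move=> x r r0; have kb0 := ball_ratio_ge0 nu x r.
have mnb := measurable_near_sphere x r; have nb0 := near_sphere_ge0 x r.
rewrite mulrDl; have [xr|xr] := leP `|x| (2 * r).
  have r3 : 0 < 3 * r by rewrite mulr_gt0.
  apply: (@le_trans _ _ (\int[mu]_y ((`|y| `^ (- a))%:E * (1%E * (`|y| < 3 * r)%R%:R%:E)))%E).
    rewrite -ge0_integralZl_real//; last 2 first.
    - by mfun.
    - by move=> y; rewrite mule_ge0// lee_fin// powR_ge0.
    apply: ge0_le_integralT.
    - by mfun.
    - by mfun.
    - by move=> y; rewrite !mule_ge0// lee_fin// powR_ge0.
    - move=> y; rewrite -[leRHS]mul1e; apply: lee_pmul; rewrite ?lee_fin ?ball_ratio_le1//.
        by rewrite mulr_ge0// powR_ge0.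
      rewrite mul1r ler_wpM2l ?powR_ge0//; apply: ler_bool => h.
      by move: h; rewrite ltr_norml => /andP[]; move: xr; lra.
  apply: le_trans (HK mu (fun=> 1%E) (2 * kappa / d) _ _ _ _ _ r3) _ => //.
  - exact: ltW.
  - move=> s s0; under eq_integral do rewrite mul1e.
    by rewrite integral_dunkl_ball.
  - by rewrite lee_fin powRM ?(ltW r0)// mulrA lerDl; pos.
have x1 : 0 < `|x| by apply: lt_trans xr; rewrite mulr_gt0.
have x0 : x != 0 by rewrite -normr_gt0.
apply: (@le_trans _ _ (kappa * 2 `^ (d - 1) * 4 * r `^ (d - a))%:E); last first.
  by rewrite lee_fin lerDr; pos.
have k1 : 0 <= r `^ (- a) * (kappa * (2 * `|x|) `^ (d - 1)).
  by pos.
apply: (@le_trans _ _ (((r / `|x|) `^ (d - 1))%:E *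
    ((r `^ (- a) * (kappa * (2 * `|x|) `^ (d - 1))) * (4 * r))%:E)%E).
  apply: lee_pmul.
  - by rewrite lee_fin.
  - by pos.
  - by rewrite lee_fin ball_ratio_le_far.
  - rewrite ge0_integral_dunkl//; [|by mfun|by pos].
    apply: (@le_trans _ _ (\int[leb]_y ((r `^ (- a) * (kappa * (2 * `|x|) `^ (d - 1)))%:E *
        (nb x r y)%:E))%E).
      have md := measurable_dunkl_density nu.
      apply: ge0_le_integralT.
      + by mfun.
      + by mfun.
      + by pos; exact: dunkl_density_ge0.
      + move=> y; rewrite -!EFinM lee_fin [leLHS]mulrAC.
        rewrite /near_sphere; case: ltP => h; last by rewrite !mulr0.
        have /andP[y1 y2] : r <= `|y| <= 2 * `|x|.
          by move: h; rewrite ltr_norml => /andP[]; move: xr r0; lra.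
        have y0 : 0 < `|y| by apply: lt_le_trans y1.
        rewrite !mulr1; apply: ler_pM; rewrite ?powR_ge0 ?dunkl_density_ge0//.
          by rewrite !powRN lef_pV2 ?posrE ?powR_gt0// ge0_ler_powR ?nnegrE ?(ltW r0) ?(ltW y0).
        rewrite dunkl_densityE dunkl_dimB1 ler_wpM2l ?(ltW kappa0)//.
        by rewrite ge0_ler_powR ?nnegrE ?mulr_ge0// subr_ge0 ltW.
    rewrite ge0_integralZl_real//; last by mfun.
    rewrite [leRHS]EFinM lee_wpmul2l ?lee_fin// lebesgue_near_sphere_le//.
rewrite -EFinM lee_fin.
rewrite powR_divr ?(ltW r0)// powRM ?(ltW x1)//.
rewrite (_ : r `^ (d - a) = r `^ (d - 1) * r `^ (- a) * r); last first.
  have := powR_addr (d - 1 - a) 1 r0; rewrite powRr1 ?(ltW r0)// (powR_addr (d - 1) (- a) r0) => <-.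
  by congr (_ `^ _); ring.
apply: le_of_eq.
by field; rewrite gt_eqF// powR_gt0.
Qed.
End dunkl_powers.

(** * Strong type of the Hardy-Littlewood maximal operator *)

Section hardy_littlewood_strong.
Context (R : realType).
Local Notation leb := (@lebesgue_measure R).
Local Notation HL := HL_maximal.

(* h <= h 1_{h > l/2} + l/2, and averages of the constant l/2 are at most l/2. *)
Lemma HL_maximal_gt_half (h : R -> R) l : locally_integrable setT h -> (forall x, 0 <= h x) ->
  0 < l ->
  (leb [set x | l%:E < HL h x] <= (6 / l)%:E * \int[leb]_x (h x * (l / 2 < h x)%R%:R)%:E)%E.
Proof.
move=> hloc h0 l0; have [mh _ fh] := hloc.
have mabs (f : R -> R) : measurable_fun setT f -> measurable_fun setT (fun x => `|(f x)%:E|%E).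
  by move=> mf; apply: measurableT_comp => //; exact: measurableT_comp.
pose k x := h x * (l / 2 < h x)%R%:R.
have mk : measurable_fun setT k by rewrite /k; mfun.
have k0 x : 0 <= k x by rewrite /k; pos.
have kh x : k x <= h x by rewrite /k; case: (_ < _); rewrite ?mulr1 ?mulr0.
have kloc : locally_integrable setT k.
  split => //; first exact: openT.
  move=> K _ cK; apply: le_lt_trans (fh K _ cK) => //.
  apply: ge0_le_integral => //.
  - exact: compact_measurable.
  - by apply: measurable_funTS; exact: mabs.
  - by apply: measurable_funTS; exact: mabs.
  - by move=> x _; rewrite lee_fin !ger0_norm.
have l2 : 0 < l / 2 by pos.

have sub : [set x | l%:E < HL h x]%E `<=` [set x | (l / 2)%:E < HL k x]%E.
  move=> x /= /ereal_sup_gt[_ [r + <-]] lx; rewrite /= in_itv/= andbT => r0.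
  apply: (@lt_le_trans _ _ (iavg k (ball x r))); last first.
    by apply: ereal_sup_ubound; exists r => //=; rewrite in_itv/= r0.
  have mB : measurable (ball x r) by exact: measurable_ball.
  have lB : leb (ball x r) = (r *+ 2)%:E by rewrite lebesgue_measure_ball// ltW.
  have r2 : 0 < r *+ 2 by rewrite mulrn_wgt0.
  have inv : ((leb (ball x r))^-1 = ((r *+ 2)^-1)%:E)%E.
    by rewrite lB inver gt_eqF.
  have E : (iavg h (ball x r) <= iavg k (ball x r) + (l / 2)%:E)%E.
    rewrite /iavg inv.
    have -> : ((l / 2)%:E = ((r *+ 2)^-1)%:E * \int[leb]_(y in ball x r) (l / 2)%:E)%E.
      by rewrite integral_cst// [X in (_ * (_ * X))%E]lB -!EFinM mulrCA mulVf ?gt_eqF// mulr1.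
    rewrite -ge0_muleDr; last 2 first.
    - by apply: integral_ge0 => y _; rewrite lee_fin.
    - by pos.
    apply: lee_wpmul2l; first by rewrite lee_fin invr_ge0 ltW.
    rewrite -ge0_integralD//; [|by apply: measurable_funTS; exact: mabs|by move=> y _; rewrite lee_fin ltW].
    apply: ge0_le_integral => //.
    - by apply: measurable_funTS; exact: mabs.
    - by apply: emeasurable_funD => //; apply: measurable_funTS; exact: mabs.
    - move=> y _; rewrite lee_fin !ger0_norm// /k; case: ltP => hy; rewrite ?mulr1 ?mulr0.
        by rewrite lerDl ltW.
      by rewrite add0r.
  have := lt_le_trans lx E.
  rewrite [X in (X < _)%E](_ : l%:E = ((l / 2)%:E + (l / 2)%:E)%E); last first.
    by rewrite -EFinD -splitr.
  by rewrite lteD2rE.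
have mset (f : R -> R) c : locally_integrable setT f -> measurable [set x | c%:E < HL f x]%E.
  move=> lf; rewrite -[X in measurable X]setTI.
  by apply: emeasurable_fun_o_infty => //; exact: measurable_HL_maximal.
apply: (le_trans (le_measure leb _ _ sub)); rewrite ?inE; [exact: mset|exact: mset|].
apply: le_trans (maximal_inequality kloc l2) _.
rewrite (_ : 3 / (l / 2) = 6 / l); last by field; rewrite gt_eqF.
apply: lee_wpmul2l; first by pos.
apply: ge0_le_integralT.
- exact: mabs.
- by mfun.
- by move=> x; rewrite lee_fin.
- by move=> x; rewrite lee_fin ger0_norm.
Qed.

(** Layer cake for extended values: if [M] is infinite the integral exceeds b^p for every b, hence
    is infinite. *)
Lemma poweR_layer (M : \bar R) p : 0 < p -> (0 <= M)%E ->
  (poweR M p <= \int[leb]_l ((p * l `^ (p - 1))%:E * ((0 < l)%R && (l%:E < M)%E)%:R%:E))%E.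
Proof.
move=> p0; have p1 : p != 0 by rewrite gt_eqF.
have fin (b : R) : 0 < b ->
    (\int[leb]_l ((p * l `^ (p - 1))%:E * ((0 < l < b)%R)%:R%:E) = (b `^ p)%:E)%E.
  move=> b0; transitivity (\int[leb]_l (p%:E * ((l `^ (p - 1))%:E * ((0 < l < b)%R)%:R%:E)))%E.
    by apply: eq_integral => l _; rewrite EFinM muleA.
  rewrite ge0_integralZl_real; last 3 first.
  - by mfun.
  - by pos.
  - exact: ltW.
  have := integral_powR_below b0 p0 => ->.
  by rewrite -EFinM mulrA divff ?mul1r.
case: M => [b| |]//; last first.
  move=> _; rewrite poweRE (negbTE p1) eqxx leye_eq; apply/eqP/eq_infty => c.
  have [c0|c0] := leP c 0.
    by apply: (@le_trans _ _ 0%E); [rewrite lee_fin|pos].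
  pose b := c `^ p^-1; have b0 : 0 < b by rewrite powR_gt0.
  have -> : c = b `^ p by rewrite /b -powRrM mulVf// powRr1// ltW.
  rewrite -fin//; apply: ge0_le_integralT.
  - by mfun.
  - have mm : measurable_fun setT (fun l : R => ((p * l `^ (p - 1))%:E * ((0 < l)%R && true)%:R%:E)%E) by mfun.
    apply: eq_measurable_fun mm => l _; by rewrite ltry.
  - by pos.
  - move=> l; rewrite lee_wpmul2l//; first by pos.
    by rewrite lee_fin; apply: ler_bool => /andP[-> _]; rewrite ltry.
rewrite lee_fin poweR_EFin le_eqVlt => /predU1P[<-|b0].
  by rewrite powR0//; pos.
by rewrite -fin//; apply: le_of_eq; apply: eq_integral => l _; rewrite lte_fin.
Qed.

(** The bound of [HL_maximal_gt_half] is inserted in the layer cake formula. After Tonelli, the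
    integral of l^(p-2) over l < 2 h(x) converges because p > 1. *)
Lemma HL_maximal_strong p : 1 < p -> exists2 C : R, 0 < C & forall h : R -> R,
  locally_integrable setT h -> (forall x, 0 <= h x) ->
  (\int[leb]_x poweR (HL h x) p <= C%:E * \int[leb]_x (h x `^ p)%:E)%E.
Proof.
move=> p1; have p0 : 0 < p by apply: lt_trans p1.
have q0 : 0 < p - 1 by rewrite subr_gt0.
exists (6 * p * ((p - 1)^-1 * 2 `^ (p - 1))); first by pos.
move=> h hloc h0; have [mh _ fh] := hloc.
have mM := measurable_HL_maximal hloc.
have M0 := HL_maximalT_ge0 hloc.
have HLw := fun l l0 => @HL_maximal_gt_half h l hloc h0 l0.
move: (HL h) mM M0 HLw => M mM M0 HLw.
pose F (x l : R) : \bar R := ((p * l `^ (p - 1))%:E * ((0 < l)%R && (l%:E < M x)%E)%:R%:E)%E.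
have mF : measurable_fun setT (fun q : R * R => F q.1 q.2).
  have mb : measurable_fun setT (fun q : R * R => (q.2%:E < M q.1)%E).
    by apply: measurable_fun_lte; mfun.
  by rewrite /F; mfun.
have F0 q : (0 <= F q.1 q.2)%E by rewrite /F; pos.
apply: (@le_trans _ _ (\int[leb]_x \int[leb]_l F x l)%E).
  apply: ge0_le_integralT.
  - exact: (measurableT_comp (measurable_poweR _) mM).
  - exact: (measurable_fun_fubini_tonelli_F (m2 := leb) _ mF).
  - by move=> x; exact: poweR_ge0.
  - by move=> x; exact: poweR_layer.
have -> : (\int[leb]_x \int[leb]_l F x l = \int[leb]_l \int[leb]_x F x l)%E.
  exact: (fubini_tonelli (m1 := leb) (m2 := leb) _ mF).
pose G (x l : R) : \bar R := ((6 * p)%:E * ((h x)%:E * ((l `^ (p - 1 - 1))%:E * (0 < l < 2 * h x)%R%:R%:E)))%E.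
have mG : measurable_fun setT (fun q : R * R => G q.1 q.2) by rewrite /G; mfun.
have G0 q : (0 <= G q.1 q.2)%E by rewrite /G; pos.
apply: (@le_trans _ _ (\int[leb]_l \int[leb]_x G x l)%E).
  apply: ge0_le_integralT.
  - exact: (measurable_fun_fubini_tonelli_G (m1 := leb) _ mF).
  - exact: (measurable_fun_fubini_tonelli_G (m1 := leb) _ mG).
  - by move=> l; apply: integral_ge0 => x _; exact: (F0 (x, l)).
  - move=> l; have [l0|l0] := leP l 0.
      rewrite integral0_eq; last by move=> x _; rewrite /F ltNge l0/= mule0.
      by apply: integral_ge0 => x _; exact: (G0 (x, l)).
    have mset : measurable [set x | l%:E < M x]%E.
      by rewrite -[X in measurable X]setTI; exact: emeasurable_fun_o_infty.
    have mk : measurable_fun setT (fun x : R => (h x * (l / 2 < h x)%R%:R)%:E) by mfun.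
    apply: (@le_trans _ _ ((p * l `^ (p - 1))%:E * leb [set x | l%:E < M x])%E).
      rewrite -integral_cst// [leRHS]integral_mul_indic; apply: le_of_eq.
      apply: eq_integral => x _; rewrite /F l0/= indicE; congr (_ * (nat_of_bool _)%:R%:E)%E.
      by apply/idP/idP; rewrite inE.
    apply: le_trans (lee_wpmul2l _ (HLw _ l0)) _; first by pos.
    rewrite muleA -EFinM -ge0_integralZl_real//; [|by pos|by pos].
    apply: ge0_le_integralT; [by mfun|by rewrite /G; mfun|by pos|].
    move=> x; rewrite /G l0/= -!EFinM lee_fin.
    rewrite (_ : (l < 2 * h x) = (l / 2 < h x)); last first.
      by rewrite ltr_pdivrMr// mulrC.
    apply: le_of_eq.
    have := powR_addr (p - 1 - 1) 1 l0; rewrite powRr1 ?(ltW l0)// subrK => ->.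
    by field; rewrite gt_eqF.
have <- : (\int[leb]_x \int[leb]_l G x l = \int[leb]_l \int[leb]_x G x l)%E.
  exact: (fubini_tonelli (m1 := leb) (m2 := leb) _ mG).
have mhp : measurable_fun setT (fun x : R => (h x `^ p)%:E) by mfun.
rewrite -ge0_integralZl_real//; [|by pos|by pos].
apply: ge0_le_integralT.
- exact: (measurable_fun_fubini_tonelli_F (m2 := leb) _ mG).
- by mfun.
- by move=> x; apply: integral_ge0 => l _; exact: (G0 (x, l)).
- move=> x; have := h0 x; rewrite le_eqVlt => /predU1P[hx|hx].
    rewrite integral0_eq; first by pos.
    by move=> l _; rewrite /G -hx mul0e mule0.
  have h2 : 0 < 2 * h x by pos.
  rewrite /G; under eq_integral do rewrite muleA -(EFinM (6 * p)).
  rewrite ge0_integralZl_real; [|by mfun|by pos|by pos].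
  have := integral_powR_below h2 q0 => ->.
  rewrite -EFinM lee_fin powRM ?(ltW hx)//; apply: le_of_eq.
  have := powR_addr (p - 1) 1 hx; rewrite powRr1 ?(ltW hx)// subrK => ->.
  by ring.
Qed.

End hardy_littlewood_strong.

(** * Averages over shells *)

Lemma dunkl_dimE (R : realType) (nu : R) : dunkl_dim nu = 2 * nu + 2. Proof. by []. Qed.

(* Rewriting with lemmas on sums would unfold it. *)
Opaque dunkl_dim.

Section morrey_estimates.
Context (R : realType) (nu p q : R).
Hypothesis hnu : - 2^-1 < nu.
Hypothesis hp : 1 < p.
Local Notation mu := (dunkl_measure nu).
Local Notation d := (dunkl_dim nu).
Local Notation kb := (ball_ratio nu).
Local Notation nb := (@near_sphere R).
Local Notation kappa := (dunkl_cst nu).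

(** The p-th power of the Morrey condition with constant A, the translation over a ball being
    replaced by the shell average comparable to it. *)
Definition morrey_bound (H : R -> R) (A : R) : Prop := forall x r, 0 < r ->
  ((kb x r)%:E * \int[mu]_z ((H z `^ p)%:E * (nb x r z)%:E) <=
   (A `^ p * r `^ (d - d * p / q))%:E)%E.

Let p0 : 0 < p. Proof. exact: lt_trans hp. Qed.
Let d0 : 0 < d. Proof. exact: lt_trans (dunkl_dim_gt1 hnu). Qed.
Let kappa0 : 0 < kappa. Proof. by apply: dunkl_cst_gt0; move: hnu; lra. Qed.

Lemma near_sphere0 r z : nb 0 r z = (`|z| < r)%R%:R.
Proof. by rewrite /near_sphere normr0 subr0 normr_id. Qed.

Lemma ball_ratio0 r : 0 < r -> kb 0 r = 1.
Proof. by move=> r0; rewrite /ball_ratio normr0 add0r divff ?gt_eqF// powR1. Qed.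

Lemma morrey_bound_origin H A r : morrey_bound H A -> 0 < r ->
  (\int[mu]_z ((H z `^ p)%:E * (`|z| < r)%R%:R%:E) <= (A `^ p * r `^ (d - d * p / q))%:E)%E.
Proof.
move=> HA r0; have := HA 0 r r0; rewrite ball_ratio0// mul1e.
by under eq_integral do rewrite near_sphere0.
Qed.

(** If x > l then 1 <= (x/l)^(p-1). The free level l turns a bound on the mean of x^p into a bound
    on the mean of x. *)
Lemma powR_split (x l : R) : 0 <= x -> 0 < l -> x <= l + l `^ (1 - p) * x `^ p.
Proof.
move=> x0 l0; have [xl|lx] := leP x l.
  by rewrite (le_trans xl)// lerDl mulr_ge0 ?powR_ge0.
have {}x0 : 0 < x by apply: lt_trans lx.
rewrite -[leLHS]add0r lerD ?(ltW l0)//.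
have := powR_addr (1 - p) p x0; rewrite subrK powRr1 ?(ltW x0)// => {1}->.
rewrite ler_wpM2r ?powR_ge0// -(opprB p 1) !powRN lef_pV2 ?posrE ?powR_gt0//.
by rewrite ge0_ler_powR ?nnegrE ?(ltW l0) ?(ltW x0) ?(ltW lx)// subr_ge0 ltW.
Qed.

Lemma powR_mulE (r a b c : R) : 0 < r -> a + b = c -> r `^ a * r `^ b = r `^ c.
Proof. by move=> r0 <-; rewrite powR_addr. Qed.

(* H <= l + l^(1-p) H^p with l = A r^(-d/q), in place of the Hoelder inequality. *)
Lemma integral_morrey_ball : exists2 K : R, 0 < K & forall (H : R -> R) (A : R), measurable_fun setT H ->
  (forall z, 0 <= H z) -> 0 < A -> morrey_bound H A -> forall r, 0 < r ->
  (\int[mu]_z ((H z)%:E * (`|z| < r)%R%:R%:E) <= (K * A * r `^ (d - d / q))%:E)%E.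
Proof.
exists (2 * kappa / d + 1); first by pos.
move=> H A mH H0 A0 HA r r0; pose l := A * r `^ (- (d / q)).
have l0 : 0 < l by rewrite /l; pos.
pose f (z : R) : \bar R := (l%:E * (`|z| < r)%R%:R%:E)%E.
pose g (z : R) : \bar R := ((l `^ (1 - p))%:E * ((H z `^ p)%:E * (`|z| < r)%R%:R%:E))%E.
apply: (@le_trans _ _ (\int[mu]_z f z + \int[mu]_z g z)%E).
  apply: ge0_integral_sum_le; [by mfun|by rewrite /f; mfun|by rewrite /g; mfun|by pos|by rewrite /f; pos|by rewrite /g; pos|].
  move=> z; rewrite /f /g -!EFinM -EFinD lee_fin; case: (_ < _).
    by rewrite !mulr1 powR_split.
  by rewrite !mulr0 addr0.
rewrite /f /g ge0_integralZl_real ?(ltW l0)//; last by mfun.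
rewrite integral_dunkl_ball// ge0_integralZl_real; [|by mfun|by pos|by pos].
apply: le_trans (leeD2l _ (lee_wpmul2l _ (morrey_bound_origin HA r0))) _; first by pos.
rewrite -!EFinM -EFinD lee_fin; apply: le_of_eq.
have E1 : l * (2 * kappa / d * r `^ d) = 2 * kappa / d * (A * r `^ (d - d / q)).
  by rewrite /l -(@powR_mulE r (- (d / q)) d (d - d / q))//; ring.
have E2 : l `^ (1 - p) * (A `^ p * r `^ (d - d * p / q)) = A * r `^ (d - d / q).
  rewrite /l powRM ?(ltW A0) ?powR_ge0// -powRrM mulrACA.
  rewrite (@powR_mulE A _ _ 1) ?subrK// powRr1 ?(ltW A0)//.
  by rewrite (@powR_mulE r _ _ (d - d / q))//; ring.
by rewrite E1 E2; ring.
Qed.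

(** The mass of H in a ball grows like r^(d - d/q), which outweighs the singularity |z|^(-alpha) by
    the condition on alpha. This bounds the local mass of |f|. *)
Lemma integral_morrey_weight alpha : alpha < d - d / q -> exists2 K : R, 0 < K &
  forall (H : R -> R) (A : R), measurable_fun setT H ->
  (forall z, 0 <= H z) -> 0 < A -> morrey_bound H A -> forall r, 0 < r ->
  (\int[mu]_z ((`|z| `^ (- alpha) * H z)%:E * (`|z| < r)%R%:R%:E) <=
   (K * A * r `^ (d - d / q - alpha))%:E)%E.
Proof.
move=> ha; have [K1 K10 HK1] := integral_morrey_ball.
have [K2 K20 HK2] := integral_powR_weight ha.
exists (K2 * K1); first by pos.
move=> H A mH H0 A0 HA r r0.
have mE : measurable_fun setT (fun z : R => (H z)%:E) by mfun.
have HE0 z : (0 <= (H z)%:E)%E by pos.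
have KA : 0 <= K1 * A by pos.
have := HK2 mu _ _ mE HE0 KA (HK1 _ _ mH H0 A0 HA) r r0.
by rewrite !mulrA; under eq_integral do rewrite muleA -EFinM.
Qed.

End morrey_estimates.

(** * Large radii: the pointwise bound *)

Section far_part.
Context (R : realType) (nu p q gamma alpha beta b : R).
Hypothesis hnu : - 2^-1 < nu.
Hypothesis hp : 1 < p.
Local Notation mu := (dunkl_measure nu).
Local Notation d := (dunkl_dim nu).
Local Notation kb := (ball_ratio nu).
Local Notation nb := (@near_sphere R).
Hypothesis hb : b = d / q - (gamma - alpha - beta).
Hypothesis halpha : alpha < d - d / q.
Hypothesis hbeta : beta < b.

Let p0 : 0 < p. Proof. exact: lt_trans hp. Qed.

(** Up to constants this dominates the average of radius r that enters |y|^(-beta) M f(y), where |f|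
    = |.|^(-alpha) H. *)
Definition weighted_avg (H : R -> R) (y r : R) : \bar R :=
  ((`|y| `^ (- beta) * (r `^ (gamma - d) * kb y r))%:E *
   \int[mu]_z ((`|z| `^ (- alpha) * H z)%:E * (nb y r z)%:E))%E.

Lemma weighted_avg_ge0 H y r : (forall z, 0 <= H z) -> (0 <= weighted_avg H y r)%E.
Proof.
by move=> H0; have := ball_ratio_ge0 nu y r; have := near_sphere_ge0 y r; rewrite /weighted_avg; pos.
Qed.

Lemma weighted_avg_far_le (H : R -> R) y r : measurable_fun setT H -> (forall z, 0 <= H z) ->
  0 < r -> `|y| <= 2 * r ->
  (weighted_avg H y r <= (`|y| `^ (- beta) * r `^ (gamma - d))%:E *
    \int[mu]_z ((`|z| `^ (- alpha) * H z)%:E * (`|z| < 3 * r)%R%:R%:E))%E.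
Proof.
move=> mH H0 r0 yr; have mnb := measurable_near_sphere y r.
have nb0 := near_sphere_ge0 y r; have kb0 := ball_ratio_ge0 nu y r.
rewrite /weighted_avg; apply: lee_pmul.
- by pos.
- by pos.
- by rewrite lee_fin ler_wpM2l ?powR_ge0// ler_piMr ?powR_ge0// ball_ratio_le1.
- apply: ge0_le_integralT; [by mfun|by mfun|by pos|].
  move=> z; rewrite lee_wpmul2l//; first by pos.
  rewrite lee_fin; apply: ler_bool => h.
  by move: h; rewrite ltr_norml => /andP[]; move: yr; lra.
Qed.

(** The power of r is gamma - d + (d - d/q - alpha) = beta - b, which is negative: the bound is
    largest at r = |y|/2, and together with |y|^(-beta) it yields |y|^(-b). *)
Lemma weighted_avg_far : exists2 K : R, 0 < K & forall (H : R -> R) (A : R),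
  measurable_fun setT H -> (forall z, 0 <= H z) -> 0 < A -> morrey_bound nu p q H A ->
  forall y r, y != 0 -> 0 < r -> `|y| <= 2 * r ->
  (weighted_avg H y r <= (K * A * `|y| `^ (- b))%:E)%E.
Proof.
have [K K0 HK] := integral_morrey_weight hnu hp halpha.
exists (K * 3 `^ (d - d / q - alpha) * 2 `^ (b - beta)); first by pos.
move=> H A mH H0 A0 HA y r y0 r0 yr; have y1 : 0 < `|y| by rewrite normr_gt0.
have r3 : 0 < 3 * r by pos.
apply: le_trans (weighted_avg_far_le mH H0 r0 yr) _.
apply: le_trans (lee_wpmul2l _ (HK _ _ mH H0 A0 HA _ r3)) _; first by pos.
rewrite -EFinM lee_fin powRM ?(ltW r0)//.
set c := d - d / q - alpha.
have -> : `|y| `^ (- beta) * r `^ (gamma - d) * (K * A * (3 `^ c * r `^ c)) =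
  K * 3 `^ c * A * `|y| `^ (- beta) * r `^ (beta - b).
  rewrite -(@powR_mulE R r (gamma - d) c (beta - b))//; first by ring.
  by rewrite /c hb; ring.
have -> : K * 3 `^ c * 2 `^ (b - beta) * A * `|y| `^ (- b) =
   K * 3 `^ c * A * `|y| `^ (- beta) * (2 `^ (b - beta) * `|y| `^ (beta - b)).
  rewrite -(@powR_mulE R `|y| (- beta) (beta - b) (- b))//; first by ring.
  by ring.
apply: ler_wpM2l; first by pos.
rewrite -(opprB b beta) !powRN ler_pdivlMr ?powR_gt0// mulrC ler_pdivrMr ?powR_gt0//.
rewrite -powRM ?(ltW r0)// ge0_ler_powR ?nnegrE ?mulr_ge0 ?(ltW r0)//.
by rewrite subr_ge0 ltW.
Qed.

End far_part.

Lemma ler_poweR (R : realType) (p : R) (x y : \bar R) : 0 <= p -> (0 <= x)%E -> (x <= y)%E ->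
  (poweR x p <= poweR y p)%E.
Proof.
move=> p0 x0 xy; apply: gt0_ler_poweR => //; rewrite in_itv/= leey andbT//.
exact: le_trans xy.
Qed.

Lemma hoelder_poweR d (T : measurableType d) (R : realType) (m : {measure set T -> \bar R})
    (u v : T -> R) (p : R) : 1 < p ->
  measurable_fun setT u -> measurable_fun setT v -> (forall x, 0 <= u x) -> (forall x, 0 <= v x) ->
  (poweR (\int[m]_x (u x * v x)%:E) p <=
   poweR (\int[m]_x (u x `^ (p / (p - 1)))%:E) (p - 1) * \int[m]_x (v x `^ p)%:E)%E.
Proof.
move=> p1 mu mv u0 v0; have p0 : 0 < p by apply: lt_trans p1.
have q0 : 0 < p - 1 by rewrite subr_gt0.
have p'0 : 0 < p / (p - 1) by rewrite divr_gt0.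
have conj : (p / (p - 1))^-1 + p^-1 = 1 by field; rewrite !gt_eqF.
have := hoelder m mu mv p'0 p0 conj; rewrite Lnorm1 => le1.
have -> : (\int[m]_x (u x * v x)%:E = \int[m]_x `|(EFin \o (u \* v)%R) x|)%E.
  by apply: eq_integral => x _ /=; rewrite ger0_norm// mulr_ge0.
have Eu : (poweR 'N[m]_(p / (p - 1))%:E[EFin \o u] (p / (p - 1)) =
    \int[m]_x (u x `^ (p / (p - 1)))%:E)%E.
  rewrite poweR_Lnorm; last by rewrite gt_eqF.
  apply: eq_integral => x _ /=.
  by rewrite ger0_norm.
have Ev : (poweR 'N[m]_p%:E[EFin \o v] p = \int[m]_x (v x `^ p)%:E)%E.
  rewrite poweR_Lnorm; last by rewrite gt_eqF.
  apply: eq_integral => x _ /=.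
  by rewrite ger0_norm.
have Nu0 := Lnorm_ge0 m (p / (p - 1))%:E (EFin \o u).
have Nv0 := Lnorm_ge0 m p%:E (EFin \o v).
have I0 : (0 <= \int[m]_x `|(EFin \o (u \* v)%R) x|)%E by apply: integral_ge0.
rewrite -Eu -Ev; move: Nu0 Nv0 le1 I0.
move: ('N[m]_(p / (p - 1))%:E[EFin \o u])%E ('N[m]_p%:E[EFin \o v])%E => Nu Nv Nu0 Nv0 le1 I0.
rewrite -poweRrM divfK ?gt_eqF// -poweRM//.
by apply: ler_poweR => //; exact: ltW.
Qed.

(** * Large radii when p = q: the Hardy operator *)

Section far_part_critical.
Context (R : realType) (nu : R).
Hypothesis hnu : - 2^-1 < nu.
Local Notation mu := (dunkl_measure nu).
Local Notation d := (dunkl_dim nu).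

(** Rules such as |z|^(-a) |z|^(a-alpha) = |z|^(-alpha) can fail at 0, where [powR] has conventional
    values. Folding onto the positive half-line removes this null point. *)
Lemma ge0_integral_dunkl_le (f g : R -> \bar R) : measurable_fun setT f -> measurable_fun setT g ->
  (forall z, (0 <= f z)%E) -> (forall z, (0 <= g z)%E) -> (forall z, z != 0 -> (f z <= g z)%E) ->
  (\int[mu]_z f z <= \int[mu]_z g z)%E.
Proof.
move=> mf mg f0 g0 fg; rewrite !ge0_integral_dunkl_fold//; apply: ge0_le_integral => //.
- by pos.
- by apply: measurable_funTS; mfun.
- by apply: measurable_funTS; mfun.
- move=> z /=; rewrite in_itv/= andbT => z0.
  by apply: leeD; apply: fg; rewrite ?oppr_eq0 gt_eqF.
Qed.

Variables (p gamma alpha beta b : R).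
Hypothesis hp : 1 < p.
Hypothesis hb : b = d / p - (gamma - alpha - beta).
Hypothesis halpha : alpha < d - d / p.
Hypothesis hbeta : beta < b.
Hypothesis hgammad : gamma < d.

Let p0 : 0 < p. Proof. exact: lt_trans hp. Qed.
Let d0 : 0 < d. Proof. exact: lt_trans (dunkl_dim_gt1 hnu). Qed.

(* Hoelder's inequality for the factorization |z|^(-a) (|z|^(a-alpha) H(z)), with
   max(alpha, gamma - d/p) < a < d - d/p, then Tonelli's theorem. *)
Lemma weighted_avg_hardy : exists2 K : R, 0 < K & forall (H : R -> R),
  measurable_fun setT H -> (forall z, 0 <= H z) ->
  exists Phi : R -> \bar R, [/\ measurable_fun setT Phi, forall y, (0 <= Phi y)%E,
    forall y r, y != 0 -> 0 < r -> `|y| <= 2 * r ->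
      (poweR (weighted_avg nu gamma alpha beta H y r) p <= Phi y)%E &
    (\int[mu]_y ((`|y| `^ (- ((gamma - alpha - beta) * p)))%:E * Phi y) <=
     K%:E * \int[mu]_z (H z `^ p)%:E)%E].
Proof.
(* [a] is the midpoint of its admissible range. The bound a < d - d/p makes |z|^(-a p/(p-1)) locally
   integrable ([ed]), a > gamma - d/p makes c > 0, and a > alpha makes the tail in y converge
   ([edc]). *)
pose m := Num.max alpha (gamma - d / p).
have hm : m < d - d / p by rewrite /m gt_max halpha ltrD2r.
pose a := (m + (d - d / p)) / 2.
have [am ad] : m < a /\ a < d - d / p by split; rewrite /a; move: hm; lra.
have aal : alpha < a by apply: le_lt_trans am; rewrite /m le_max lexx.
have ag : gamma - d / p < a by apply: le_lt_trans am; rewrite /m le_max lexx orbT.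
pose c := d / p + a - gamma.
have c0 : 0 < c by rewrite /c; move: ag; lra.
have q0 : 0 < p - 1 by rewrite subr_gt0.
pose e := a * (p / (p - 1)).
have ed : e < d.
  have E : e * (p - 1) = a * p by rewrite /e; field; rewrite gt_eqF.
  rewrite -(ltr_pM2r q0) E; have := ltr_pM2r p0 a (d - d / p); rewrite ad => /esym.
  by rewrite mulrBl divfK ?gt_eqF// mulrBr mulr1.
have Ee : e * (p - 1) = a * p by rewrite /e; field; rewrite gt_eqF.
(* The total power of 1/|y|: beta p from the average and (gamma - alpha - beta) p from the outer
   weight. The condition beta < b says exactly that e' < d. *)
pose e' := (gamma - alpha) * p.
have ed' : e' < d.
  rewrite /e' -ltr_pdivlMr//; move: hbeta; rewrite hb; lra.
have edc : d < e' + c * p.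
  rewrite (_ : e' + c * p = d + (a - alpha) * p); last first.
    by rewrite /e' /c; field; rewrite gt_eqF.
  by rewrite ltrDl mulr_gt0// subr_gt0.
have [K1 K10 HK1] := integral_powR_weight ed.
have [K2 K20 HK2] := integral_powR_weight ed'.
have [K3 K30 HK3] := integral_dunkl_tail hnu edc.
have kappa0 : 0 < dunkl_cst nu by apply: dunkl_cst_gt0; move: hnu; lra.
pose B := 2 * dunkl_cst nu / d; have B0 : 0 < B by rewrite /B; pos.
have HB s : 0 < s -> (\int[mu]_z (1%E * (`|z| < s)%R%:R%:E) <= (B * s `^ d)%:E)%E.
  by move=> s0; under eq_integral do rewrite mul1e; rewrite integral_dunkl_ball.
have HU s : 0 < s -> (\int[mu]_z ((`|z| `^ (- e))%:E * (`|z| < s)%R%:R%:E) <= (K1 * B * s `^ (d - e))%:E)%E.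
  move=> s0; have := HK1 mu (fun=> 1%E) B (measurable_cst _) _ (ltW B0) HB s s0.
  by under eq_integral do rewrite mul1e; apply.
have HU' s : 0 < s -> (\int[mu]_z ((`|z| `^ (- e'))%:E * (`|z| < s)%R%:R%:E) <= (K2 * B * s `^ (d - e'))%:E)%E.
  move=> s0; have := HK2 mu (fun=> 1%E) B (measurable_cst _) _ (ltW B0) HB s s0.
  by under eq_integral do rewrite mul1e; apply.
pose C0 := (K1 * B * 3 `^ (d - e)) `^ (p - 1) * 3 `^ (c * p).
have C00 : 0 < C0 by rewrite /C0; pos.
exists (C0 * (K2 * B * 2 `^ (d - e') + K3)); first by pos.
move=> H mH H0.
pose w z := `|z| `^ ((a - alpha) * p) * H z `^ p.
have w0 z : 0 <= w z by rewrite /w; pos.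
have mw : measurable_fun setT w by rewrite /w; mfun.
(* Hoelder's inequality leaves the factor r^(-c p). As |y| and |z| are at most 3 r, it is bounded by
   3^(c p) max(|y|, |z|)^(-c p): a kernel free of r, which controls all large radii at once. *)
pose k (y z : R) : R := (Num.max `|y| `|z|) `^ (- (c * p)).
have k0 y z : 0 <= k y z by exact: powR_ge0.
have mk : measurable_fun setT (fun q : R * R => k q.1 q.2).
  by rewrite /k; apply: measurable_powR_comp; apply: measurable_maxr; mfun.
have mk1 y : measurable_fun setT (k y) by exact: (measurableT_comp mk (pair1_measurable y)).
have mk2 z : measurable_fun setT (k ^~ z) by exact: (measurableT_comp mk (pair2_measurable z)).
pose F (q : R * R) : \bar R := (k q.1 q.2 * w q.2)%:E.
have mF : measurable_fun setT F by rewrite /F; mfun.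
have F0 q : (0 <= F q)%E by rewrite /F lee_fin mulr_ge0.
pose Phi y : \bar R := ((C0 * `|y| `^ (- (beta * p)))%:E * \int[mu]_z F (y, z))%E.
have mFi : measurable_fun setT (fun y => \int[mu]_z F (y, z))%E.
  exact: (measurable_fun_fubini_tonelli_F (m2 := mu) F).
have mPhi : measurable_fun setT Phi by rewrite /Phi; mfun.
exists Phi; split => //; first by move=> y; rewrite /Phi; pos; exact: F0.
- move=> y r y0 r0 yr; have y1 : 0 < `|y| by rewrite normr_gt0.
  have r3 : 0 < 3 * r by pos.
  apply: le_trans (ler_poweR _ _ (weighted_avg_far_le gamma alpha beta hnu mH H0 r0 yr)) _.
  + exact: ltW.
  + exact: weighted_avg_ge0.
  pose u (z : R) : R := `|z| `^ (- a) * (`|z| < 3 * r)%R%:R.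
  pose v (z : R) : R := `|z| `^ (a - alpha) * H z * (`|z| < 3 * r)%R%:R.
  have u0 z : 0 <= u z by rewrite /u; pos.
  have v0 z : 0 <= v z by rewrite /v; pos.
  have mu_ : measurable_fun setT u by rewrite /u; mfun.
  have mv : measurable_fun setT v by rewrite /v; mfun.
  rewrite poweRM; [|by pos|by pos].
  have Iuv : (\int[mu]_z ((`|z| `^ (- alpha) * H z)%:E * (`|z| < 3 * r)%R%:R%:E) <=
      \int[mu]_z (u z * v z)%:E)%E.
    apply: ge0_integral_dunkl_le.
    - by mfun.
    - by mfun.
    - by pos.
    - by move=> z; rewrite lee_fin mulr_ge0.
    - move=> z z0; rewrite -EFinM lee_fin /u /v.
      case: (_ < _); rewrite ?mulr0// !mulr1 mulrA.
      by rewrite (@powR_mulE _ _ _ _ (- alpha)) ?normr_gt0//; ring.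
  have := ler_poweR (ltW p0) _ Iuv; rewrite integral_ge0; last by pos.
  move=> /(_ isT) Ip.
  have := le_trans Ip (hoelder_poweR mu hp mu_ mv u0 v0) => {Ip Iuv} Ip.
  apply: le_trans (lee_wpmul2l _ Ip) _; first exact: poweR_ge0.
  have EU : (\int[mu]_z (u z `^ (p / (p - 1)))%:E <= (K1 * B * (3 * r) `^ (d - e))%:E)%E.
    apply: le_trans (HU _ r3); apply: ge0_le_integralT.
    - by mfun.
    - by mfun.
    - by move=> z; rewrite lee_fin powR_ge0.
    - move=> z; rewrite /u -EFinM lee_fin powRM ?powR_ge0//; case: (_ < _).
        by rewrite powR1 !mulr1 -powRrM mulNr.
      by rewrite powR0 ?mulr0// mulf_neq0 ?invr_eq0 ?gt_eqF.
  have := ler_poweR (ltW q0) _ EU; rewrite integral_ge0; last first.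
    by move=> z _; rewrite lee_fin powR_ge0.
  move=> /(_ isT) EU'.
  have V0 : (0 <= \int[mu]_z (v z `^ p)%:E)%E.
    by apply: integral_ge0 => z _; rewrite lee_fin powR_ge0.
  apply: le_trans (lee_wpmul2l _ (lee_wpmul2r V0 EU')) _; first exact: poweR_ge0.
  rewrite !poweR_EFin muleA -EFinM.
  rewrite powRM ?powR_ge0// -!powRrM mulNr.
  rewrite (_ : (K1 * B * (3 * r) `^ (d - e)) `^ (p - 1) =
     (K1 * B * 3 `^ (d - e)) `^ (p - 1) * r `^ ((d - e) * (p - 1))); last first.
    rewrite (powRM _ (ltW _) (ltW r0))// mulrA powRM ?powR_ge0 -?powRrM//.
    by pos.
  rewrite (_ : `|y| `^ (- (beta * p)) * r `^ ((gamma - d) * p) *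
    ((K1 * B * 3 `^ (d - e)) `^ (p - 1) * r `^ ((d - e) * (p - 1))) =
    (K1 * B * 3 `^ (d - e)) `^ (p - 1) * `|y| `^ (- (beta * p)) * r `^ (- (c * p))); last first.
    rewrite -(@powR_mulE _ r ((gamma - d) * p) ((d - e) * (p - 1)) (- (c * p)))//; first by ring.
    rewrite (_ : (d - e) * (p - 1) = d * (p - 1) - a * p); last by rewrite -Ee; ring.
    by rewrite /c; field; rewrite gt_eqF.
  rewrite EFinM -muleA /Phi (_ : C0 * `|y| `^ (- (beta * p)) =
    (K1 * B * 3 `^ (d - e)) `^ (p - 1) * `|y| `^ (- (beta * p)) * 3 `^ (c * p)); last first.
    by rewrite /C0; ring.
  rewrite [in leRHS]EFinM -[leRHS]muleA; apply: lee_wpmul2l; first by pos.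
  rewrite -!ge0_integralZl_real; last 6 first.
  + exact: (measurableT_comp mF (pair1_measurable y)).
  + by move=> z; exact: F0.
  + by pos.
  + by mfun.
  + by move=> z; rewrite lee_fin powR_ge0.
  + by pos.
  apply: ge0_le_integralT.
  + by mfun.
  + apply: emeasurable_funM => //; exact: (measurableT_comp mF (pair1_measurable y)).
  + by move=> z; rewrite mule_ge0// lee_fin powR_ge0.
  + move=> z; rewrite /v /F/= -!EFinM lee_fin.
    case: ltP => zr; last first.
      rewrite mulr0 powR0 ?gt_eqF// mulr0.
      by apply: mulr_ge0; [exact: powR_ge0|exact: mulr_ge0].
    rewrite mulr1 powRM ?powR_ge0// -powRrM [leRHS]mulrA; apply: ler_wpM2r; first exact: w0.
    have M0 : 0 < Num.max `|y| `|z| by rewrite lt_max y1.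
    have M3 : Num.max `|y| `|z| <= 3 * r by rewrite ge_max (ltW zr) andbT (le_trans yr)// ler_pM2r// ler_nat.
    rewrite /k !powRN ler_pdivlMr ?powR_gt0// mulrC ler_pdivrMr ?powR_gt0//.
    by rewrite -powRM ?(ltW r0)// ge0_ler_powR ?nnegrE ?mulr_ge0 ?(ltW M0) ?(ltW r0) ?(ltW c0) ?(ltW p0).
pose G (q : R * R) : \bar R := ((`|q.1| `^ (- e'))%:E * F q)%E.
have mG : measurable_fun setT G by rewrite /G; mfun.
have G0 q : (0 <= G q)%E by rewrite /G mule_ge0// lee_fin powR_ge0.
apply: (@le_trans _ _ (C0%:E * \int[mu]_y \int[mu]_z G (y, z))%E).
  rewrite -ge0_integralZl_real; last 3 first.
  - exact: (measurable_fun_fubini_tonelli_F (m2 := mu) G).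
  - by move=> y; apply: integral_ge0 => z _; exact: G0.
  - exact: ltW.
  apply: ge0_integral_dunkl_le.
  - by mfun.
  - apply: emeasurable_funM => //; exact: (measurable_fun_fubini_tonelli_F (m2 := mu) G).
  - by move=> y; rewrite /Phi; pos; exact: F0.
  - by move=> y; rewrite mule_ge0 ?lee_fin ?(ltW C00)//; apply: integral_ge0 => z _; exact: G0.
  - move=> y y0.
    have -> : (\int[mu]_z G (y, z) = (`|y| `^ (- e'))%:E * \int[mu]_z F (y, z))%E.
      have mFy : measurable_fun setT (fun z => F (y, z)) := measurableT_comp mF (pair1_measurable y).
      transitivity (\int[mu]_z ((`|y| `^ (- e'))%:E * F (y, z)))%E; first by [].
      by rewrite ge0_integralZl_real ?powR_ge0// => z; exact: F0.
    rewrite /Phi !muleA -!EFinM; apply: le_of_eq; congr (_%:E * _)%E.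
    rewrite -(@powR_mulE _ `|y| (- ((gamma - alpha - beta) * p)) (- (beta * p)) (- e')) ?normr_gt0//.
      by ring.
    by rewrite /e'; ring.
rewrite [in leRHS]EFinM -[leRHS]muleA; apply: lee_wpmul2l; first by pos.
have -> : (\int[mu]_y \int[mu]_z G (y, z) = \int[mu]_z \int[mu]_y G (y, z))%E.
  exact: (fubini_tonelli (m1 := mu) (m2 := mu) _ mG).
have KK0 : 0 <= K2 * B * 2 `^ (d - e') + K3 by pos.
rewrite -ge0_integralZl_real//; [|by mfun|by move=> z; rewrite lee_fin powR_ge0].
apply: ge0_integral_dunkl_le.
- exact: (measurable_fun_fubini_tonelli_G (m1 := mu) _ mG).
- by mfun.
- by move=> z; apply: integral_ge0 => y _; exact: G0.
- by move=> z; rewrite mule_ge0 ?lee_fin ?powR_ge0.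
- move=> z z0; have z1 : 0 < `|z| by rewrite normr_gt0.
  (* For |y| < 2 |z| the maximum is at least |z|, beyond that it equals |y|. Both pieces integrate
     to multiples of |z|^((alpha - a) p), the inverse of the weight in [w]. *)
  pose f1 (y : R) : \bar R := ((`|z| `^ (- (c * p)))%:E * ((`|y| `^ (- e'))%:E * (`|y| < 2 * `|z|)%R%:R%:E))%E.
  pose f2 (y : R) : \bar R := ((`|y| `^ (- (e' + c * p)))%:E * (`|z| < `|y|)%R%:R%:E)%E.
  have mf1 : measurable_fun setT f1 by rewrite /f1; mfun.
  have mf2 : measurable_fun setT f2 by rewrite /f2; mfun.
  have f10 y : (0 <= f1 y)%E by rewrite /f1; pos.
  have f20 y : (0 <= f2 y)%E by rewrite /f2; pos.
  apply: (@le_trans _ _ (\int[mu]_y ((w z)%:E * (f1 y + f2 y)))%E).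
    apply: ge0_integral_dunkl_le.
    + exact: (measurableT_comp mG (pair2_measurable z)).
    + by mfun.
    + by move=> y; exact: G0.
    + by move=> y; rewrite mule_ge0 ?lee_fin ?adde_ge0.
    + move=> y y0; rewrite /G /F /f1 /f2 /= -!EFinM lee_fin.
      rewrite [leLHS]mulrA [leLHS]mulrC; apply: ler_wpM2l; first exact: w0.
      have y1 : 0 < `|y| by rewrite normr_gt0.
      rewrite /k; case: (ltP `|y| (2 * `|z|)) => yz.
        rewrite mulr1 -[leLHS]addr0; apply: lerD; last by pos.
        rewrite mulrC ler_wpM2r ?powR_ge0// !powRN lef_pV2 ?posrE ?powR_gt0//; last first.
          by rewrite lt_max y1.
        rewrite ge0_ler_powR ?nnegrE ?(mulr_ge0 (ltW c0) (ltW p0)) ?le_max ?(ltW y1) ?lexx ?orbT//.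
      have zy : `|z| < `|y| by rewrite (lt_le_trans _ yz)// mulr_natl mulr2n ltrDr.
      rewrite zy max_l ?(ltW zy)// mulr0 mulr0 add0r mulr1.
      by rewrite (@powR_mulE _ _ _ _ (- (e' + c * p)))// opprD.
  rewrite ge0_integralZl_real; last 3 first.
  + by mfun.
  + by move=> y; rewrite adde_ge0.
  + exact: w0.
  rewrite ge0_integralD//.
  have I1 : (\int[mu]_y f1 y <= (K2 * B * 2 `^ (d - e') * `|z| `^ ((alpha - a) * p))%:E)%E.
    rewrite /f1 ge0_integralZl_real; [|by mfun|by pos|by pos].
    have z2 : 0 < 2 * `|z| by pos.
    apply: le_trans (lee_wpmul2l _ (HU' _ z2)) _; first by pos.
    rewrite -EFinM lee_fin powRM//; apply: le_of_eq.
    rewrite -(@powR_mulE _ `|z| (- (c * p)) (d - e') ((alpha - a) * p))//; first by ring.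
    by rewrite /e' /c; field; rewrite gt_eqF.
  have I2 : (\int[mu]_y f2 y <= (K3 * `|z| `^ ((alpha - a) * p))%:E)%E.
    apply: le_trans (HK3 _ z1) _; rewrite lee_fin (_ : d - _ = (alpha - a) * p)//.
    by rewrite /e' /c; field; rewrite gt_eqF.
  apply: le_trans (lee_wpmul2l _ (leeD I1 I2)) _; first by rewrite lee_fin.
  rewrite -EFinD -!EFinM lee_fin; apply: le_of_eq.
  have E1 : `|z| `^ ((a - alpha) * p) * `|z| `^ ((alpha - a) * p) = 1.
    by rewrite (@powR_mulE _ _ _ _ 0) ?powRr0//; ring.
  transitivity ((K2 * B * 2 `^ (d - e') + K3) * H z `^ p *
      (`|z| `^ ((a - alpha) * p) * `|z| `^ ((alpha - a) * p))); first by rewrite /w; ring.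
  by rewrite E1 mulr1.
Qed.

End far_part_critical.

(** * Small radii: reduction to one dimension *)

Section local_part.
Context (R : realType) (nu p q : R).
Hypothesis hnu : - 2^-1 < nu.
Hypothesis hp : 1 < p.
Local Notation leb := (@lebesgue_measure R).
Local Notation mu := (dunkl_measure nu).
Local Notation d := (dunkl_dim nu).
Local Notation kb := (ball_ratio nu).
Local Notation nb := (@near_sphere R).
Local Notation kappa := (dunkl_cst nu).

Let p0 : 0 < p. Proof. exact: lt_trans hp. Qed.
Let d0 : 0 < d. Proof. exact: lt_trans (dunkl_dim_gt1 hnu). Qed.
Let d1 : 0 < d - 1. Proof. by rewrite subr_gt0 dunkl_dim_gt1. Qed.
Let kappa0 : 0 < kappa. Proof. by apply: dunkl_cst_gt0; move: hnu; lra. Qed.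

Lemma near_sphere_bounds (y r z : R) : 2 * r <= `|y| -> `| `|z| - `|y| | < r ->
  `|y| / 2 <= `|z| <= 2 * `|y|.
Proof. by rewrite ltr_norml => yr /andP[z1 z2]; apply/andP; split; lra. Qed.

(** On the shell |z| is comparable to |y|, and [ball_ratio] cancels the density up to r^(d-1). What
    remains is |y|^(-(alpha+beta)) r^(gamma-1), and |y| >= r concludes because alpha + beta >= 0. *)
Lemma weighted_avg_local gamma alpha beta : 0 <= alpha + beta -> exists2 K : R, 0 < K &
  forall (H : R -> R), measurable_fun setT H -> (forall z, 0 <= H z) ->
  forall y r, 0 < r -> 2 * r <= `|y| ->
  (weighted_avg nu gamma alpha beta H y r <=
   (K * r `^ (gamma - alpha - beta) * r^-1)%:E * \int[leb]_z ((H z)%:E * (nb y r z)%:E))%E.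
Proof.
move=> hab; exists (2 `^ `|- alpha| * kappa * 2 `^ (d - 1)); first by pos.
move=> H mH H0 y r r0 yr; have y0 : 0 < `|y| by apply: lt_le_trans yr; pos.
have mnb := measurable_near_sphere y r; have nb0 := near_sphere_ge0 y r.
have kb0 := ball_ratio_ge0 nu y r; have md := measurable_dunkl_density nu.
pose c := 2 `^ `|- alpha| * `|y| `^ (- alpha) * (kappa * (2 * `|y|) `^ (d - 1)).
have c0 : 0 <= c by rewrite /c; pos.
have I : (\int[mu]_z ((`|z| `^ (- alpha) * H z)%:E * (nb y r z)%:E) <=
    c%:E * \int[leb]_z ((H z)%:E * (nb y r z)%:E))%E.
  rewrite ge0_integral_dunkl//; [|by mfun|by pos].
  rewrite -ge0_integralZl_real//; [|by mfun|by pos].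
  apply: ge0_le_integralT.
  - by mfun.
  - by mfun.
  - by pos; exact: dunkl_density_ge0.
  - move=> z; rewrite -!EFinM lee_fin /near_sphere; case: ltP => h; last by rewrite !(mulr0, mul0r).
    have /andP[z1 z2] := near_sphere_bounds yr h.
    have z0 : 0 < `|z| by apply: lt_le_trans z1; pos.
    rewrite !mulr1 mulrAC ler_wpM2r// /c; apply: ler_pM; rewrite ?powR_ge0 ?dunkl_density_ge0//.
      have [|_ b] := andP (@powR_bounds R (`|z| / `|y|) (- alpha) _).
        by rewrite ler_pdivlMr// ler_pdivrMr// z2 andbT mulrC.
      by move: b; rewrite powR_divr ?(ltW z0)// ler_pdivrMr ?powR_gt0.
    rewrite dunkl_densityE dunkl_dimB1 ler_wpM2l ?(ltW kappa0)//.
    by rewrite ge0_ler_powR ?nnegrE ?mulr_ge0 ?(ltW d1) ?(ltW y0).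
rewrite /weighted_avg; apply: le_trans (lee_wpmul2l _ I) _; first by pos.
rewrite muleA -EFinM; apply: lee_wpmul2r; first by pos.
have y0' : y != 0 by rewrite -normr_gt0.
have k1 := ball_ratio_le_far hnu r0 y0'.
rewrite lee_fin.
apply: (@le_trans _ _ (`|y| `^ (- beta) * (r `^ (gamma - d) * (r / `|y|) `^ (d - 1)) * c)).
  by rewrite ler_wpM2r// ler_wpM2l ?powR_ge0// ler_wpM2l ?powR_ge0.
rewrite powR_divr ?(ltW r0)// /c powRM ?(ltW y0)//.
have -> : `|y| `^ (- beta) * (r `^ (gamma - d) * (r `^ (d - 1) / `|y| `^ (d - 1))) *
  (2 `^ `|- alpha| * `|y| `^ (- alpha) * (kappa * (2 `^ (d - 1) * `|y| `^ (d - 1)))) =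
  2 `^ `|- alpha| * kappa * 2 `^ (d - 1) * (`|y| `^ (- beta) * `|y| `^ (- alpha)) *
  (r `^ (gamma - d) * r `^ (d - 1)).
  by field; rewrite gt_eqF// powR_gt0.
rewrite (@powR_mulE _ `|y| _ _ (- (alpha + beta)))//; last by ring.
rewrite (@powR_mulE _ r _ _ (gamma - 1))//; last by ring.
have -> : r `^ (gamma - 1) = r `^ (alpha + beta) * (r `^ (gamma - alpha - beta) * r^-1).
  rewrite -(powR_inv1 (ltW r0)) mulrA (@powR_mulE _ r _ _ gamma)//; last by ring.
  by rewrite (@powR_mulE _ r _ _ (gamma - 1)).
set K := 2 `^ `|- alpha| * kappa * 2 `^ (d - 1).
have K0 : 0 <= K by rewrite /K; pos.
have X1 : `|y| `^ (- (alpha + beta)) * r `^ (alpha + beta) <= 1.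
  rewrite powRN mulrC ler_pdivrMr ?powR_gt0// mul1r ge0_ler_powR ?nnegrE ?(ltW r0) ?(ltW y0)//.
  by move: yr r0; lra.
have Y0 : 0 <= K * (r `^ (gamma - alpha - beta) * r^-1) by apply: mulr_ge0 => //; pos.
have := ler_wpM2l Y0 X1; rewrite mulr1 !mulrA; apply: le_trans.
by apply: le_of_eq; ring.
Qed.

(** The density is at least kappa (|y|/2)^(d-1) and [ball_ratio] at least (r/(2|y|))^(d-1); their
    product kappa (r/4)^(d-1) is free of y. *)
Lemma morrey_local_mass : exists2 K : R, 0 < K & forall (H : R -> R) (A : R),
  measurable_fun setT H -> (forall z, 0 <= H z) -> morrey_bound nu p q H A ->
  forall y r, 0 < r -> 2 * r <= `|y| ->
  (\int[leb]_z ((H z `^ p)%:E * (nb y r z)%:E) <= (K * (A `^ p * r `^ (1 - d * p / q)))%:E)%E.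
Proof.
exists (4 `^ (d - 1) / kappa); first by pos.
move=> H A mH H0 HA y r r0 yr; have y0 : 0 < `|y| by apply: lt_le_trans yr; pos.
have mnb := measurable_near_sphere y r; have nb0 := near_sphere_ge0 y r.
have kb0 := ball_ratio_ge0 nu y r; have md := measurable_dunkl_density nu.
have ry : r <= `|y| by move: yr r0; lra.
pose c1 := (r / (2 * `|y|)) `^ (d - 1); pose c2 := kappa * (`|y| / 2) `^ (d - 1).
have c10 : 0 < c1 by rewrite /c1; pos.
have c20 : 0 < c2 by rewrite /c2; pos.
have I : (c2%:E * \int[leb]_z ((H z `^ p)%:E * (nb y r z)%:E) <=
    \int[mu]_z ((H z `^ p)%:E * (nb y r z)%:E))%E.
  rewrite ge0_integral_dunkl//; [|by mfun|by pos].
  rewrite -ge0_integralZl_real ?(ltW c20)//; [|by mfun|by pos].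
  apply: ge0_le_integralT; [by mfun|by mfun|by pos|].
  move=> z; rewrite -!EFinM lee_fin /near_sphere; case: ltP => h; last by rewrite !(mulr0, mul0r).
  have /andP[z1 z2] := near_sphere_bounds yr h.
  rewrite !mulr1 mulrC ler_wpM2l ?powR_ge0// dunkl_densityE dunkl_dimB1 /c2 ler_wpM2l ?(ltW kappa0)//.
  by rewrite ge0_ler_powR ?nnegrE ?mulr_ge0 ?(ltW d1) ?(ltW y0).
have k1 := ball_ratio_ge_far hnu r0 ry.
have HA' := HA y r r0.
have J : ((c1 * c2)%:E * \int[leb]_z ((H z `^ p)%:E * (nb y r z)%:E) <=
    (A `^ p * r `^ (d - d * p / q))%:E)%E.
  apply: le_trans HA'; rewrite EFinM -muleA; apply: lee_pmul => //.
  - by rewrite lee_fin ltW.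
  - by apply: mule_ge0; [rewrite lee_fin ltW|pos].
have c12 : c1 * c2 = kappa / 4 `^ (d - 1) * r `^ (d - 1).
  rewrite /c1 /c2 !powR_divr ?powRM ?(ltW r0) ?(ltW y0)//; last by pos.
  rewrite (_ : 4 `^ (d - 1) = 2 `^ (d - 1) * 2 `^ (d - 1)); last first.
    by rewrite -powRM// -natrM.
  by field; rewrite !gt_eqF// powR_gt0.
have c120 : 0 < c1 * c2 by pos.
rewrite -(@lee_pmul2l _ (c1 * c2)%:E)//; apply: le_trans J _.
rewrite -EFinM lee_fin c12; apply: le_of_eq.
rewrite -(@powR_mulE _ r (d - 1) (1 - d * p / q) (d - d * p / q))//; last by ring.
by field; rewrite !gt_eqF// powR_gt0.
Qed.

(** [powR_split] at the level A r^(-d/q), which balances the length of the shell against the bound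
    on the mass of H^p. *)
Lemma morrey_local_avg : exists2 K : R, 0 < K & forall (H : R -> R) (A : R),
  measurable_fun setT H -> (forall z, 0 <= H z) -> 0 < A -> morrey_bound nu p q H A ->
  forall y r, 0 < r -> 2 * r <= `|y| ->
  (\int[leb]_z ((H z)%:E * (nb y r z)%:E) <= (K * A * r `^ (- (d / q)) * r)%:E)%E.
Proof.
have [K K0 HK] := morrey_local_mass.
exists (4 + K); first by pos.
move=> H A mH H0 A0 HA y r r0 yr; pose l := A * r `^ (- (d / q)).
have mnb := measurable_near_sphere y r; have nb0 := near_sphere_ge0 y r.
have l0 : 0 < l by rewrite /l; pos.
pose f (z : R) : \bar R := (l%:E * (nb y r z)%:E)%E.
pose g (z : R) : \bar R := ((l `^ (1 - p))%:E * ((H z `^ p)%:E * (nb y r z)%:E))%E.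
apply: (@le_trans _ _ (\int[leb]_z f z + \int[leb]_z g z)%E).
  have m1 : measurable_fun setT (fun z => (H z)%:E * (nb y r z)%:E)%E by mfun.
  have m2 : measurable_fun setT f by rewrite /f; mfun.
  have m3 : measurable_fun setT g by rewrite /g; mfun.
  apply: ge0_integral_sum_le => //.
  - by pos.
  - by rewrite /f; pos.
  - by rewrite /g; pos.
  - move=> z; rewrite /f /g -!EFinM -EFinD lee_fin /near_sphere; case: (_ < _).
      by rewrite !mulr1 powR_split.
    by rewrite !mulr0 addr0.
have If : (\int[leb]_z f z <= (l * (4 * r))%:E)%E.
  rewrite /f ge0_integralZl_real ?(ltW l0)//; last by mfun.
  rewrite [leRHS]EFinM lee_wpmul2l ?lee_fin ?(ltW l0)//.
  exact: lebesgue_near_sphere_le.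
have Ig : (\int[leb]_z g z <= (l `^ (1 - p) * (K * (A `^ p * r `^ (1 - d * p / q))))%:E)%E.
  rewrite /g ge0_integralZl_real ?powR_ge0//; [|by mfun|by pos].
  rewrite [leRHS]EFinM lee_wpmul2l ?lee_fin ?powR_ge0//.
  exact: HK.
apply: le_trans (leeD If Ig) _; rewrite -EFinD lee_fin; apply: le_of_eq.
have E2 : l `^ (1 - p) * (A `^ p * r `^ (1 - d * p / q)) = l * r.
  rewrite /l powRM ?(ltW A0) ?powR_ge0// -powRrM mulrACA.
  rewrite (@powR_mulE _ A _ _ 1) ?subrK// powRr1 ?(ltW A0)//.
  rewrite (@powR_mulE _ r _ _ (- (d / q) + 1))//; last by ring.
  by rewrite powR_addr// powRr1 ?(ltW r0)// mulrA.
by rewrite [X in _ + X]mulrCA E2 /l; ring.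
Qed.

(* Even, so that averages over the two components of a shell reduce to averages over
   one interval; the power of |z| is the p-th root of the density. *)
Definition folded_density (H : R -> R) (x0 r0 : R) (z : R) : R :=
  (H z + H (- z)) * `|z| `^ ((d - 1) / p) * nb x0 (2 * r0) z.

Lemma measurable_folded_density (H : R -> R) x0 r0 : measurable_fun setT H ->
  measurable_fun setT (folded_density H x0 r0).
Proof.
move=> mH; have mnb := measurable_near_sphere x0 (2 * r0); rewrite /folded_density.
by mfun.
Qed.

Lemma folded_density_ge0 (H : R -> R) x0 r0 z : (forall z, 0 <= H z) -> 0 <= folded_density H x0 r0 z.
Proof. by move=> H0; have := near_sphere_ge0 x0 (2 * r0); rewrite /folded_density; pos. Qed.

Lemma powR_add_le (x y : R) : 0 <= x -> 0 <= y -> (x + y) `^ p <= 2 `^ p * (x `^ p + y `^ p).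
Proof.
move=> x0 y0; wlog xy : x y x0 y0 / x <= y.
  move=> W; have [xy|/ltW yx] := leP x y; first exact: W.
  by rewrite addrC [X in _ * X]addrC; exact: W.
apply: (@le_trans _ _ ((2 * y) `^ p)).
  by rewrite ge0_ler_powR ?nnegrE ?addr_ge0 ?mulr_ge0 ?(ltW p0)//; lra.
by rewrite powRM// ler_wpM2l ?powR_ge0// lerDr powR_ge0.
Qed.

(** The p-th power of |z|^((d-1)/p) restores the Dunkl density, so the Morrey bound applies at
    radius 2 r0; [ball_ratio] increases with the radius. *)
Lemma folded_density_mass : exists2 K : R, 0 < K & forall (H : R -> R) (A : R),
  measurable_fun setT H -> (forall z, 0 <= H z) -> morrey_bound nu p q H A ->
  forall x0 r0, 0 < r0 ->
  ((kb x0 r0)%:E * \int[leb]_z (folded_density H x0 r0 z `^ p)%:E <=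
   (K * (A `^ p * r0 `^ (d - d * p / q)))%:E)%E.
Proof.
exists (2 `^ p * 2 / kappa * 2 `^ (d - d * p / q)); first by pos.
move=> H A mH H0 HA x0 r0 r00; have kb0 := ball_ratio_ge0 nu x0 r0.
have r2 : 0 < 2 * r0 by pos.
have mnb := measurable_near_sphere x0 (2 * r0); have nb0 := near_sphere_ge0 x0 (2 * r0).
pose g (z : R) : \bar R := (((H z `^ p)%:E * (nb x0 (2 * r0) z)%:E) * (`|z| `^ (d - 1))%:E)%E.
have mg : measurable_fun setT g by rewrite /g; mfun.
have g0 z : (0 <= g z)%E by rewrite /g; pos.
have Ig : (\int[mu]_z ((H z `^ p)%:E * (nb x0 (2 * r0) z)%:E) = kappa%:E * \int[leb]_z g z)%E.
  rewrite ge0_integral_dunkl//; [|by mfun|by pos].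
  rewrite -(ge0_integralZl_real leb mg g0 (ltW kappa0)); apply: eq_integral => z _.
  by rewrite /g dunkl_densityE dunkl_dimB1 -!EFinM; congr EFin; ring.
have Ig' : (\int[leb]_z (folded_density H x0 r0 z `^ p)%:E <=
    (2 `^ p * 2)%:E * \int[leb]_z g z)%E.
  apply: (@le_trans _ _ (\int[leb]_z ((2 `^ p)%:E * (g z + g (- z)%R)))%E).
    apply: ge0_le_integralT.
    - by have mf := measurable_folded_density x0 r0 mH; mfun.
    - by mfun.
    - by pos.
    - move=> z; rewrite /g /folded_density normrN near_sphereN /= -!EFinM lee_fin.
      rewrite powRM ?near_sphere_ge0 ?mulr_ge0 ?addr_ge0 ?powR_ge0//.
      rewrite powRM ?addr_ge0 ?powR_ge0// -powRrM divfK ?gt_eqF//.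
      rewrite (_ : nb x0 (2 * r0) z `^ p = nb x0 (2 * r0) z); last first.
        by rewrite /near_sphere; case: (_ < _); rewrite ?powR1// powR0// gt_eqF.
      have W0 : 0 <= `|z| `^ (d - 1) * nb x0 (2 * r0) z by pos.
      have := ler_wpM2r W0 (powR_add_le (H0 z) (H0 (- z))).
      by rewrite mulrA; move/le_trans; apply; apply: le_of_eq; ring.
  rewrite ge0_integralZl_real ?powR_ge0//; [|by mfun|by pos].
  rewrite ge0_integralD//; last by mfun.
  rewrite -integral_lebN// -[X in (_ * (X + _))%E]mul1e -[X in (_ * (_ + X))%E]mul1e -ge0_muleDl//.
  by rewrite muleA -EFinD -EFinM (_ : 1 + 1 = 2).
have HA2 := HA x0 _ r2; rewrite Ig in HA2.
have k1 : kb x0 r0 <= kb x0 (2 * r0) by apply: ball_ratio_mono => //; move: r00; lra.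
have I0 : (0 <= \int[leb]_z g z)%E by exact: integral_ge0.
apply: (@le_trans _ _ ((2 `^ p * 2 / kappa)%:E * ((kb x0 (2 * r0))%:E * (kappa%:E * \int[leb]_z g z)))%E).
  apply: (@le_trans _ _ ((kb x0 (2 * r0))%:E * ((2 `^ p * 2)%:E * \int[leb]_z g z))%E).
    by apply: lee_pmul => //; pos; exact: powR_ge0.
  rewrite [leRHS]muleCA; apply: lee_wpmul2l; first by rewrite lee_fin ball_ratio_ge0.
  by rewrite muleA -EFinM divfK// gt_eqF.
apply: le_trans (lee_wpmul2l _ HA2) _; first by pos.
rewrite -EFinM lee_fin powRM ?(ltW r00)//; apply: le_of_eq; ring.
Qed.

Lemma ball_ratio_gt0 x r : 0 < r -> 0 < kb x r.
Proof. by move=> r0; rewrite /ball_ratio powR_gt0// divr_gt0// ltr_wpDl. Qed.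

(** D <= 1 + D^p, and the integral of D^p is finite because [ball_ratio] is positive in
    [folded_density_mass]. *)
Lemma folded_density_loc (H : R -> R) (A : R) x0 r0 :
  measurable_fun setT H -> (forall z, 0 <= H z) -> morrey_bound nu p q H A ->
  0 < r0 -> locally_integrable setT (folded_density H x0 r0).
Proof.
move=> mH H0 HA r00; have mf := measurable_folded_density x0 r0 mH.
have f0 z := folded_density_ge0 x0 r0 z H0.
split => //; first exact: openT.
move=> C _ cC; have mC : measurable C by exact: compact_measurable.
have [K K0 HK] := folded_density_mass; have := HK H A mH H0 HA x0 r0 r00 => hK.
have k0 := ball_ratio_gt0 x0 r00.
have I : (\int[leb]_z (folded_density H x0 r0 z `^ p)%:E < +oo)%E.
  rewrite ltey; apply: contraTN isT => /eqP E; move: hK.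
  by rewrite E gt0_muley ?lte_fin// leye_eq.
apply: (@le_lt_trans _ _ (\int[leb]_(z in C) (1 + (folded_density H x0 r0 z `^ p)%:E))%E).
  apply: ge0_le_integral => //.
  - by apply: measurable_funTS; apply: measurableT_comp => //; exact: measurableT_comp.
  - by apply: measurable_funTS; mfun.
  - move=> z _; rewrite -EFinD lee_fin ger0_norm//.
    by have := @powR_split R p hp (folded_density H x0 r0 z) 1 (f0 z) ltr01; rewrite powR1 mul1r.
rewrite ge0_integralD//; [|by pos|by apply: measurable_funTS; mfun].
rewrite lte_add_pinfty//.
  by rewrite integral_cst// mul1e; exact: compact_finite_measure.
apply: le_lt_trans I; apply: ge0_subset_integral => //; first by mfun.
by pos.
Qed.

(** The component of the shell about -y is reflected onto the one about y, hence H(z) + H(-z). There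
    |z| >= |y|/2 bounds the inserted power from below, and r <= r0 keeps z in the shell of width 2
    r0. *)
Lemma local_avg_HL : exists2 K : R, 0 < K & forall (H : R -> R),
  measurable_fun setT H -> (forall z, 0 <= H z) ->
  forall x0 r0 y r, 0 < r -> 2 * r <= `|y| -> r <= r0 -> `| `|y| - `|x0| | < r0 ->
  (\int[leb]_z ((H z)%:E * (nb y r z)%:E) <=
   (K * `|y| `^ (- ((d - 1) / p)) * r)%:E * HL_maximal (folded_density H x0 r0) y)%E.
Proof.
exists (2 * 2 `^ ((d - 1) / p)); first by pos.
move=> H mH H0 x0 r0 y r r_gt0 yr rr0 yx0; have y0 : 0 < `|y| by apply: lt_le_trans yr; pos.
have mnb := measurable_near_sphere y r; have nb0 := near_sphere_ge0 y r.
pose D := folded_density H x0 r0.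
have mD : measurable_fun setT D := measurable_folded_density x0 r0 mH.
have D0 z : 0 <= D z := folded_density_ge0 x0 r0 z H0.
have e0 : 0 <= (d - 1) / p by rewrite divr_ge0 ?ltW.
set c := 2 `^ ((d - 1) / p) * `|y| `^ (- ((d - 1) / p)).
have c0 : 0 <= c by rewrite /c; pos.
have I : (\int[leb]_z ((H z)%:E * (nb y r z)%:E) <= c%:E * \int[leb]_z (D z * (`|z - y| < r)%R%:R)%:E)%E.
  pose f (z : R) : \bar R := (H z * (`|z - y| < r)%R%:R)%:E.
  pose g (z : R) : \bar R := (H z * (`|z + y| < r)%R%:R)%:E.
  have mf : measurable_fun setT f by rewrite /f; mfun.
  have mg : measurable_fun setT g by rewrite /g; mfun.
  have f0 z : (0 <= f z)%E by rewrite /f; pos.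
  have g0 z : (0 <= g z)%E by rewrite /g; pos.
  apply: (@le_trans _ _ (\int[leb]_z f z + \int[leb]_z g z)%E).
    have m1 : measurable_fun setT (fun z => (H z)%:E * (nb y r z)%:E)%E by mfun.
    apply: ge0_integral_sum_le => //.
    - by pos.
    - move=> z; rewrite /f /g -EFinM -EFinD lee_fin -mulrDr ler_wpM2l//.
      exact: near_sphere_le.
  rewrite (integral_lebN mg) -ge0_integralD//; last by mfun.
  rewrite -ge0_integralZl_real//; [|by mfun|by pos].
  apply: ge0_le_integralT; [by mfun|by mfun|by move=> z; rewrite adde_ge0|].
  move=> z; rewrite /f /g -EFinD -EFinM lee_fin (_ : `|- z + y| = `|z - y|); last first.
    by rewrite -normrN opprD opprK.
  case: ltP => zy; last by rewrite !mulr0 addr0.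
  rewrite !mulr1.
  have zy' : `| `|z| - `|y| | < r by apply: le_lt_trans zy; exact: ler_dist_dist.
  have /andP[z1 z2] := near_sphere_bounds yr zy'.
  have z0 : 0 < `|z| by apply: lt_le_trans z1; pos.
  rewrite /D /folded_density (_ : nb x0 (2 * r0) z = 1) ?mulr1; last first.
    rewrite /near_sphere (_ : (_ < _) = true)//.
    by move: zy' yx0; rewrite !ltr_norml => /andP[? ?] /andP[? ?]; apply/andP; split; lra.
  rewrite mulrC -mulrA -[leLHS]mulr1 ler_wpM2l ?addr_ge0// /c.
  rewrite mulrA -powRM// powRN ler_pdivlMr ?powR_gt0// mul1r.
  by rewrite ge0_ler_powR ?nnegrE ?(ltW y0)// ?mulr_ge0//; move: z1; lra.
apply: le_trans I _.
have mB : measurable (ball y r) by exact: measurable_ball.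
have r2 : 0 < r *+ 2 by rewrite mulrn_wgt0.
have E : (\int[leb]_z (D z * (`|z - y| < r)%R%:R)%:E = (r *+ 2)%:E * iavg D (ball y r))%E.
  rewrite /iavg lebesgue_measure_ball ?(ltW r_gt0)// inver gt_eqF// muleA -EFinM divff ?gt_eqF// mul1e.
  rewrite [RHS]integral_mul_indic; apply: eq_integral => z _.
  rewrite indicE -ball_normE gee0_abs ?lee_fin// EFinM; congr (_ * (nat_of_bool _)%:R%:E)%E.
  by apply/idP/idP; rewrite !inE/= distrC.
rewrite E muleA -EFinM (_ : c * (r *+ 2) = 2 * 2 `^ ((d - 1) / p) * `|y| `^ (- ((d - 1) / p)) * r); last first.
  by rewrite /c -mulr_natl; ring.
apply: lee_wpmul2l; first by pos.
by apply: ereal_sup_ubound; exists r => //=; rewrite in_itv/= r_gt0.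
Qed.

End local_part.

(** * The weighted estimate *)

Section core_estimate.
Context (R : realType) (nu p q s gamma alpha beta b : R).
Hypothesis hnu : - 2^-1 < nu.
Hypothesis hp : 1 < p.
Hypothesis hpq : p <= q.
Hypothesis hps : p <= s.
Local Notation leb := (@lebesgue_measure R).
Local Notation mu := (dunkl_measure nu).
Local Notation d := (dunkl_dim nu).
Local Notation kb := (ball_ratio nu).
Local Notation nb := (@near_sphere R).
Local Notation kappa := (dunkl_cst nu).
Local Notation wavg := (weighted_avg nu gamma alpha beta).
Hypothesis hb : b = d / q - (gamma - alpha - beta).
Hypothesis hsb : s * b = d * p / q.
Hypothesis hab : 0 <= alpha + beta.
Hypothesis halpha : alpha < d - d / q.
Hypothesis hbeta : beta < b.
Hypothesis hgammad : gamma < d.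

Let p0 : 0 < p. Proof. exact: lt_trans hp. Qed.
Let q0 : 0 < q. Proof. exact: lt_le_trans hpq. Qed.
Let s0 : 0 < s. Proof. exact: lt_le_trans hps. Qed.
Let d0 : 0 < d. Proof. exact: lt_trans (dunkl_dim_gt1 hnu). Qed.
Let d1 : 0 < d - 1. Proof. by rewrite subr_gt0 dunkl_dim_gt1. Qed.
Let kappa0 : 0 < kappa. Proof. by apply: dunkl_cst_gt0; move: hnu; lra. Qed.
Let sp0 : 0 <= s - p. Proof. by rewrite subr_ge0. Qed.

Lemma powR_le_split (w B : R) : 0 <= w -> w <= B -> w `^ s <= B `^ (s - p) * w `^ p.
Proof.
rewrite le_eqVlt => /predU1P[<-|w0] wB.
  by rewrite !powR0 ?gt_eqF// mulr0.
rewrite -(@powR_mulE _ w (s - p) p s)//; last by rewrite subrK.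
rewrite ler_wpM2r ?powR_ge0// ge0_ler_powR ?nnegrE ?(ltW w0)//.
exact: le_trans (ltW w0) wB.
Qed.

Lemma ge0_le_fin (x : \bar R) (B : R) : (0 <= x)%E -> (x <= B%:E)%E ->
  exists2 w, 0 <= w & x = w%:E.
Proof. by case: x => [w| |]//=; rewrite !lee_fin => w0 _; exists w. Qed.

(** For q = p the exponent d - d p/q is 0: the bound is the same on all balls and passes to the
    limit. *)
Lemma integral_dunkl_morrey (H : R -> R) A : q = p -> measurable_fun setT H ->
  (forall z, 0 <= H z) -> morrey_bound nu p q H A ->
  (\int[mu]_z (H z `^ p)%:E <= (A `^ p)%:E)%E.
Proof.
move=> qp mH H0 HA.
pose F (n : nat) : set R := `](- n.+1%:R), n.+1%:R[%classic.
have mF n : measurable (F n) by exact: measurable_itv.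
have UF : \bigcup_n F n = setT.
  apply/seteqP; split => // z _; exists (Num.truncn `|z|) => //=.
  by rewrite /F/= in_itv/= -ltr_norml; exact: truncnS_gt.
have ndF : {homo F : n m / (n <= m)%N >-> (n <= m)%O}.
  move=> n m nm; apply/subsetPset => z; rewrite /F/= !in_itv/= -!ltr_norml => zn.
  by apply: lt_le_trans zn _; rewrite ler_nat.
have mf : measurable_fun setT (fun z : R => (H z `^ p)%:E) by mfun.
have f0 z : (0 <= (H z `^ p)%:E)%E by rewrite lee_fin powR_ge0.
have := @ge0_nondecreasing_set_cvg_integral _ _ R F (fun z : R => (H z `^ p)%:E) mu ndF mF
  (fun i => measurable_funTS mf) (fun i x _ => f0 x).
rewrite UF => cv; rewrite -(cvg_lim _ cv)//.
apply: lime_le; first by apply/cvg_ex; eexists; exact: cv.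
apply: nearW => n; have n0 : 0 < n.+1%:R :> R by rewrite ltr0n.
have := morrey_bound_origin HA n0.
rewrite qp mulfK ?gt_eqF// subrr powRr0 mulr1; apply: le_trans.
rewrite /F integral_mul_indic; apply: le_of_eq.
by apply: eq_integral => z _; rewrite indic_ball.
Qed.

(** The majorant [Phi] does not depend on r. Radii r <= r0 are controlled by the maximal function of
    the folded density; for r > r0 the average is already at most a multiple of A r0^(-d/q), which
    gives the constant [c2]. *)
Lemma local_bound : exists2 K : R, 0 < K & forall (H : R -> R) (A : R),
  measurable_fun setT H -> (forall z, 0 <= H z) -> 0 < A -> morrey_bound nu p q H A ->
  forall x0 r0, 0 < r0 -> exists Phi : R -> \bar R,
  [/\ measurable_fun setT Phi, forall y, (0 <= Phi y)%E,
      forall y r, 0 < r -> 2 * r <= `|y| -> `| `|y| - `|x0| | < r0 ->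
        (poweR (wavg H y r) s <= Phi y)%E &
      ((kb x0 r0)%:E * \int[mu]_y (Phi y * (nb x0 r0 y)%:E) <=
       (K * (A `^ s * r0 `^ (d - d * p / q)))%:E)%E].
Proof.
have [K1 K10 HK1] := weighted_avg_local hnu gamma hab.
have [K2 K20 HK2] := morrey_local_avg q hnu hp.
have [K3 K30 HK3] := local_avg_HL hnu hp.
have [K4 K40 HK4] := HL_maximal_strong hp.
have [K5 K50 HK5] := folded_density_mass q hnu hp.
have d00 : (0 : R) <= 0 < d by apply/andP; split.
have [K6 K60 HK6] := integral_near_sphere_powR hnu d00.
exists (K1 `^ s * K2 `^ (s - p) * (K2 `^ p * K6 + K3 `^ p * kappa * K4 * K5)); first by pos.
move=> H A mH H0 A0 HA x0 r0 r00.
have kb0 := ball_ratio_ge0 nu x0 r0.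
have mnb := measurable_near_sphere x0 r0; have nb0 := near_sphere_ge0 x0 r0.
pose D := folded_density nu p H x0 r0.
have Dloc : locally_integrable setT D by exact: (folded_density_loc hnu hp x0 mH H0 HA r00).
have D0 z : 0 <= D z := folded_density_ge0 nu p x0 r0 z H0.
have HKD := HK4 D Dloc D0.
have HK3' := fun y r r0' yr rr0 yx => HK3 H mH H0 x0 r0 y r r0' yr rr0 yx.
have mM := measurable_HL_maximal Dloc; have M0 := HL_maximalT_ge0 Dloc.
have HK5' := HK5 H A mH H0 HA x0 r0 r00.
have ID0 : (0 <= \int[leb]_z (D z `^ p)%:E)%E by apply: integral_ge0 => z _; rewrite lee_fin powR_ge0.
rewrite -/D in HK3' HK5'; clearbody D.
move: (HL_maximal D) mM M0 HKD HK3' => M mM M0 HKD HK3'.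
have KA : 0 < K2 * A by pos.
have mMp : measurable_fun setT (fun y => poweR (M y) p) := measurableT_comp (measurable_poweR _) mM.
pose c1 := K1 `^ s * (K2 * A) `^ (s - p); pose c2 := (K2 * A) `^ p * r0 `^ (- (d * p / q)).
have c10 : 0 <= c1 by rewrite /c1; pos.
have c20 : 0 <= c2 by rewrite /c2; pos.
pose f (y : R) : \bar R := ((K3 `^ p * `|y| `^ (- (d - 1)))%:E * poweR (M y) p)%E.
have f0 y : (0 <= f y)%E by rewrite /f; pos.
have mf : measurable_fun setT f by rewrite /f; mfun.
exists (fun y => c1%:E * (c2%:E + f y))%E; split.
- by mfun.
- by pos.
- move=> y r rr yr yx.
  have y0 : 0 < `|y| by apply: lt_le_trans yr; pos.
  have mnb' := measurable_near_sphere y r; have nb0' := near_sphere_ge0 y r.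
  have I0 : (0 <= \int[leb]_z ((H z)%:E * (nb y r z)%:E))%E by pos.
  have Ib := HK2 H A mH H0 A0 HA y r rr yr.
  have [i i0 Ei] := ge0_le_fin I0 Ib.
  pose m := i / r; have m0 : 0 <= m by rewrite /m divr_ge0// ltW.
  have mb : m <= K2 * A * r `^ (- (d / q)).
    by rewrite /m ler_pdivrMr//; move: Ib; rewrite Ei lee_fin.
  have W : (wavg H y r <= (K1 * r `^ (gamma - alpha - beta) * m)%:E)%E.
    apply: le_trans (HK1 H mH H0 y r rr yr) _; rewrite Ei -EFinM lee_fin /m.
    by apply: le_of_eq; ring.
  apply: le_trans (ler_poweR (ltW s0) (weighted_avg_ge0 _ _ _ _ _ _ H0) W) _.
  have S1 : (K1 * r `^ (gamma - alpha - beta) * m) `^ s <= c1 * m `^ p.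
    rewrite powRM//; last by pos.
    rewrite powRM ?powR_ge0 ?(ltW K10)// /c1 -mulrA -[leRHS]mulrA ler_wpM2l ?powR_ge0//.
    apply: (@le_trans _ _ ((r `^ (gamma - alpha - beta)) `^ s *
        ((K2 * A * r `^ (- (d / q))) `^ (s - p) * m `^ p))).
      by rewrite ler_wpM2l ?powR_ge0//; exact: powR_le_split.
    rewrite mulrA ler_wpM2r ?powR_ge0// (@powRM _ (K2 * A)) ?(ltW KA) ?powR_ge0//.
    (* The powers of r cancel: s (gamma - alpha - beta) - (s - p) d/q = d p/q - s b = 0. *)
    rewrite mulrCA -!powRrM (@powR_mulE _ r _ _ 0) ?powRr0 ?mulr1//.
    rewrite (_ : gamma - alpha - beta = d / q - b); last by rewrite hb; ring.
    by have := hsb; rewrite [X in _ -> X = _](_ : _ = d * p / q - s * b) => [->|]; ring.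
  rewrite poweR_EFin; apply: (@le_trans _ _ (c1 * m `^ p)%:E); first by rewrite lee_fin.
  rewrite EFinM; apply: lee_wpmul2l; first by rewrite lee_fin.
  have [rr0|r0r] := leP r r0.
    rewrite -[leLHS]add0e; apply: leeD; first by rewrite lee_fin.
    have J := HK3' y r rr yr rr0 yx; rewrite Ei in J.
    have J' : (m%:E <= (K3 * `|y| `^ (- ((d - 1) / p)))%:E * M y)%E.
      rewrite -(@lee_pmul2l _ r%:E)// muleA -EFinM -EFinM (_ : r * m = i).
        by rewrite mulrC.
      by rewrite /m mulrC divfK// gt_eqF.
    have := ler_poweR (ltW p0) _ J'; rewrite lee_fin => /(_ m0).
    rewrite poweR_EFin => /le_trans; apply; rewrite poweRM//; last by pos.
    rewrite poweR_EFin powRM ?powR_ge0 ?(ltW K30)// -powRrM mulNr divfK ?gt_eqF//.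
  apply: (@le_trans _ _ c2%:E); last by rewrite leeDl.
  rewrite lee_fin /c2; apply: (@le_trans _ _ ((K2 * A * r `^ (- (d / q))) `^ p)).
    by rewrite ge0_ler_powR ?nnegrE ?(ltW p0)//; pos.
  rewrite (@powRM _ (K2 * A)) ?(ltW KA) ?powR_ge0// ler_wpM2l ?powR_ge0//.
  rewrite -powRrM mulNr mulrAC !powRN lef_pV2 ?posrE ?powR_gt0// ge0_ler_powR ?nnegrE ?(ltW r00) ?(ltW rr) ?(ltW r0r)//.
  by pos.
- have E1 : (\int[mu]_y (c1%:E * (c2%:E + f y) * (nb x0 r0 y)%:E) =
      c1%:E * (c2%:E * \int[mu]_y (nb x0 r0 y)%:E + \int[mu]_y (f y * (nb x0 r0 y)%:E)))%E.
    rewrite -ge0_integralZl_real//; last by mfun.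
    rewrite -ge0_integralD//; [|by pos|by mfun|by pos|by mfun].
    rewrite -ge0_integralZl_real//; [|by mfun|by pos].
    by apply: eq_integral => y _; rewrite -muleA ge0_muleDl.
  rewrite E1 muleCA ge0_muleDr//; [|by pos|by pos].
  have N := HK6 x0 r0 r00; rewrite subr0 in N.
  have N1 : ((kb x0 r0)%:E * (c2%:E * \int[mu]_y (nb x0 r0 y)%:E) <= (c2 * (K6 * r0 `^ d))%:E)%E.
    rewrite muleCA [leRHS]EFinM; apply: lee_wpmul2l; first by rewrite lee_fin.
    apply: le_trans N; apply: lee_wpmul2l; first by rewrite lee_fin.
    apply: le_of_eq; apply: eq_integral => y _.
    by rewrite oppr0 powRr0 mul1e.
  (* The density |y|^(d-1) cancels the factor |y|^(-(d-1)) of [f], which leaves a Lebesgue integral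
     to which the strong maximal inequality applies. *)
  have N2 : (\int[mu]_y (f y * (nb x0 r0 y)%:E) <= (K3 `^ p * kappa)%:E * \int[leb]_y poweR (M y) p)%E.
    rewrite ge0_integral_dunkl//; [|by mfun|by pos].
    rewrite -ge0_integralZl_real//; [|by pos|by pos].
    have md := measurable_dunkl_density nu.
    apply: ge0_le_integralT.
    + by mfun.
    + by mfun.
    + move=> y; apply: mule_ge0; last by rewrite lee_fin dunkl_density_ge0.
      by apply: mule_ge0; rewrite ?lee_fin.
    + move=> y; rewrite /f -muleA muleAC; apply: lee_wpmul2r; first exact: poweR_ge0.
      rewrite -!EFinM lee_fin -mulrA ler_wpM2l ?powR_ge0// dunkl_densityE dunkl_dimB1.
      have [->|y0] := eqVneq y 0.
        by rewrite normr0 powR0 ?mul0r ?(ltW kappa0)// oppr_eq0 gt_eqF.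
      have y1 : 0 < `|y| by rewrite normr_gt0.
      rewrite [leLHS](_ : _ = kappa * nb x0 r0 y * (`|y| `^ (- (d - 1)) * `|y| `^ (d - 1))); last by ring.
      rewrite (@powR_mulE _ _ _ _ 0)// ?addNr// powRr0 mulr1 ler_piMr ?(ltW kappa0)//.
      by rewrite /near_sphere lern1; case: (_ < _).
  have N3 : ((kb x0 r0)%:E * \int[mu]_y (f y * (nb x0 r0 y)%:E) <=
      (K3 `^ p * kappa * K4 * (K5 * (A `^ p * r0 `^ (d - d * p / q))))%:E)%E.
    apply: le_trans (lee_wpmul2l _ N2) _; first by rewrite lee_fin.
    apply: (@le_trans _ _ ((kb x0 r0)%:E * ((K3 `^ p * kappa)%:E * (K4%:E * \int[leb]_z (D z `^ p)%:E)))%E).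
      by apply: lee_wpmul2l; [rewrite lee_fin|apply: lee_wpmul2l => //; pos].
    rewrite [leLHS](_ : _ = (K3 `^ p * kappa * K4)%:E *
      ((kb x0 r0)%:E * \int[leb]_z (D z `^ p)%:E))%E; last first.
      by rewrite [RHS]muleCA [in RHS]EFinM -!muleA.
    rewrite [leRHS]EFinM; apply: lee_wpmul2l; first by pos.
    exact: HK5'.
  apply: le_trans (lee_wpmul2l _ (leeD N1 N3)) _; first by rewrite lee_fin.
  rewrite -EFinD -EFinM lee_fin /c1 /c2; apply: le_of_eq.
  rewrite !powRM ?(ltW K20) ?(ltW A0)//.
  rewrite -(@powR_mulE _ A (s - p) p s) ?subrK//.
  rewrite -(@powR_mulE _ r0 (- (d * p / q)) d (d - d * p / q))//; last by ring.
  by ring.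
Qed.

(** If p < q then s b = d p/q < d and |y|^(-s b) is handled by [integral_near_sphere_powR]. If p = q
    then s b = d is the borderline: s - p powers are bounded pointwise, the other p by the Hardy
    operator. The exponent of r0 is then 0, so a bound over the whole line is enough. *)
Lemma far_bound : exists2 K : R, 0 < K & forall (H : R -> R) (A : R),
  measurable_fun setT H -> (forall z, 0 <= H z) -> 0 < A -> morrey_bound nu p q H A ->
  forall x0 r0, 0 < r0 -> exists Phi : R -> \bar R,
  [/\ measurable_fun setT Phi, forall y, (0 <= Phi y)%E,
      forall y r, y != 0 -> 0 < r -> `|y| <= 2 * r -> (poweR (wavg H y r) s <= Phi y)%E &
      ((kb x0 r0)%:E * \int[mu]_y (Phi y * (nb x0 r0 y)%:E) <=
       (K * (A `^ s * r0 `^ (d - d * p / q)))%:E)%E].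
Proof.
have [K1 K10 HK1] := weighted_avg_far hnu hp hb halpha hbeta.
have [pq|qp] := ltP p q.
  have sbd : 0 <= s * b < d.
    rewrite hsb divr_ge0 ?mulr_ge0 ?(ltW d0) ?(ltW p0) ?(ltW q0)//=.
    by rewrite ltr_pdivrMr// ltr_pM2l.
  have [K2 K20 HK2] := integral_near_sphere_powR hnu sbd.
  exists (K1 `^ s * K2); first by pos.
  move=> H A mH H0 A0 HA x0 r0 r00.
  have mnb := measurable_near_sphere x0 r0; have nb0 := near_sphere_ge0 x0 r0.
  exists (fun y => ((K1 * A) `^ s)%:E * (`|y| `^ (- (s * b)))%:E)%E; split.
  - by mfun.
  - by pos.
  - move=> y r y0 rr yr.
    have W := HK1 H A mH H0 A0 HA y r y0 rr yr.
    apply: le_trans (ler_poweR (ltW s0) (weighted_avg_ge0 _ _ _ _ _ _ H0) W) _.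
    rewrite poweR_EFin -EFinM lee_fin powRM ?powR_ge0 ?mulr_ge0 ?(ltW K10) ?(ltW A0)//.
    by rewrite -powRrM mulNr (mulrC b).
  - under eq_integral do rewrite -muleA.
    rewrite ge0_integralZl_real ?powR_ge0//; [|by mfun|by pos].
    rewrite muleCA; apply: le_trans (lee_wpmul2l _ (HK2 x0 r0 r00)) _.
      by rewrite lee_fin powR_ge0.
    rewrite -EFinM lee_fin powRM ?(ltW K10) ?(ltW A0)// hsb.
    by apply: le_of_eq; ring.
have {}qp : q = p by apply/le_anti/andP.
have hb' : b = d / p - (gamma - alpha - beta) by rewrite hb qp.
have ha' : alpha < d - d / p by rewrite -qp.
have [K2 K20 HK2] := weighted_avg_hardy hnu hp hb' ha' hbeta hgammad.
exists (K1 `^ (s - p) * K2); first by pos.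
move=> H A mH H0 A0 HA x0 r0 r00.
have mnb := measurable_near_sphere x0 r0; have nb0 := near_sphere_ge0 x0 r0.
have [Phi [mPhi Phi0 HPhi IPhi]] := HK2 H mH H0.
pose f (y : R) : \bar R := ((`|y| `^ (- ((gamma - alpha - beta) * p)))%:E * Phi y)%E.
have mf : measurable_fun setT f by rewrite /f; mfun.
have f0 y : (0 <= f y)%E by rewrite /f; pos.
exists (fun y => ((K1 * A) `^ (s - p))%:E * f y)%E; split.
- by mfun.
- by pos.
- move=> y r y0 rr yr; have y1 : 0 < `|y| by rewrite normr_gt0.
  have W := HK1 H A mH H0 A0 HA y r y0 rr yr.
  have [w w0 Ew] := ge0_le_fin (weighted_avg_ge0 nu gamma alpha beta y r H0) W.
  have := HPhi y r y0 rr yr; rewrite Ew !poweR_EFin => Hw.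
  apply: (@le_trans _ _ (((K1 * A) `^ (s - p) * `|y| `^ (- ((gamma - alpha - beta) * p)))%:E * (w `^ p)%:E)%E).
    rewrite Ew lee_fin in W; rewrite -EFinM lee_fin.
    apply: le_trans (powR_le_split w0 W) _; rewrite ler_wpM2r ?powR_ge0//.
    rewrite powRM ?powR_ge0 ?mulr_ge0 ?(ltW K10) ?(ltW A0)// -powRrM.
    (* Since s b = d, b (s - p) = d - b p = (gamma - alpha - beta) p, the power of the outer weight
       in [weighted_avg_hardy]. *)
    rewrite (_ : - b * (s - p) = - ((gamma - alpha - beta) * p))//.
    rewrite mulrBr mulNr (mulrC b s) hsb hb' qp; field; exact: lt0r_neq0.
  rewrite EFinM -muleA /f; do 2 (apply: lee_wpmul2l; first by rewrite lee_fin powR_ge0).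
  exact: Hw.
- under eq_integral do rewrite -muleA.
  rewrite ge0_integralZl_real ?powR_ge0//; [|by mfun|by pos].
  have I1 : (\int[mu]_y (f y * (nb x0 r0 y)%:E) <= (K2 * A `^ p)%:E)%E.
    apply: (@le_trans _ _ (\int[mu]_y f y)%E).
      apply: ge0_le_integralT => //.
      + by mfun.
      + by pos.
      + move=> y; rewrite -[leRHS]mule1 lee_wpmul2l// lee_fin /near_sphere lern1.
        by case: (_ < _).
    apply: le_trans IPhi _; rewrite EFinM; apply: lee_wpmul2l; first by rewrite lee_fin ltW.
    exact: (integral_dunkl_morrey qp mH H0 HA).
  apply: (@le_trans _ _ (1%:E * (((K1 * A) `^ (s - p))%:E * (K2 * A `^ p)%:E))%E).
    apply: lee_pmul.
    + by rewrite lee_fin ball_ratio_ge0.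
    + by pos.
    + by rewrite lee_fin ball_ratio_le1.
    + by apply: lee_wpmul2l => //; rewrite lee_fin powR_ge0.
  rewrite mul1e -EFinM lee_fin powRM ?(ltW K10) ?(ltW A0)// qp mulfK ?gt_eqF// subrr powRr0 mulr1.
  rewrite -(@powR_mulE _ A (s - p) p s) ?subrK//.
  by apply: le_of_eq; ring.
Qed.

(** [G] enters through one property: off the origin it lies below every common bound of the
    averages. This is what a suitable multiple of the weighted maximal function satisfies. *)
Lemma weighted_maximal_estimate : exists2 K : R, 0 < K & forall (H : R -> R) (A : R),
  measurable_fun setT H -> (forall z, 0 <= H z) -> 0 < A -> morrey_bound nu p q H A ->
  forall G : R -> \bar R, measurable_fun setT G -> (forall y, (0 <= G y)%E) ->
  (forall y B, y != 0 -> (forall r, 0 < r -> (wavg H y r <= B)%E) -> (G y <= B)%E) ->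
  forall x0 r0, 0 < r0 ->
  ((kb x0 r0)%:E * \int[mu]_y (poweR (G y) s * (nb x0 r0 y)%:E) <=
       (K * (A `^ s * r0 `^ (d - d * p / q)))%:E)%E.
Proof.
have [K1 K10 HK1] := local_bound.
have [K2 K20 HK2] := far_bound.
exists (K1 + K2); first by pos.
move=> H A mH H0 A0 HA G mG G0 HG x0 r0 r00.
have mnb := measurable_near_sphere x0 r0; have nb0 := near_sphere_ge0 x0 r0.
have kb0 := ball_ratio_ge0 nu x0 r0.
have [P [mP P0 HP IP]] := HK1 H A mH H0 A0 HA x0 r0 r00.
have [Q [mQ Q0 HQ IQ]] := HK2 H A mH H0 A0 HA x0 r0 r00.
have mGs : measurable_fun setT (fun y => poweR (G y) s) := measurableT_comp (measurable_poweR _) mG.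
apply: (@le_trans _ _ ((kb x0 r0)%:E * (\int[mu]_y (P y * (nb x0 r0 y)%:E) +
   \int[mu]_y (Q y * (nb x0 r0 y)%:E)))%E).
  apply: lee_wpmul2l; first by rewrite lee_fin.
  rewrite -ge0_integralD//; [|by pos|by mfun|by pos|by mfun].
  apply: ge0_integral_dunkl_le; [by mfun|by mfun|by pos|by pos|].
  move=> y y0; rewrite -ge0_muleDl// /near_sphere; case: ltP => yx; last by rewrite !mule0.
  rewrite !mule1.
  have PQ0 : (0 <= P y + Q y)%E by rewrite adde_ge0.
  (* [P] bounds the s-th powers of the averages with 2 r <= |y| and [Q] the others, so the s-th root
     of P + Q is a common bound. *)
  have GB : (G y <= poweR (P y + Q y) s^-1)%E.
    apply: HG => // r rr; have W0 := weighted_avg_ge0 nu gamma alpha beta y r H0.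
    rewrite -[leLHS](poweRe1 W0) -(divff (lt0r_neq0 s0)) poweRrM.
    apply: ler_poweR; rewrite ?invr_ge0 ?(ltW s0) ?poweR_ge0//.
    have [ry|yr] := leP (2 * r) `|y|.
      by rewrite -[leLHS]adde0 leeD// HP.
    by rewrite -[leLHS]add0e leeD// HQ// ltW.
  apply: le_trans (ler_poweR (ltW s0) (G0 y) GB) _.
  by rewrite -poweRrM mulVf ?gt_eqF// poweRe1.
rewrite ge0_muleDr; [|by pos|by pos].
apply: le_trans (leeD IP IQ) _; rewrite -EFinD lee_fin.
by apply: le_of_eq; ring.
Qed.

End core_estimate.

(** * Morrey norms and the maximal function *)

Section morrey_norm.
Context (R : realType) (nu p q : R).
Hypothesis hnu : - 2^-1 < nu.
Hypothesis hp : 1 < p.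
Local Notation mu := (dunkl_measure nu).
Local Notation d := (dunkl_dim nu).
Local Notation kb := (ball_ratio nu).

Let p0 : 0 < p. Proof. exact: lt_trans hp. Qed.

(** If |x| >= 2 r, the lower bound for translations is used at radius 2 r for x and for -x, and the
    two intervals of radius r cover the shell. If |x| < 2 r, the shell lies in the ball of radius 3
    r and the translation by 0 suffices. *)
Lemma morrey_bound_transl : exists2 K : R, 0 < K & forall (H : R -> R) (A : R),
  measurable_fun setT H -> (forall z, 0 <= H z) -> 0 < A ->
  dunkl_locfin nu (fun z => (H z `^ p)%:E) ->
  (forall x r, 0 < r ->
    (\int[mu]_(y in `](- r)%R, r[) dunkl_transl nu x (fun z => (H z `^ p)%:E) y <=
     (A `^ p * r `^ (d - d * p / q))%:E)%E) ->
  morrey_bound nu p q H (K * A).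
Proof.
have [C C0 HC] := dunkl_transl_ball_lower hnu.
have [k k0 Hk] := dunkl_transl0 hnu.
set E := d - d * p / q.
pose K := 2 * 2 `^ E / C + 3 `^ E / k; have K0 : 0 < K by rewrite /K; pos.
exists (K `^ p^-1); first by rewrite powR_gt0.
move=> H A mH H0 A0 lf HA x r r0.
pose g z := (H z `^ p)%:E; have mg : measurable_fun setT g by rewrite /g; mfun.
have g0 z : (0 <= g z)%E by rewrite /g lee_fin powR_ge0.
have kb0 := ball_ratio_ge0 nu x r.
have mnb := measurable_near_sphere x r; have nb0 := near_sphere_ge0 x r.
rewrite (powRM _ (powR_ge0 _ _) (ltW A0)) -powRrM mulVf ?gt_eqF// powRr1 ?(ltW K0)// -/E.
pose B := A `^ p * r `^ E; have B0 : 0 <= B by rewrite /B; pos.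
rewrite (_ : K * A `^ p * r `^ E = 2 * 2 `^ E / C * B + 3 `^ E / k * B); last by rewrite /K /B; ring.
have [xr|rx] := ltP `|x| (2 * r).
  have r3 : 0 < 3 * r by pos.
  apply: (@le_trans _ _ (3 `^ E / k * B)%:E); last by rewrite lee_fin lerDr; pos.
  apply: (@le_trans _ _ (1%:E * \int[mu]_z (g z * (`|z| < 3 * r)%R%:R%:E))%E).
    apply: lee_pmul.
    - by pos.
    - by pos.
    - by rewrite lee_fin ball_ratio_le1.
    - apply: ge0_le_integralT; [by mfun|by mfun|by pos|].
      move=> z; apply: lee_wpmul2l; [exact: g0|rewrite lee_fin; apply: ler_bool => h].
      by move: h; rewrite ltr_norml => /andP[]; move: xr; lra.
  rewrite mul1e; have := HA 0 _ r3; rewrite integral_mul_indic => I.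
  have J : (k%:E * \int[mu]_z (g z * (`|z| < 3 * r)%R%:R%:E) <= (A `^ p * (3 * r) `^ E)%:E)%E.
    apply: le_trans I; rewrite -ge0_integralZl_real ?(ltW k0)//; [|by mfun|by pos].
    apply: le_of_eq; apply: eq_integral => z _.
    by rewrite Hk// indic_ball muleA.
  rewrite -(@lee_pmul2l _ k%:E)//; apply: le_trans J _.
  rewrite -EFinM lee_fin powRM ?(ltW r0)// /B; apply: le_of_eq.
  by field; rewrite gt_eqF.
apply: (@le_trans _ _ (2 * 2 `^ E / C * B)%:E); last by rewrite lee_fin lerDl; pos.
have r2 : 0 < 2 * r by pos.
have L y : `|y| = `|x| -> ((C * kb x r)%:E * \int[mu]_z (g z * (`|z - y| < r)%R%:R%:E) <= (2 `^ E * B)%:E)%E.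
  move=> yx; have := HC g y (2 * r) r2; rewrite yx => /(_ rx mg g0 lf).
  rewrite mulrAC divff ?mul1r// => I.
  have := le_trans I (HA y _ r2); rewrite -/E => J.
  apply: le_trans (le_trans _ J) _.
    apply: lee_wpmul2r; first by pos.
    rewrite lee_fin ler_wpM2l ?(ltW C0)//.
    rewrite {2}/ball_ratio yx -/(ball_ratio nu x (2 * r)).
    by apply: ball_ratio_mono => //; move: r0; lra.
  by rewrite lee_fin powRM ?(ltW r0)// /B mulrCA.
rewrite -(@lee_pmul2l _ C%:E)// muleA -EFinM.
apply: (@le_trans _ _ ((C * kb x r)%:E * (\int[mu]_z (g z * (`|z - x| < r)%R%:R%:E) +
   \int[mu]_z (g z * (`|z - (- x)| < r)%R%:R%:E)))%E).
  apply: lee_wpmul2l; first by pos.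
  rewrite -ge0_integralD//; [|by pos|by mfun|by pos|by mfun].
  apply: ge0_le_integralT; [by mfun|by mfun|by pos|].
  move=> z; rewrite /g -!EFinM -EFinD lee_fin -mulrDr ler_wpM2l ?powR_ge0//.
  by rewrite opprK near_sphere_le.
rewrite ge0_muleDr; [|by pos|by pos].
apply: le_trans (leeD (L x _) (L (- x) _)) _ => //; first by rewrite normrN.
rewrite -EFinD -EFinM lee_fin; apply: le_of_eq.
by field; rewrite gt_eqF.
Qed.

End morrey_norm.

(** * Measurability of the maximal function *)

Section fmax_measurable.
Context (R : realType) (nu gamma : R).
Hypothesis hnu : - 2^-1 < nu.
Hypothesis hgammad : gamma < dunkl_dim nu.
Local Notation mu := (dunkl_measure nu).
Local Notation d := (dunkl_dim nu).
Local Notation kappa := (dunkl_cst nu).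
Local Notation c := (dunkl_transl_const nu / 2).

Let d0 : 0 < d. Proof. exact: lt_trans (dunkl_dim_gt1 hnu). Qed.
Let c0 : 0 < c. Proof. by rewrite divr_gt0// dunkl_transl_const_gt0. Qed.
Let kappa0 : 0 < kappa. Proof. by apply: dunkl_cst_gt0; move: hnu; lra. Qed.

Definition fmax_normalization (r : R) : R :=
  (fine (dunkl_measure nu `](- r), r[) `^ (1 - gamma / d))^-1.

Lemma fmax_normalizationE r : 0 < r ->
  fmax_normalization r = ((2 * kappa / d) `^ (1 - gamma / d))^-1 * r `^ (gamma - d).
Proof.
move=> r0; have k0 : 0 < 2 * kappa / d by pos.
rewrite /fmax_normalization dunkl_measure_ball//= powRM ?powR_ge0 ?(ltW k0)// -powRrM invfM.
by congr (_ * _); rewrite -powRN; congr (_ `^ _); field; rewrite gt_eqF.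
Qed.

Lemma fmax_normalization_gt0 r : 0 < r -> 0 < fmax_normalization r.
Proof.
move=> r0; have k0 : 0 < 2 * kappa / d by pos.
by rewrite fmax_normalizationE//; pos.
Qed.

Lemma fmax_normalization_le r r' : 0 < r -> r <= r' ->
  fmax_normalization r' <= fmax_normalization r.
Proof.
move=> r0 rr; have r'0 : 0 < r' by apply: lt_le_trans rr.
rewrite !fmax_normalizationE// ler_wpM2l ?invr_ge0 ?powR_ge0//.
rewrite -(opprB d gamma) !powRN lef_pV2 ?posrE ?powR_gt0//.
by rewrite ge0_ler_powR ?nnegrE ?(ltW r0) ?(ltW r'0)// subr_ge0 ltW.
Qed.

Lemma dunkl_ball_int_mono (g : R -> \bar R) x r r' : measurable_fun setT g ->
  (forall z, (0 <= g z)%E) -> r <= r' ->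
  (dunkl_ball_int nu x r g <= dunkl_ball_int nu x r' g)%E.
Proof.
move=> mg g0 rr; apply: ge0_subset_integral => //.
- by apply: measurable_funTS; exact: measurable_dunkl_inner1.
- by move=> y _; exact: dunkl_inner_ge0.
- by move=> y /=; rewrite !in_itv/= -!ltr_norml => /lt_le_trans; apply.
Qed.

(** Monotone convergence along the radii r - r/(n+1) gives left-continuity in r, and a rational lies
    between each of them and r. *)
Lemma dunkl_ball_int_left (g : R -> \bar R) (x r : R) (B : \bar R) : measurable_fun setT g ->
  (forall z, (0 <= g z)%E) -> 0 < r ->
  (forall q : rat, (0 : R) < ratr q < r -> (dunkl_ball_int nu x (ratr q) g <= B)%E) ->
  (dunkl_ball_int nu x r g <= B)%E.
Proof.
move=> mg g0 r0 HB; have mI := measurable_dunkl_inner1 nu x mg g0.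
pose s (n : nat) := r - r / n.+1%:R.
pose F (n : nat) : set R := `](- s n), s n[%classic.
have mF n : measurable (F n) by exact: measurable_itv.
have s_lt n : s n < r by rewrite /s ltrBlDr ltrDl divr_gt0.
have s_ge n : 0 <= s n.
  by rewrite /s subr_ge0 ler_pdivrMr// ler_peMr ?(ltW r0)// ler1n.
have s_mono n m : (n <= m)%N -> s n <= s m.
  move=> nm; rewrite /s lerD2l lerN2 ler_pM2l// lef_pV2 ?posrE// ler_nat.
  by [].
have ndF : {homo F : n m / (n <= m)%N >-> (n <= m)%O}.
  move=> n m nm; apply/subsetPset => z; rewrite /F/= !in_itv/= -!ltr_norml => zn.
  by apply: lt_le_trans zn _; exact: s_mono.
have UF : \bigcup_n F n = `](- r), r[%classic.
  apply/seteqP; split => z.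
    move=> [n _]; rewrite /F/= !in_itv/= -!ltr_norml => /lt_trans; apply; exact: s_lt.
  rewrite /= in_itv/= -ltr_norml => zr.
  have rz : 0 < r - `|z| by rewrite subr_gt0.
  exists (Num.truncn (r / (r - `|z|))) => //; rewrite /F/= in_itv/= -ltr_norml /s.
  rewrite ltrBrDl addrC -ltrBrDl ltr_pdivrMr// mulrC -ltr_pdivrMr//.
  exact: truncnS_gt.
have := @ge0_nondecreasing_set_cvg_integral _ _ R F _ mu ndF mF
  (fun i => measurable_funTS mI) (fun i y _ => dunkl_inner_ge0 nu x y g0).
rewrite UF => cv; rewrite /dunkl_ball_int -(cvg_lim _ cv)//.
apply: lime_le; first by apply/cvg_ex; eexists; exact: cv.
apply: nearW => n; have [q /[!in_itv]/= /andP[q1 q2]] := rat_in_itvoo (s_lt n).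
have q0 : 0 < ratr q :> R by apply: le_lt_trans q1.
apply: le_trans (HB q _); last by rewrite q0.
by apply: (dunkl_ball_int_mono x mg g0); exact: ltW.
Qed.

Variable f : R -> R[i].
Hypothesis mf : measurable_fun setT (cmodulus f).
Hypothesis lf : dunkl_locfin nu (cmodulus f).

Let f0 z : (0 <= cmodulus f z)%E.
Proof. by rewrite /cmodulus lee_fin; case: (f z) => a b; exact: sqrtr_ge0. Qed.

Lemma dunkl_fmax_avgE y r : y != 0 -> 0 < r -> dunkl_fmax_avg nu gamma f y r =
  ((fmax_normalization r * c)%:E * dunkl_ball_int nu y r (cmodulus f))%E.
Proof.
move=> y0 r0; rewrite /dunkl_fmax_avg (dunkl_transl_ball hnu y0 r0 mf f0 lf).
by rewrite muleA.
Qed.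

(** The averages with rational radius, enumerated. Indices that code no positive rational get 0,
    which is below the maximal function because the averages are nonnegative. *)
Let u (n : nat) (y : R) : \bar R :=
  if unpickle n is Some q then
    let r : R := ratr q in
    if 0 < r then ((fmax_normalization r * c)%:E * dunkl_ball_int nu y r (cmodulus f))%E else 0%E
  else 0%E.

Let mu_ n : measurable_fun setT (u n).
Proof.
rewrite /u; case: (unpickle n) => [q|]; last exact: measurable_cst.
rewrite /=; case: (0 < _); last exact: measurable_cst.
by apply: emeasurable_funM => //; exact: measurable_dunkl_ball_int.
Qed.

(** Off the origin the supremum may be taken over rational radii: the ball integral is
    left-continuous in r and the normalization decreases. The origin is set apart because
    [dunkl_fmax_avgE] holds for y <> 0. *)
Lemma measurable_dunkl_fmax : measurable_fun setT (dunkl_fmax nu gamma f).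
Proof.
pose S y := esups (u ^~ y) 0%N.
have mS : measurable_fun setT S by exact: measurable_fun_esups.
have E y : dunkl_fmax nu gamma f y = if y == 0 then dunkl_fmax nu gamma f 0 else S y.
  have [->//|y0] := eqVneq y 0.
  have u_le n : (u n y <= S y)%E.
    by apply: ereal_sup_ubound; exists n.
  apply/eqP; rewrite eq_le; apply/andP; split.
  - apply: ge_ereal_sup => _ [r /= r0 <-]; rewrite dunkl_fmax_avgE//.
    have k0 : 0 < fmax_normalization r * c by rewrite mulr_gt0// fmax_normalization_gt0.
    rewrite muleC -lee_pdivlMr//; apply: dunkl_ball_int_left => // q /andP[q0 qr].
    rewrite lee_pdivlMr//; have := u_le (pickle q).
    rewrite /u pickleK/= q0; apply: le_trans; rewrite muleC.
    apply: lee_wpmul2r; first exact: dunkl_ball_int_ge0.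
    rewrite lee_fin; apply: ler_wpM2r; first exact: ltW.
    by apply: fmax_normalization_le; [exact: q0|exact: ltW].
  - have fr r : 0 < r -> ((fmax_normalization r * c)%:E * dunkl_ball_int nu y r (cmodulus f) <=
      dunkl_fmax nu gamma f y)%E.
      by move=> r0; apply: ereal_sup_ubound; exists r => //; exact: dunkl_fmax_avgE.
    have fmax0 : (0 <= dunkl_fmax nu gamma f y)%E.
      apply: le_trans (fr 1 ltr01); apply: mule_ge0; last exact: dunkl_ball_int_ge0.
      by rewrite lee_fin mulr_ge0 ?(ltW c0)// ltW// fmax_normalization_gt0.
    apply: ge_ereal_sup => _ [n _ <-]; rewrite /u.
    by case: (unpickle n) => [q|]//; case: ifP => // q0; exact: fr.
rewrite (_ : dunkl_fmax nu gamma f = fun y => if y == 0 then dunkl_fmax nu gamma f 0 else S y).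
  apply: measurable_fun_ifT => //.
  exact: measurable_fun_eqr.
by apply/funext.
Qed.

End fmax_measurable.

Section moduli.
Context (R : realType).

Definition cnorm (f : R -> R[i]) (z : R) : R := ComplexField.Normc.normc (f z).

Lemma cnorm_ge0 f z : 0 <= cnorm f z.
Proof. by rewrite /cnorm; case: (f z) => x y; exact: sqrtr_ge0. Qed.

Lemma measurable_cnorm f : cmeasurable f -> measurable_fun setT (cnorm f).
Proof.
move=> [mr mi]; rewrite (_ : cnorm f = fun z => Num.sqrt (complex.Re (f z) ^+ 2 + complex.Im (f z) ^+ 2)).
  by mfun.
by apply/funext => z; rewrite /cnorm; case: (f z).
Qed.

Lemma cnorm_cpow_weight a f z : cnorm (cpow_weight a f) z = `|z| `^ a * cnorm f z.
Proof.
rewrite /cnorm /cpow_weight ComplexField.Normc.normcM; congr (_ * _).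
by rewrite /= expr0n addr0 sqrtr_sqr ger0_norm ?powR_ge0.
Qed.

Lemma cmodulusE f : cmodulus f = fun z => (cnorm f z)%:E.
Proof. by []. Qed.

Lemma poweR_cmodulus f p : (fun z => poweR `|cmodulus f z|%E p) = fun z => (cnorm f z `^ p)%:E.
Proof.
by apply/funext => z; rewrite cmodulusE gee0_abs ?lee_fin ?cnorm_ge0// poweR_EFin.
Qed.

End moduli.

Section assembly.
Context (R : realType) (nu p q s t gamma alpha beta : R).
Hypothesis hnu : - 2^-1 < nu.
Hypothesis hp : 1 < p.
Hypothesis hpq : p <= q.
Hypothesis hps : p <= s.
Local Notation mu := (dunkl_measure nu).
Local Notation d := (dunkl_dim nu).
Local Notation kb := (ball_ratio nu).
Local Notation nb := (@near_sphere R).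
Local Notation kappa := (dunkl_cst nu).
Hypothesis hb : d / t = d / q - (gamma - alpha - beta).
Hypothesis hsb : s * (d / t) = d * p / q.
Hypothesis hab : 0 <= alpha + beta.
Hypothesis halpha : alpha < d - d / q.
Hypothesis hbeta : beta < d / t.
Hypothesis hgammad : gamma < d.

Let p0 : 0 < p. Proof. exact: lt_trans hp. Qed.
Let q0 : 0 < q. Proof. exact: lt_le_trans hpq. Qed.
Let s0 : 0 < s. Proof. exact: lt_le_trans hps. Qed.
Let d0 : 0 < d. Proof. exact: lt_trans (dunkl_dim_gt1 hnu). Qed.
Let kappa0 : 0 < kappa. Proof. by apply: dunkl_cst_gt0; move: hnu; lra. Qed.

Lemma dunkl_morrey_avg_le (a b : R) (g : R -> \bar R) (A x r : R) : 0 < a -> 0 < A -> 0 < r ->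
  (0 <= \int[mu]_(y in `](- r)%R, r[) dunkl_transl nu x (fun z => poweR `|g z|%E a) y)%E ->
  (dunkl_morrey_avg nu a b g x r <= A%:E)%E <->
  (\int[mu]_(y in `](- r)%R, r[) dunkl_transl nu x (fun z => poweR `|g z|%E a) y <=
    (A `^ a * r `^ (d - d * a / b))%:E)%E.
Proof.
move=> a0 A0 r0; rewrite /dunkl_morrey_avg; set I := (\int[_]_(_ in _) _)%E => I0.
have re : 0 < r `^ (d * (b^-1 - a^-1)) by rewrite powR_gt0.
have E : A `^ a * r `^ (d - d * a / b) = (A / r `^ (d * (b^-1 - a^-1))) `^ a.
  rewrite powR_divr ?(ltW A0)// -powRrM -powRN; congr (_ * _ `^ _).
  by move: (b^-1) => bi; field; rewrite gt_eqF.
rewrite E muleC -lee_pdivlMr//; split => h.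
- have := ler_poweR (ltW a0) (poweR_ge0 _ _) h.
  by rewrite -poweRrM mulVf ?gt_eqF// poweRe1// -EFinM poweR_EFin.
- have ai : 0 <= a^-1 by rewrite invr_ge0 ltW.
  have := ler_poweR ai I0 h.
  by rewrite poweR_EFin -powRrM mulfV ?gt_eqF// powRr1// divr_ge0 ?(ltW A0) ?(ltW re).
Qed.

Lemma locfin_of_locally_integrable (g : R -> \bar R) : (forall z, (0 <= g z)%E) ->
  dunkl_locally_integrable nu g -> dunkl_locfin nu g.
Proof.
move=> g0 [mg hg] b b0; apply: le_lt_trans (hg _ (@segment_compact _ (- b) b)).
under [leRHS]eq_integral do rewrite gee0_abs//.
apply: ge0_subset_integral => //; first exact: measurable_funTS.
by move=> z /=; rewrite !in_itv/= => /andP[/ltW -> /ltW ->].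
Qed.

(** The kernel being signed, this is not a pointwise fact: it holds over balls, through the
    nonnegative integrand of [dunkl_ball_int]. *)
Lemma dunkl_transl_ball_ge0 (g : R -> \bar R) x r : 0 < r -> measurable_fun setT g ->
  (forall z, (0 <= g z)%E) -> dunkl_locfin nu g ->
  (0 <= \int[mu]_(y in `](- r)%R, r[) dunkl_transl nu x g y)%E.
Proof.
move=> r0 mg g0 lf; have [->|x0] := eqVneq x 0.
  have [k k0 Hk] := dunkl_transl0 hnu.
  apply: integral_ge0 => y _; rewrite Hk//; apply: mule_ge0 => //.
  by rewrite lee_fin ltW.
rewrite (dunkl_transl_ball hnu x0 r0 mg g0 lf); apply: mule_ge0.
  by rewrite lee_fin ltW// divr_gt0// dunkl_transl_const_gt0.
exact: dunkl_ball_int_ge0.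
Qed.

Lemma dunkl_fmax_morrey : exists2 C : R, 0 < C & forall (f : R -> R[i]) (A : R), 0 < A ->
  dunkl_morrey nu p q (cpow_weight alpha f) ->
  (dunkl_morrey_norm nu p q (cmodulus (cpow_weight alpha f)) <= A%:E)%E ->
  (dunkl_morrey_norm nu s t (epow_weight (- beta) (dunkl_fmax nu gamma f)) <= (C * A)%:E)%E.
Proof.
have [K1 K10 HK1] := morrey_bound_transl q hnu hp.
have [K2 K20 HK2] := weighted_maximal_estimate hnu hp hpq hps hb hsb hab halpha hbeta hgammad.
have [K3 K30 HK3] := dunkl_transl_ball_upper hnu.
have [K4 K40 HK4] := integral_morrey_weight hnu hp halpha.
pose N0 := (2 * kappa / d) `^ (1 - gamma / d).
have N00 : 0 < N0 by rewrite /N0; pos.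
pose c2 := K3 / N0; have c20 : 0 < c2 by rewrite /c2; pos.
(* [K1] is the cost of passing from translations to shells for H, [c2] that of comparing the maximal
   averages with [weighted_avg]. [K2] is the weighted estimate and [K3] the return to translations;
   these two multiply s-th powers, hence the root. *)
exists ((K3 * K2) `^ s^-1 * c2 * K1); first by pos.
move=> f A A0 [cmh _ hfin] hA.
set h := cpow_weight alpha f in cmh hfin hA.
pose H := cnorm h; have mH : measurable_fun setT H := measurable_cnorm cmh.
have H0 z : 0 <= H z := cnorm_ge0 h z.
have mHp : measurable_fun setT (fun z => (H z `^ p)%:E) by mfun.
have Hp0 z : (0 <= (H z `^ p)%:E)%E by rewrite lee_fin powR_ge0.
have [loch normE] : dunkl_locally_integrable nu (fun z => poweR `|cmodulus h z|%E p) /\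
    forall x r, 0 < r -> (dunkl_morrey_avg nu p q (cmodulus h) x r <= A%:E)%E.
  move: hfin hA; rewrite /dunkl_morrey_norm; case: asboolP => // lh _ hA; split => // x r r0.
  by apply: le_trans hA; apply: ereal_sup_ubound; exists x => //; exists r.
rewrite poweR_cmodulus in loch.
have lfH := locfin_of_locally_integrable Hp0 loch.
have HA' : forall x r, 0 < r ->
    (\int[mu]_(y in `](- r)%R, r[) dunkl_transl nu x (fun z => (H z `^ p)%:E) y <=
     (A `^ p * r `^ (d - d * p / q))%:E)%E.
  move=> x r r0; have I0 := dunkl_transl_ball_ge0 x r0 mHp Hp0 lfH.
  have := @dunkl_morrey_avg_le p q (cmodulus h) A x r p0 A0 r0.
  by rewrite poweR_cmodulus => /(_ I0)[+ _]; apply; exact: normE.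
have HA := HK1 H A mH H0 A0 lfH HA'.
have KA : 0 < K1 * A by pos.
have FE z : z != 0 -> cmodulus f z = (`|z| `^ (- alpha) * H z)%:E.
  move=> z0; rewrite /cmodulus -/(cnorm f z) /H cnorm_cpow_weight mulrA.
  by rewrite (@powR_mulE _ _ _ _ 0) ?normr_gt0 ?addNr// powRr0 mul1r.
(* Measurability is given for the weighted function only; f is recovered from it off the origin,
   where the weight is invertible. *)
have mF : measurable_fun setT (cmodulus f).
  rewrite (_ : cmodulus f = fun z => if z == 0 then cmodulus f 0 else (`|z| `^ (- alpha) * H z)%:E).
    apply: measurable_fun_ifT => //; last by mfun.
    exact: measurable_fun_eqr.
  by apply/funext => z; have [->//|z0] := eqVneq z 0; exact: FE.
have F0 z : (0 <= cmodulus f z)%E by rewrite lee_fin cnorm_ge0.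
have F_le x r : (\int[mu]_z (cmodulus f z * (nb x r z)%:E) <=
    \int[mu]_z ((`|z| `^ (- alpha) * H z)%:E * (nb x r z)%:E))%E.
  have mnb := measurable_near_sphere x r; have nb0 := near_sphere_ge0 x r.
  apply: ge0_integral_dunkl_le.
  - by mfun.
  - by mfun.
  - by pos.
  - by pos.
  - by move=> z z0; rewrite FE.
have lfF : dunkl_locfin nu (cmodulus f).
  move=> b b0; rewrite integral_mul_indic.
  under eq_integral do rewrite indic_ball -near_sphere0.
  apply: le_lt_trans (F_le 0 b) _; under eq_integral do rewrite near_sphere0.
  by apply: le_lt_trans (HK4 H _ mH H0 KA HA b b0) _; rewrite ltry.
have mfm := measurable_dunkl_fmax hnu hgammad mF lfF.
pose G := epow_weight (- beta) (dunkl_fmax nu gamma f).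
have mG : measurable_fun setT G by rewrite /G /epow_weight; mfun.
have G0 y : (0 <= G y)%E.
  apply: mule_ge0; first by rewrite lee_fin powR_ge0.
  apply: (@le_trans _ _ (dunkl_fmax_avg nu gamma f y 1)).
    apply: mule_ge0; first by rewrite lee_fin invr_ge0 powR_ge0.
    exact: dunkl_transl_ball_ge0.
  by apply: ereal_sup_ubound; exists 1 => //=.
(* Dividing by [c2] absorbs the constants of the translation bound and of the measure of balls, as
   the weighted estimate refers to [weighted_avg] itself. *)
pose G' y := ((c2^-1)%:E * G y)%E.
have mG' : measurable_fun setT G' by rewrite /G'; mfun.
have c2i : 0 < c2^-1 by rewrite invr_gt0.
have G'0 y : (0 <= G' y)%E by apply: mule_ge0 => //; rewrite lee_fin ltW.
have HG' y B : y != 0 ->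
    (forall r, 0 < r -> (weighted_avg nu gamma alpha beta H y r <= B)%E) -> (G' y <= B)%E.
  move=> y0 hB; have y1 : 0 < `|y| by rewrite normr_gt0.
  rewrite /G' /G /epow_weight muleA -EFinM muleC.
  have X0 : 0 < c2^-1 * `|y| `^ (- beta) by pos.
  rewrite -lee_pdivlMr//; apply: ge_ereal_sup => _ [r /= r0 <-].
  rewrite lee_pdivlMr//; apply: le_trans (hB r r0).
  rewrite /dunkl_fmax_avg -/(fmax_normalization nu gamma r).
  have n0 := fmax_normalization_gt0 gamma hnu r0.
  apply: (@le_trans _ _ (((fmax_normalization nu gamma r)%:E * ((K3 * kb y r)%:E *
     \int[mu]_z ((`|z| `^ (- alpha) * H z)%:E * (nb y r z)%:E))) * (c2^-1 * `|y| `^ (- beta))%:E)%E).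
    apply: lee_wpmul2r; first by rewrite lee_fin ltW.
    apply: lee_wpmul2l; first by rewrite lee_fin ltW.
    apply: le_trans (HK3 _ y r r0 mF F0 lfF) _.
    apply: lee_wpmul2l; last exact: F_le.
    by rewrite lee_fin mulr_ge0 ?ball_ratio_ge0 ?(ltW K30).
  rewrite muleC !muleA -!EFinM /weighted_avg; apply: le_of_eq.
  congr (_%:E * _)%E; rewrite fmax_normalizationE// -/N0 /c2.
  by field; rewrite !gt_eqF.
have core := HK2 H _ mH H0 KA HA G' mG' G'0 HG'.
pose E := d - d * p / q.
have coreG x r : 0 < r -> ((kb x r)%:E * \int[mu]_y (poweR (G y) s * (nb x r y)%:E) <=
    (K2 * (c2 * K1 * A) `^ s * r `^ E)%:E)%E.
  move=> r0; have mnb := measurable_near_sphere x r; have nb0 := near_sphere_ge0 x r.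
  have mG's : measurable_fun setT (fun y => poweR (G' y) s) := measurableT_comp (measurable_poweR _) mG'.
  have -> : (\int[mu]_y (poweR (G y) s * (nb x r y)%:E) =
      (c2 `^ s)%:E * \int[mu]_y (poweR (G' y) s * (nb x r y)%:E))%E.
    rewrite -ge0_integralZl_real ?powR_ge0//; [|by mfun|by pos].
    apply: eq_integral => y _; rewrite muleA -poweR_EFin -poweRM//; last by rewrite lee_fin ltW.
    by rewrite /G' muleA -EFinM mulfV ?gt_eqF// mul1e.
  rewrite muleCA; apply: le_trans (lee_wpmul2l _ (core x r r0)) _; first by rewrite lee_fin powR_ge0.
  rewrite -EFinM lee_fin -/E -(mulrA c2) (@powRM _ c2) ?(ltW c20) ?(ltW KA)//.
  by apply: le_of_eq; ring.
have mGs : measurable_fun setT (fun y => poweR (G y) s) := measurableT_comp (measurable_poweR _) mG.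
have Gs0 y : (0 <= poweR (G y) s)%E by exact: poweR_ge0.
have absG : (fun z => poweR `|G z|%E s) = fun z => poweR (G z) s.
  by apply/funext => z; rewrite gee0_abs.
have lfG : dunkl_locfin nu (fun z => poweR (G z) s).
  move=> b b0; rewrite integral_mul_indic.
  under eq_integral do rewrite indic_ball -near_sphere0.
  by have := coreG 0 b b0; rewrite ball_ratio0// mul1e => /le_lt_trans; apply; rewrite ltry.
(* The norm is infinite unless the s-th power is locally integrable; a compact set lies in a ball,
   where [lfG], the estimate at x = 0, applies. *)
rewrite /dunkl_morrey_norm -/G absG asboolT; last first.
  split => // K cK; have [M [_ HM]] := compact_bounded cK.
  pose b := Num.max M 0 + 1; have b0 : 0 < b by rewrite /b ltr_wpDl// le_max lexx orbT.
  have Mb : M < b by rewrite /b ltr_pwDr// le_max lexx.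
  have b1 : 0 < b + 1 by pos.
  apply: le_lt_trans (lfG (b + 1) b1).
  under eq_integral do rewrite gee0_abs//.
  apply: ge0_subset_integral => //; first exact: compact_measurable.
    exact: measurable_funTS.
  move=> y Ky; rewrite /= in_itv/= -ltr_norml; apply: le_lt_trans (HM _ Mb y Ky) _.
  by rewrite ltrDl.
apply: ge_ereal_sup => _ [x _ [r /= r0 <-]].
have C0 : 0 < (K3 * K2) `^ s^-1 * c2 * K1 * A by pos.
have := @dunkl_morrey_avg_le s t G _ x r s0 C0 r0; rewrite absG.
move=> /(_ (dunkl_transl_ball_ge0 x r0 mGs Gs0 lfG))[_]; apply. apply: le_trans (HK3 _ x r r0 mGs Gs0 lfG) _.
rewrite EFinM -muleA; apply: le_trans (lee_wpmul2l _ (coreG x r r0)) _; first by rewrite lee_fin ltW.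
rewrite -EFinM lee_fin -2!(mulrA (_ `^ s^-1)) (@powRM _ ((K3 * K2) `^ s^-1)) ?powR_ge0//; last by pos.
rewrite -powRrM mulVf ?gt_eqF// powRr1; last by pos.
rewrite (_ : d - d * s / t = E); last by rewrite /E -hsb; ring.
by apply: le_of_eq; ring.
Qed.

End assembly.

Lemma dunkl_morrey_norm_ge0 (R : realType) (nu p q : R) (g : R -> \bar R) :
  (0 <= dunkl_morrey_norm nu p q g)%E.
Proof.
rewrite /dunkl_morrey_norm; case: asboolP => // _.
apply: (@le_trans _ _ (dunkl_morrey_avg nu p q g 0 1)).
  by apply: mule_ge0; [rewrite lee_fin powR_ge0|exact: poweR_ge0].
by apply: ereal_sup_ubound; exists 0 => //; exists 1 => //=.
Qed.

Theorem corollary4p2 (R : realType) (nu gamma alpha beta p q q' s t : R)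
  (hnu : - 2^-1 <= nu)
  (hgamma0 : 0 < gamma) (hgammad : gamma < dunkl_dim nu)
  (hab0 : 0 <= alpha + beta) (habg : alpha + beta <= gamma)
  (hp : 1 < p) (hpq : p <= q)
  (hq : gamma != alpha + beta -> q < dunkl_dim nu / (gamma - alpha - beta))
  (hs : 1 < s) (hst : s <= t)
  (ht : t^-1 = q^-1 - (gamma - alpha - beta) / dunkl_dim nu)
  (hstpq : s / t = p / q)
  (hq' : q^-1 + q'^-1 = 1)
  (halpha : alpha < dunkl_dim nu / q')
  (hbeta : beta < dunkl_dim nu / t)
  (hdt : t < dunkl_dim nu) :
  exists C : R, 0 < C /\
    forall f : R -> R[i], dunkl_morrey nu p q (cpow_weight alpha f) ->
      (dunkl_morrey_norm nu s t (epow_weight (- beta) (dunkl_fmax nu gamma f))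
       <= C%:E * dunkl_morrey_norm nu p q (cmodulus (cpow_weight alpha f)))%E.
Proof.
have t1 : 1 < t by apply: lt_le_trans hst.
have hnu' : - 2^-1 < nu by have := lt_trans t1 hdt; rewrite dunkl_dimE; lra.
have d0 : 0 < dunkl_dim nu by apply: lt_trans hdt; apply: lt_trans t1.
have t0 : 0 < t by apply: lt_trans t1.
have q0 : 0 < q by apply: lt_le_trans hpq; apply: lt_trans hp.
have hb : dunkl_dim nu / t = dunkl_dim nu / q - (gamma - alpha - beta).
  by rewrite ht mulrBr; congr (_ - _); rewrite mulrCA mulfV ?mulr1// gt_eqF.
have hsb : s * (dunkl_dim nu / t) = dunkl_dim nu * p / q.
  by rewrite mulrCA hstpq mulrA.
have ha : alpha < dunkl_dim nu - dunkl_dim nu / q.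
  have -> : dunkl_dim nu - dunkl_dim nu / q = dunkl_dim nu * (q^-1 + q'^-1) - dunkl_dim nu / q.
    by rewrite hq' mulr1.
  by rewrite mulrDr addrAC subrr add0r.
have hqt : q <= t.
  rewrite -lef_pV2 ?posrE// ht gerBl divr_ge0 ?(ltW d0)//.
  by move: habg; lra.
(* s = t p/q, and q <= t because gamma - alpha - beta >= 0. *)
have hps : p <= s.
  have -> : s = t * (p / q) by rewrite -hstpq mulrC divfK// gt_eqF.
  rewrite mulrA ler_pdivlMr// mulrC ler_pM2r//.
  exact: lt_trans hp.
have [C C0 HC] := dunkl_fmax_morrey hnu' hp hpq hps hb hsb hab0 ha hbeta hgammad.
exists C; split => // f hf; have [_ _ hfin] := hf.
have := dunkl_morrey_norm_ge0 nu p q (cmodulus (cpow_weight alpha f)).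
have := HC f; move: hfin.
case: (dunkl_morrey_norm nu p q _) => [A _||]//= H.
rewrite lee_fin le_eqVlt => /predU1P[A0|A0]; last by rewrite -EFinM; exact: H.
(* The estimate is stated for A > 0. When the norm is 0 it is applied with A = e/C for every e >
   0. *)
rewrite -A0 mule0; apply/lee_addgt0Pr => e e0; rewrite add0e.
have := H (e / C) (divr_gt0 e0 C0) hf; rewrite (_ : C * (e / C) = e).
  by apply; rewrite -A0 lee_fin divr_ge0// ltW.
by rewrite mulrC divfK// gt_eqF.
Qed.
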